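(* Let $f$ be a density supported on $\mathcal{S}_d$ such that $f\in C^2(\mathrm{Int}(\mathcal{S}_d))$ and such that there exist an open set $\mathcal{U}\subseteq\mathbb{R}^d$ containing $\mathcal{S}_d$ and an extension $f_{\mathrm{ext}}:\mathcal{U}\to\mathbb{R}$ with $f_{\mathrm{ext}}\equiv f$ on $\mathcal{S}_d$ and $f_{\mathrm{ext}}\in C^2(\mathcal{U})$. Let $\mathcal{J}\subseteq[d]$ and assume also that $$\frac{\partial}{\partial x_i}f(\boldsymbol{x})\Big|_{\boldsymbol{x}_{\mathcal{J}}=\boldsymbol{0}}=0\quad\forall i\in[d],\qquad\frac{\partial^2}{\partial x_i\partial x_j}f(\boldsymbol{x})\Big|_{\boldsymbol{x}_{\mathcal{J}}=\boldsymbol{0}}=0\quad\forall(i,j)\in([d]\backslash\mathcal{J})^2.$$ Then, for any $\boldsymbol{x}\in\mathcal{S}_d$ such that $x_i=\lambda_i/m$ for all $i\in\mathcal{J}$ (with $\lambda_i\ge0$ fixed for all $i\in\mathcal{J}$) and $x_i\in(0,1)$ is independent of $m$ for all $i\in[d]\backslash\mathcal{J}$, we have, as $n\to\infty$, $$\begin{aligned}\mathrm{MSE}(\widetilde f_{n,m}(\boldsymbol{x}))&=n^{-1}m^{(d+|\mathcal{J}|)/2}v_{\mathcal{J}}(\boldsymbol{x})+m^{-4}L_{\mathcal{J}}^2(\boldsymbol{x})\\&\quad+n^{-1}m^{(d+|\mathcal{J}|)/2}\big[\mathcal{O}_{\boldsymbol{\lambda}_{\mathcal{J}}}(m^{-1})+\mathrm{o}_{\boldsymbol{x}_{[d]\backslash\mathcal{J}}}(1)\mathbf{1}_{\{\mathcal{J}\ne[d]\}}\big]+\mathrm{o}_{\boldsymbol{\lambda}_{\mathcal{J}},\boldsymbol{x}_{[d]\backslash\mathcal{J}}}\big(m^{-4}+\mathbf{1}_{\{\mathcal{J}\ne[d]\}}m^{-3}\big),\end{aligned}$$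 where $$v_{\mathcal{J}}(\boldsymbol{x})=f(\boldsymbol{x})\big|_{\boldsymbol{x}_{\mathcal{J}}=\boldsymbol{0}}\;\psi_{[d]\backslash\mathcal{J}}(\boldsymbol{x})\prod_{i\in\mathcal{J}}e^{-2\lambda_i}I_0(2\lambda_i),$$ $$L_{\mathcal{J}}(\boldsymbol{x})=\sum_{(i,j)\in[d]^2\backslash([d]\backslash\mathcal{J})^2}\Big(\big(\tfrac16+\lambda_i\big)\mathbf{1}_{\{i=j\}}+\big(\tfrac18+\tfrac{\lambda_j}{2}\big)\mathbf{1}_{\{i\ne j\}}\Big)\frac{\partial^2}{\partial x_i\partial x_j}f(\boldsymbol{x})\Big|_{\boldsymbol{x}_{\mathcal{J}}=\boldsymbol{0}},$$ with $\lambda_i:=0$ for $i\in[d]\backslash\mathcal{J}$. Moreover, if $\mathcal{J}=[d]$ and $L_{[d]}(\boldsymbol{0})\ne0$, the asymptotically optimal choice of $m$, with respect to $\mathrm{MSE}$, is $$m_{\mathrm{opt}}=n^{\frac1{d+4}}\frac{\{L_{[d]}(\boldsymbol{0})\}^{\frac{2}{d+4}}}{\big\{\frac d4v_{[d]}(\boldsymbol{0})\big\}^{\frac1{d+4}}},$$ so that, as $n\to\infty$, $$\mathrm{MSE}(\widetilde f_{n,m_{\mathrm{opt}}}(\boldsymbol{x}))=n^{-\frac4{d+4}}\frac{\{L_{[d]}(\boldsymbol{0})\}^{\frac{2d}{d+4}}}{\left[\frac{\big(\frac4d\big)^{\frac4{d+4}}}{\frac4d+1}\right]\{v_{[d]}(\boldsymbol{0})\}^{\frac{-4}{d+4}}}+\mathrm{o}_{\boldsymbol{\lambda}}\big(n^{-\frac4{d+4}}\big).$$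 Here $$v_{[d]}(\boldsymbol{0})=f(\boldsymbol{0})\prod_{i\in[d]}e^{-2\lambda_i}I_0(2\lambda_i),\qquad L_{[d]}(\boldsymbol{0})=\sum_{i,j\in[d]}\Big(\big(\tfrac16+\lambda_i\big)\mathbf{1}_{\{i=j\}}+\big(\tfrac18+\tfrac{\lambda_j}{2}\big)\mathbf{1}_{\{i\ne j\}}\Big)\frac{\partial^2}{\partial x_i\partial x_j}f(\boldsymbol{x})\Big|_{\boldsymbol{x}=\boldsymbol{0}},$$ where the $\lambda_i$ are the given fixed constants.
   Context: Let $d\ge1$, $[d]=\{1,\dots,d\}$, $\mathbb{N}_0=\{0,1,2,\dots\}$, $\|\boldsymbol{x}\|_1=\sum_{i=1}^d|x_i|$, $\mathcal{S}_d=\{\boldsymbol{x}\in[0,1]^d:\|\boldsymbol{x}\|_1\le1\}$, $\mathrm{Int}(\mathcal{S}_d)=\{\boldsymbol{x}\in(0,1)^d:\|\boldsymbol{x}\|_1<1\}$, and $m\mathcal{S}_d=\{m\boldsymbol{x}:\boldsymbol{x}\in\mathcal{S}_d\}$. For $\boldsymbol{k}\in\mathbb{N}_0^d\cap m\mathcal{S}_d$ the multinomial probabilities are $$P_{\boldsymbol{k},m}(\boldsymbol{x})=\frac{m!}{(m-\|\boldsymbol{k}\|_1)!\prod_{i=1}^dk_i!}(1-\|\boldsymbol{x}\|_1)^{m-\|\boldsymbol{k}\|_1}\prod_{i=1}^dx_i^{k_i}$$ (with $0^0=1$). Let $\boldsymbol{X}_1,\dots,\boldsymbol{X}_n$ be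 i.i.d. with density $f$ supported on $\mathcal{S}_d$. The Bernstein density estimator is $$\widetilde f_{n,m}(\boldsymbol{x})=\sum_{\boldsymbol{k}\in\mathbb{N}_0^d\cap(m-1)\mathcal{S}_d}m^d\Big\{\frac1n\sum_{i=1}^n\mathbf{1}_{(\frac{\boldsymbol{k}}{m},\frac{\boldsymbol{k}+1}{m}]}(\boldsymbol{X}_i)\Big\}P_{\boldsymbol{k},m-1}(\boldsymbol{x}),\quad \boldsymbol{x}\in\mathcal{S}_d,$$ where $(\frac{\boldsymbol{k}}{m},\frac{\boldsymbol{k}+1}{m}]=(\frac{k_1}{m},\frac{k_1+1}{m}]\times\dots\times(\frac{k_d}{m},\frac{k_d+1}{m}]$. $\mathrm{MSE}(\widetilde f_{n,m}(\boldsymbol{x}))=\mathbb{E}[(\widetilde f_{n,m}(\boldsymbol{x})-f(\boldsymbol{x}))^2]$. The bandwidth $m=m(n)\in\mathbb{N}$ is a function of $n$ with $m\to\infty$ as $n\to\infty$. The asymptotically optimal choice of $m$ (for $\mathcal{J}=[d]$) is the value minimizing the leading terms $n^{-1}m^{d}v_{[d]}+m^{-4}L_{[d]}^2$ of the MSE; powers of $L_{[d]}$ are understood as powers of $L_{[d]}^2$, e.g. $\{L\}^{2/p}=(L^2)^{1/p}$. For $A\subseteq[d]$, $\boldsymbol{v}_A=(v_i)_{i\in A}$ and $\psi_A(\boldsymbol{x})=\big[(4\pi)^{|A|}(1-\sum_{i\in A}x_i)\prod_{i\in A}x_i\big]^{-1/2}$, with empty sum $0$ and empty product $1$. The notation $|_{\boldsymbol{x}_{\mathcal{J}}=\boldsymbol{0}}$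 means evaluation at the point obtained from $\boldsymbol{x}$ by setting the coordinates with index in $\mathcal{J}$ to $0$. At boundary points of $\mathcal{S}_d$ the partial derivatives of $f$ mean those of $f_{\mathrm{ext}}$. $I_0(z)=\sum_{k=0}^\infty\frac{(z/2)^{2k}}{(k!)^2}$ is the modified Bessel function of the first kind of order $0$. $u=\mathcal{O}(v)$ means $\limsup|u/v|<C<\infty$ and $u=\mathrm{o}(v)$ means $\lim|u/v|=0$; the constant or rate may depend on $f$ and $d$ but on no other variable unless written as a subscript. *)

(* Defs.v *)
From HB Require Import structures.
From mathcomp Require Import all_boot all_order all_algebra.
From mathcomp Require Import all_classical all_reals all_analysis.

Set Implicit Arguments.
Unset Strict Implicit.
Unset Printing Implicit Defensive.

Import Order.TTheory GRing.Theory Num.Theory.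
Import numFieldNormedType.Exports.

Local Open Scope classical_set_scope.
Local Open Scope ring_scope.

Section lebesgue_tuple.
Context {R : realType}.
(* The Borel structure on R that carries [lebesgue_measure]. *)
Local Notation Rm := (measurableTypeR R).

Definition pcons n (p : Rm * n.-tuple Rm) : n.+1.-tuple Rm :=
  [tuple of p.1 :: p.2].

Lemma measurable_pcons n : measurable_fun setT (@pcons n).
Proof. exact: (@measurable_cons _ _ _ _ (fst : Rm * n.-tuple Rm -> Rm) n snd). Qed.

Section step.
Variables (n : nat) (mu : {sigma_finite_measure set (n.-tuple Rm) -> \bar R}).

Definition lebesgue_step : set (n.+1.-tuple Rm) -> \bar R :=
  pushforward (lebesgue_measure \x mu)%E (@pcons n).

Let step0 : lebesgue_step set0 = 0%E.
Proof. by rewrite /lebesgue_step /pushforward preimage_set0 measure0. Qed.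

Let step_ge0 B : (0 <= lebesgue_step B)%E.
Proof.
rewrite /lebesgue_step /pushforward.
exact: (measure_ge0 (product_measure1 lebesgue_measure mu)).
Qed.

Let step_sigma_additive : semi_sigma_additive lebesgue_step.
Proof.
move=> F mF tF mUF; rewrite /lebesgue_step /pushforward preimage_bigcup.
have mp A : measurable A -> measurable (@pcons n @^-1` A).
  by move=> mA; rewrite -[X in measurable X]setTI; exact: measurable_pcons.
apply: measure_semi_sigma_additive.
- by move=> k; exact: mp.
- apply/trivIsetP => /= i j _ _ ij; rewrite -preimage_setI.
  by move/trivIsetP : tF => /(_ _ _ _ _ ij) ->//; rewrite preimage_set0.
- by rewrite -preimage_bigcup; exact: mp.
Qed.

HB.instance Definition _ := isMeasure.Build _ _ _
  lebesgue_step step0 step_ge0 step_sigma_additive.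

Let step_sigma_finite : sigma_finite setT lebesgue_step.
Proof.
have /sigma_finiteP[F [TF ndF Foo]] := sigma_finiteT (@lebesgue_measure R).
have /sigma_finiteP[G [TG ndG Goo]] := sigma_finiteT mu.
pose u (t : n.+1.-tuple Rm) : Rm * n.-tuple Rm := (thead t, [tuple of behead t]).
have mu_ : measurable_fun setT u.
  apply: measurable_fun_pair; first exact: measurable_tnth.
  exact: measurable_behead.
have uK : cancel (@pcons n) u.
  by case=> x t; rewrite /u /pcons theadE; congr pair; apply: val_inj.
exists (fun k => u @^-1` (F k `*` G k)).
  rewrite -preimage_bigcup; apply/seteqP; split=> // t _ /=.
  have [k _ Fk] : (\bigcup_k F k) (u t).1 by rewrite -TF.
  have [l _ Gl] : (\bigcup_k G k) (u t).2 by rewrite -TG.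
  exists (maxn k l) => //; split.
    by move: (u t).1 Fk; exact/subsetPset/ndF/leq_maxl.
  by move: (u t).2 Gl; exact/subsetPset/ndG/leq_maxr.
move=> k; have [mFk Fk] := Foo k; have [mGk Gk] := Goo k; split.
  by rewrite -[X in measurable X]setTI; apply: mu_ => //; exact: measurableX.
rewrite /lebesgue_step /pushforward -comp_preimage.
rewrite (_ : u \o _ = id); last by apply/funext => p /=; rewrite uK.
by rewrite preimage_id product_measure1E// lte_mul_pinfty// ge0_fin_numE.
Qed.

HB.instance Definition _ :=
  Measure_isSigmaFinite.Build _ _ _ lebesgue_step step_sigma_finite.

End step.

Fixpoint lebesgue_tuple n : {sigma_finite_measure set (n.-tuple Rm) -> \bar R} :=
  match n with
  | 0 => dirac ([tuple] : 0.-tuple Rm)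
  | n'.+1 => lebesgue_step (lebesgue_tuple n')
  end.

Lemma measurable_box n (A : 'I_n -> set Rm) : (forall i, measurable (A i)) ->
  measurable [set t : n.-tuple Rm | forall i, A i (tnth t i)].
Proof.
move=> mA.
rewrite (_ : mkset _ = \bigcap_(i in [set: 'I_n]) (@tnth n Rm ^~ i @^-1` A i)).
  apply: fin_bigcap_measurable => // i _; rewrite -[X in measurable X]setTI.
  exact: measurable_tnth.
by apply/seteqP; split => t /= tA i; [move=> _|]; exact: tA.
Qed.

Lemma lebesgue_tuple_box n (A : 'I_n -> set Rm) : (forall i, measurable (A i)) ->
  lebesgue_tuple n [set t : n.-tuple Rm | forall i, A i (tnth t i)] =
  (\prod_(i < n) lebesgue_measure (A i))%E.
Proof.
elim: n A => [|n IH] A mA.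
  by rewrite big_ord0 /= diracE mem_set //= => -[].
rewrite big_ord_recl -IH; last by move=> i; exact: mA.
rewrite /= -product_measure1E; last 2 first.
- exact: mA.
- exact: (@measurable_box n (fun i => A (lift ord0 i))).
rewrite /lebesgue_step /pushforward; congr (product_measure1 _ _ _).
apply/seteqP; split => [[x t] /= H|[x t] /= [H0 H] i].
  split=> [|i]; first exact: (H ord0).
  by have := H (lift ord0 i); rewrite tnthS.
by case: (unliftP ord0 i) => [j|] ->; [rewrite tnthS; exact: H|exact: H0].
Qed.

End lebesgue_tuple.

Section bernstein.
Context {R : realType} {d : nat}.
Local Notation Rm := (measurableTypeR R).
Implicit Types (x y lam : 'rV[R]_d) (J A : {set 'I_d}) (f g : 'rV[R]_d -> R).

Definition simplex : set 'rV[R]_d :=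
  [set x | (forall i, 0 <= x 0 i <= 1) /\ \sum_(i < d) `|x 0 i| <= 1].

Definition simplex_interior : set 'rV[R]_d :=
  [set x | (forall i, 0 < x 0 i < 1) /\ \sum_(i < d) `|x 0 i| < 1].

Definition partial (i : 'I_d) g : 'rV[R]_d -> R := 'D_(delta_mx 0 i) g.

(* Meaningful for open [A]: the derivatives at a point of [A] involve a
   neighbourhood of it. *)
Definition C2_on (A : set 'rV[R]_d) g := forall x, A x ->
  {for x, continuous g} /\
  forall i, [/\ derivable g x (delta_mx 0 i), {for x, continuous (partial i g)} &
  forall j, derivable (partial i g) x (delta_mx 0 j) /\
            {for x, continuous (partial j (partial i g))}].

Definition row_of_tuple (t : d.-tuple Rm) : 'rV[R]_d := \row_i (tnth t i : R).

Definition is_density f :=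
  [/\ forall x, 0 <= f x, measurable_fun setT (f \o row_of_tuple) &
      (\int[lebesgue_tuple d]_t (f (row_of_tuple t))%:E = 1)%E].

Definition supported_on (A : set 'rV[R]_d) f := forall x, ~ A x -> f x = 0.

Section sample.
Context {disp : measure_display} {T : measurableType disp}.
Variable P : probability T R.
Variable X : nat -> {RV P >-> d.-tuple Rm}.

Definition has_density (Y : {RV P >-> d.-tuple Rm}) f :=
  forall B : set (d.-tuple Rm), measurable B ->
    (distribution P Y B = \int[lebesgue_tuple d]_(t in B) (f (row_of_tuple t))%:E)%E.

(* Taking [B k = setT] for some [k] gives the product rule for every finite
   subfamily. *)
Definition independent_seq := forall (n : nat) (B : nat -> set (d.-tuple Rm)),
  (forall k, measurable (B k)) ->
  (P (\bigcap_(k in `I_n) (X k @^-1` B k)) = \prod_(k < n) P (X k @^-1` B k))%E.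

Definition iid_sample f := independent_seq /\ forall k, has_density (X k) f.

Definition multinomial_prob (m : nat) (k : 'I_d -> nat) x : R :=
  m`!%:R / ((m - \sum_i k i)`!%:R * \prod_i (k i)`!%:R) *
  (1 - \sum_i `|x 0 i|) ^+ (m - \sum_i k i) * \prod_i x 0 i ^+ k i.

Definition cell (m : nat) (k : 'I_d -> nat) : set (d.-tuple Rm) :=
  [set t | forall i, (k i)%:R / m%:R < (tnth t i : R) <= (k i).+1%:R / m%:R].

(* A multi-index k in (m-1)S_d has all its entries below m, whence the index
   type. The sample is X 0, ..., X (n-1). *)
Definition bernstein (n m : nat) x (w : T) : R :=
  \sum_(k : {ffun 'I_d -> 'I_m} | (\sum_i k i <= m.-1)%N)
    m%:R ^+ d * (n%:R^-1 * \sum_(l < n) \1_(cell m (fun i => k i)) (X l w)) *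
    multinomial_prob m.-1 (fun i => k i) x.

Definition MSE f (n m : nat) x : \bar R :=
  'E_P [ (fun w => (bernstein n m x w - f x) ^+ 2) ].

End sample.

Definition zero_on J x : 'rV[R]_d := \row_i (if i \in J then 0 else x 0 i).

Definition scale_params J lam :=
  (forall i, i \in J -> 0 <= lam 0 i) /\ (forall i, i \notin J -> lam 0 i = 0).

(* [y] is x_{[d]\J}, padded with zeros on J; the last condition says that
   psi_{[d]\J} is defined at [y] and is automatic when J = [d]. *)
Definition fixed_coords J y :=
  [/\ forall i, i \in J -> y 0 i = 0, forall i, i \notin J -> 0 < y 0 i < 1 &
      \sum_(i | i \notin J) y 0 i < 1].

Definition near_face J lam y (m : nat) : 'rV[R]_d :=
  \row_i (if i \in J then lam 0 i / m%:R else y 0 i).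

Definition bessel_I0 (z : R) : R :=
  limn (series (fun k => (z / 2) ^+ (2 * k) / (k`!%:R) ^+ 2)).

Definition psi A x : R :=
  ((4 * pi) ^+ #|A| * (1 - \sum_(i in A) x 0 i) * \prod_(i in A) x 0 i)
    `^ (- 2^-1).

Definition v_const f J lam y : R :=
  f (zero_on J y) * psi (~: J) y *
  \prod_(i in J) (expR (- (2 * lam 0 i)) * bessel_I0 (2 * lam 0 i)).

(* [g] is the C^2 extension of the density to a neighbourhood of the simplex:
   the second derivatives are taken at a boundary point when J is nonempty. *)
Definition L_const g J lam y : R :=
  \sum_(p : 'I_d * 'I_d | ~~ ((p.1 \notin J) && (p.2 \notin J)))
    (if p.1 == p.2 then 6^-1 + lam 0 p.1 else 8^-1 + lam 0 p.2 / 2) *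
    partial p.1 (partial p.2 g) (zero_on J y).

(* The case J = [d], with a real bandwidth [s]. Powers of L are taken through
   L^2 below, L being of any sign. *)
Definition leading_terms (v L : R) (n : nat) (s : R) : R :=
  n%:R^-1 * s ^+ d * v + s ^- 4 * L ^+ 2.

Definition m_opt (v L : R) (n : nat) : R :=
  n%:R `^ (d + 4)%:R^-1 * (L ^+ 2) `^ (d + 4)%:R^-1 /
  (d%:R / 4 * v) `^ (d + 4)%:R^-1.

Definition optimal_MSE (v L : R) (n : nat) : R :=
  n%:R `^ (- (4 / (d + 4)%:R)) *
  ((L ^+ 2) `^ (d%:R / (d + 4)%:R) /
   ((4 / d%:R) `^ (4 / (d + 4)%:R) / (4 / d%:R + 1) *
    v `^ (- (4 / (d + 4)%:R)))).

End bernstein.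

Arguments leading_terms {R} d v L n s.
Arguments m_opt {R} d v L n.
Arguments optimal_MSE {R} d v L n.

(* Main.v *)
Require Import Defs.
From mathcomp Require Import all_boot all_order all_algebra.
From mathcomp Require Import all_classical all_reals all_analysis measurable_realfun.
From mathcomp Require Import ring lra zify.

(** The estimator is an average over the sample, so its mean square error is
    [n^-1] times a variance plus a squared bias, and both are sums over the
    multinomial counts [k] of the cells: with [p_k] the mass of a cell,
    [m^(2d) \sum_k P_k^2 p_k - (m^d \sum_k P_k p_k)^2] and
    [m^d \sum_k P_k p_k - f x] ([MSE_decomposition]).

    Flatness. As the gradient vanishes on the face [x_J = 0], the density is
    constant there, and as the gradient is Lipschitz it leaves that value
    quadratically: [|f z - f 0| <= M (\sum_(i in J) z_i)^2]
    ([quadratic_near_face]). The average of [f] over a cell is thus [f 0] up to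
    [M (|k_J| + d)^2 / m^2], which is [O(m^-2)] in the mean since the counts [k_J]
    have bounded exponential moments. Cells that stick out of the simplex are hit
    with exponentially small probability ([cell_density_dev], [cubic_moment],
    [crossing_prob]).

    Variance. What remains is [m^d f 0] times [\sum_k P_k^2], the probability that
    two independent multinomial vectors coincide. Splitting it along the total [j] of
    the counts in [J] gives a weight of the short counts times the collision
    probability of the others after [m - 1 - j] draws ([sum_sqr_near_face]). The
    weights converge at speed [1/m] to those of independent Poisson variables,
    whose collision probability is [e^(-2 l) I_0 (2 l)] ([sum_poisson_weight]). The
    other factor obeys a local limit theorem ([collision_prob_cvg]), which is
    proved without Fourier analysis: the difference of two binomial variables is a
    lazy simple random walk, whose return probability is an average of central
    binomial coefficients, and these are squeezed by Wallis' inequalities;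
    conditioning on one count at a time then reduces a multinomial vector to
    binomial variables.

    Uniformity. The constant in the [O(1/m)] may depend on the scales only, and
    the null sequence on the other coordinates only. As long as the scales add up
    to a small fraction of [m], the local limit theorem applies uniformly in them
    ([collision_average]). Otherwise a large [m] is at most the square of their
    sum, and a crude bound of the error by a power of [m] is below a polynomial in
    the scales, divided by [m] ([variance_face]). The supremum over the scales of what
    exceeds the constant is then the null sequence ([uniform_modulus]).

    Bias. At the vertex, Taylor's formula of order two at [0], the second moments
    of a uniform point of a cell and the factorial moments of the counts identify
    the limit of [m^2] times the bias ([vertex_bias]). When [J] is not full, the
    expansion of the squared bias is up to [o(m^-3)], and flatness bounds the
    squared bias by [O(m^-4)] ([face_bias_le]).

    Optimum. In the variable [r = s / m_opt] the leading terms are proportional to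
    [r^d + (d/4) r^-4], which strict convexity of the exponential minimizes at
    [r = 1] ([optimum_strict]). Both integers next to [m_opt] have a ratio tending
    to one, which yields the optimal mean square error ([vertex_MSE_near_opt]). *)

Set Implicit Arguments.
Unset Strict Implicit.
Unset Printing Implicit Defensive.

Import Order.TTheory GRing.Theory Num.Theory.
Import numFieldNormedType.Exports.

Local Open Scope classical_set_scope.
Local Open Scope ring_scope.

(** * Wallis' inequalities for the central binomial coefficient *)

Section wallis.
Context {R : realType}.

(** The antiderivative of [sin ^ n] that vanishes at [0], by the reduction formula. *)
Fixpoint sin_power_primitive (n : nat) (x : R) : R :=
  match n with
  | 0 => x
  | 1 => 1 - cos x
  | (n'.+1 as k).+1 =>
      (k%:R * sin_power_primitive n' x - sin x ^+ k * cos x) / k.+1%:R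
  end.

Lemma sin_power_primitiveSS n x : sin_power_primitive n.+2 x =
  (n.+1%:R * sin_power_primitive n x - sin x ^+ n.+1 * cos x) / n.+2%:R.
Proof. by []. Qed.

Lemma is_derive_sin_power_primitive n (x : R) :
  is_derive x (1 : R) (sin_power_primitive n) (sin x ^+ n).
Proof.
suff: is_derive x (1 : R) (sin_power_primitive n) (sin x ^+ n) /\
      is_derive x (1 : R) (sin_power_primitive n.+1) (sin x ^+ n.+1) by case.
elim: n => [|n [IH0 IH1]].
  split; first exact: is_derive_id.
  rewrite (_ : sin_power_primitive 1 = cst 1 - cos)//.
  by apply: is_derive_eq; rewrite sub0r opprK expr1.
split; first exact: IH1.
rewrite (_ : sin_power_primitive n.+2 =
    n.+2%:R^-1 \*: (n.+1%:R \*: sin_power_primitive n - sin ^+ n.+1 * cos)).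
  apply: is_derive_eq.
  rewrite !/GRing.scale/= exprfctE.
  have n2 : (n.+2%:R : R) != 0 by rewrite pnatr_eq0.
  apply: (mulfI n2); rewrite [LHS]mulrA mulfV// mul1r.
  have h := cos2Dsin2 x; rewrite -[n.+2%:R]natr1 [_ ^+ n.+2]exprS [_ ^+ n.+1]exprS.
  have -> : cos x * (n.+1%:R * sin x ^+ n * cos x) =
    n.+1%:R * sin x ^+ n * (1 - sin x ^+ 2) by rewrite -h; ring.
  ring.
apply/funext => y; rewrite sin_power_primitiveSS mulrC /=.
by rewrite /GRing.scale/= !fctE.
Qed.

(** Wallis' integral of [sin ^ n] between [0] and [pi / 2]. *)
Definition wallis (n : nat) : R := sin_power_primitive n (pi / 2).

Lemma wallisSS n : wallis n.+2 = n.+1%:R / n.+2%:R * wallis n.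
Proof. by rewrite /wallis sin_power_primitiveSS cos_pihalf mulr0 subr0; ring. Qed.

Lemma wallis_nonincreasing n : wallis n.+1 <= wallis n.
Proof.
pose g := sin_power_primitive n - sin_power_primitive n.+1.
have dg (x : R) : is_derive x (1 : R) g (sin x ^+ n - sin x ^+ n.+1).
  by have := is_derive_sin_power_primitive n x;
     have := is_derive_sin_power_primitive n.+1 x => ? ?; exact: is_deriveB.
have z k : sin_power_primitive k 0 = 0.
  suff : sin_power_primitive k 0 = 0 /\ sin_power_primitive k.+1 0 = 0 by case.
  elim: k => [|k [IH0 IH1]]; first by rewrite /= cos0 subrr.
  by rewrite sin_power_primitiveSS IH0 sin0 exprS mul0r mul0r mulr0 subr0 mul0r.
suff : g 0 <= g (pi / 2).
  by rewrite /g !fctE !z subrr subr_ge0.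
have p0 : 0 <= pi / 2 :> R by rewrite divr_ge0 ?pi_ge0.
apply: (@ger0_derive1_le_cc R g 0 (pi / 2)) => //; rewrite ?in_itv/= ?lexx ?p0//.
- move=> x; rewrite in_itv/= => /andP[x0 x1].
  rewrite derive1E derive_val exprS -{1}[sin x ^+ n]mul1r -mulrBl.
  rewrite mulr_ge0 ?subr_ge0 ?sin_le1// exprn_ge0// sin_ge0_pi//.
  by rewrite (ltW x0) (le_trans (ltW x1))// ler_pdivrMr// ler_peMr ?pi_ge0// ler1n.
apply: continuous_subspaceT => x.
by apply: differentiable_continuous; apply/derivable1_diffP.
Qed.

(** The probability that a simple symmetric random walk is back at the origin
    at time [2 * j]. *)
Definition central_prob (j : nat) : R := 'C(j.*2, j)%:R / 4 ^+ j.

Lemma central_probS j :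
  central_prob j.+1 = (j.*2.+1)%:R / (j.*2.+2)%:R * central_prob j.
Proof.
rewrite /central_prob doubleS exprS.
have h : ('C(j.*2.+2, j.+1) * j.+1 * j.+1 = j.*2.+2 * j.*2.+1 * 'C(j.*2, j))%N.
  have h1 := mul_bin_diag j.*2.+2 j; have h2 := mul_bin_down j.*2.+1 j.
  rewrite /= in h1 h2; rewrite [X in (_ = X * _)%N](_ : _ = j.+1) in h2; last first.
    by rewrite -addnn -addSn addnK.
  by rewrite [X in (X * _)%N]mulnC -h1 -mulnA [X in (_ * X)%N]mulnC -h2 mulnA.
have : ('C(j.*2.+2, j.+1) * j.+1 * j.+1)%:R =
       (j.*2.+2 * j.*2.+1 * 'C(j.*2, j))%:R :> R by rewrite h.
rewrite !natrM => {}h.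
have j1 : (j.+1%:R : R) != 0 by rewrite pnatr_eq0.
have j2 : (j.*2.+2%:R : R) = 2 * j.+1%:R by rewrite -natrM mul2n doubleS.
have j4 : (4 ^+ j : R) != 0 by rewrite expf_neq0.
rewrite j2; rewrite j2 in h.
apply: (mulIf j1); apply: (mulIf j1).
transitivity ('C(j.*2.+2, j.+1)%:R * j.+1%:R * j.+1%:R / 4 / 4 ^+ j : R).
  by field; rewrite j4.
rewrite h; move: (j.+1%:R : R) j1 (4 ^+ j : R) j4 => a a0 b b0.
by field; rewrite a0 b0.
Qed.

Lemma central_prob_gt0 j : 0 < central_prob j.
Proof.
by rewrite divr_gt0// ?exprn_gt0// (ltr0n R) bin_gt0 -addnn leq_addr.
Qed.

Lemma wallis_even j : wallis j.*2 = central_prob j * (pi / 2).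
Proof.
elim: j => [|j IH]; first by rewrite /central_prob bin0 expr0 divr1 mul1r.
by rewrite doubleS wallisSS IH central_probS !mulrA.
Qed.

Lemma wallis_odd j : wallis j.*2.+1 = ((j.*2.+1)%:R * central_prob j)^-1.
Proof.
elim: j => [|j IH].
  by rewrite /wallis /= cos_pihalf subr0 /central_prob bin0 expr0 divr1 mul1r invr1.
rewrite doubleS wallisSS IH central_probS.
move: (gt_eqF (central_prob_gt0 j)) (pnatr_eq0 R j.*2.+1) (pnatr_eq0 R j.*2.+2).
move: (pnatr_eq0 R j.*2.+3) (central_prob j) (j.*2.+1%:R : R) (j.*2.+2%:R : R).
move: (j.*2.+3%:R : R) => a a0 u b c u0 b0 c0.
by field; rewrite a0 b0 c0 u0.
Qed.

(** Wallis' integrals decrease, and the product of two consecutive ones is explicit,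
    which traps the square of [central_prob]. *)
Lemma central_prob_sqr_ge j : 2 / (pi * (j.*2.+1)%:R) <= central_prob j ^+ 2.
Proof.
have := wallis_nonincreasing j.*2.
rewrite wallis_even wallis_odd => h.
have u0 := central_prob_gt0 j.
have p0 := @pi_gt0 R.
rewrite ler_pdivrMr ?mulr_gt0 ?ltr0n//.
have n0 : 0 < j.*2.+1%:R :> R by [].
move: h; rewrite -[_^-1]mul1r ler_pdivrMr ?(mulr_gt0 n0)//.
move: (central_prob j) (j.*2.+1%:R : R) (pi : R) => u n p h; nra.
Qed.

Lemma central_prob_sqr_le j : (0 < j)%N -> central_prob j ^+ 2 <= (pi * j%:R)^-1.
Proof.
case: j => // j _; have := wallis_nonincreasing j.*2.+1.
rewrite -doubleS wallis_even wallis_odd.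
have -> : central_prob j = (j.*2.+2)%:R / (j.*2.+1)%:R * central_prob j.+1.
  rewrite central_probS.
  move: (j.*2.+1%:R : R) (j.*2.+2%:R : R) (pnatr_eq0 R j.*2.+1) (pnatr_eq0 R j.*2.+2).
  by move=> a b a0 b0; field; rewrite a0 b0.
have u0 := central_prob_gt0 j.+1.
have p0 := @pi_gt0 R.
have -> : (j.*2.+2%:R : R) = 2 * j.+1%:R by rewrite -natrM mul2n doubleS.
have -> : (j.*2.+1%:R * (2 * j.+1%:R / j.*2.+1%:R * central_prob j.+1))^-1 =
  (2 * j.+1%:R * central_prob j.+1)^-1 :> R.
  congr (_^-1); move: (j.*2.+1%:R : R) (pnatr_eq0 R j.*2.+1) => a a0.
  by field; rewrite a0.
have j0 : 0 < j.+1%:R :> R by [].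
rewrite -[X in _ <= X -> _]mul1r ler_pdivlMr ?(mulr_gt0 (mulr_gt0 _ j0) u0)// => h.
rewrite -[leRHS]mul1r ler_pdivlMr ?(mulr_gt0 p0 j0)//.
move: h; move: (central_prob j.+1) (j.+1%:R : R) (pi : R) => u n p h; lra.
Qed.

End wallis.

(** * Collisions and deviations of binomial variables *)

Section deviation.
Context {R : realType}.

Lemma expR_le_quadratic (t : R) : t <= 2^-1 -> expR t <= 1 + t + 2 * t ^+ 2.
Proof.
move=> t2; have t1 : 0 < 1 - t by lra.
have := expR_ge1Dx (- t); rewrite expRN => h.
have e0 := expR_gt0 t.
have : (1 - t) * expR t <= 1.
  by rewrite -ler_pdivlMr// mul1r.
nra.
Qed.

(** Chernoff's bound for any finitely supported statistic whose moment
    generating function is dominated by that of a binomial variable. *)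
Lemma binomial_deviation (I : finType) (w S : I -> R) (N : nat) (p d : R) :
  (forall i, 0 <= w i) -> 0 <= p <= 1 -> 0 < d <= 1 ->
  (forall t, \sum_i w i * expR (t * S i) <= (1 + p * (expR t - 1)) ^+ N) ->
  \sum_(i | d * N%:R <= `|S i - p * N%:R|) w i <=
    2 * expR (- (d ^+ 2 / 8 * N%:R)).
Proof.
move=> w0 /andP[p0 p1] /andP[d0 d1] mgf.
(* The two signs of [t] give the upper and the lower tail. *)
have one_sided t : `|t| = d / 4 ->
    \sum_i w i * expR (t * (S i - p * N%:R) - `|t| * (d * N%:R)) <=
      expR (- (d ^+ 2 / 8 * N%:R)).
  move=> td.
  under eq_bigr => i _.
    rewrite [t * _ - _](_ : _ = t * S i + (- (t * p + `|t| * d) * N%:R)); last by ring.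
    rewrite expRD mulrA; over.
  rewrite -mulr_suml.
  apply: (@le_trans _ _ (expR (p * (expR t - 1) * N%:R) *
                         expR (- (t * p + `|t| * d) * N%:R))).
    apply: ler_wpM2r; first exact: expR_ge0.
    apply: le_trans (mgf t) _; rewrite expRM_natr; apply: lerXn2r.
    - rewrite nnegrE; have := expR_ge0 t; nra.
    - by rewrite nnegrE expR_ge0.
    - exact: expR_ge1Dx.
  rewrite -expRD ler_expR -mulrDl -mulNr ler_wpM2r//.
  have te : expR t <= 1 + t + 2 * t ^+ 2.
    by apply: expR_le_quadratic; have := ler_norm t; lra.
  have t2 : t ^+ 2 = d ^+ 2 / 16 by rewrite -real_normK ?num_real// td; field.
  rewrite td; rewrite t2 in te; nra.
apply: (@le_trans _ _ (\sum_i
  (w i * expR ((d / 4) * (S i - p * N%:R) - `|d / 4| * (d * N%:R)) +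
   w i * expR ((- (d / 4)) * (S i - p * N%:R) - `|- (d / 4)| * (d * N%:R))))).
  rewrite [leRHS](bigID (fun i => d * N%:R <= `|S i - p * N%:R|))/= ler_wpDr//.
    by apply: sumr_ge0 => i _; rewrite addr_ge0// mulr_ge0// expR_ge0.
  apply: ler_sum => i; rewrite ler_normr normrN gtr0_norm ?divr_gt0// => /orP[h|h].
    rewrite ler_wpDr ?mulr_ge0 ?expR_ge0// ler_peMr// (le_trans _ (expR_ge1Dx _))// lerDl.
    by rewrite -mulrBr mulr_ge0 ?subr_ge0// divr_ge0 ?ltW.
  rewrite ler_wpDl ?mulr_ge0 ?expR_ge0// ler_peMr// (le_trans _ (expR_ge1Dx _))// lerDl.
  by rewrite mulNr -mulrN -mulrBr mulr_ge0 ?subr_ge0// divr_ge0 ?ltW.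
rewrite big_split/= mulr2n mulrDl mul1r; apply: lerD; apply: one_sided.
  by rewrite gtr0_norm ?divr_gt0.
by rewrite normrN gtr0_norm ?divr_gt0.
Qed.

Lemma cvg_poly_exp (q : nat) (c : R) : 0 < c ->
  (fun N : nat => N%:R ^+ q * expR (- (c * N%:R))) @ \oo --> (0 : R).
Proof.
move=> c0.
pose K : R := q.+1`!%:R / c ^+ q.+1.
apply: (@squeeze_cvgr _ _ _ _ (cst 0) (fun N => K * (N%:R)^-1)).
- near=> N; rewrite mulr_ge0 ?exprn_ge0 ?expR_ge0//=.
  have N0 : 0 < N%:R :> R by rewrite ltr0n; near: N; exact: nbhs_infty_gt.
  rewrite expRN ler_pdivrMr ?expR_gt0//.
  have h : (c * N%:R) ^+ q.+1 / q.+1`!%:R <= expR (c * N%:R).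
    apply: le_trans (expR_ge1Dxn q (ltW (mulr_gt0 c0 N0))); lra.
  apply: le_trans (ler_wpM2l _ h); last by rewrite mulr_ge0 ?invr_ge0 ?ltW// divr_gt0 ?exprn_gt0 ?ltr0n ?fact_gt0.
  rewrite le_eqVlt; apply/orP; left; apply/eqP.
  rewrite /K exprMn [_%:R ^+ q.+1]exprS.
  have := gt_eqF c0; have := gt_eqF N0.
  have : (q.+1`!%:R : R) != 0 by rewrite pnatr_eq0 -lt0n fact_gt0.
  have : c ^+ q.+1 != 0 by rewrite expf_neq0 ?gt_eqF.
  move: (q.+1`!%:R : R) (c ^+ q.+1) (N%:R : R) => a b n b0 a0 n0 _.
  by field; rewrite n0 a0 b0.
- exact: cvg_cst.
- rewrite -[X in _ --> X](mulr0 K); apply: cvgM; first exact: cvg_cst.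
  by apply/gtr0_cvgV0; [near=> n; rewrite ltr0n; near: n; exact: nbhs_infty_gt|exact: cvgr_idn].
Unshelve. all: by end_near. Qed.

Lemma near_prodl {T U : Type} (F : set_system T) (G : set_system U) {FG : Filter G}
    (P : set T) : F P -> \forall z \near filter_prod F G, P z.1.
Proof. by move=> FP; exists (P, setT) => //=; [split=> //; exact: filterT|move=> z []]. Qed.

Lemma near_prodr {T U : Type} (F : set_system T) (G : set_system U) {FF : Filter F}
    (P : set U) : G P -> \forall z \near filter_prod F G, P z.2.
Proof. by move=> GP; exists (setT, P) => //=; [split=> //; exact: filterT|move=> z []]. Qed.

(** For the averages below, concentration makes the bad indices rare, and a crude
    bound [B] on them is affordable. *)
Lemma weighted_average_dist (I : finType) (w g : I -> R) (bad : pred I) (c e B : R) :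
  (forall i, 0 <= w i) -> 0 <= e ->
  (forall i, ~~ bad i -> `|g i - c| <= e) ->
  (forall i, bad i -> `|g i - c| <= B) ->
  `|\sum_i w i * g i - c * \sum_i w i| <=
    e * \sum_i w i + B * \sum_(i | bad i) w i.
Proof.
move=> w0 e0 ge gB.
rewrite !mulr_sumr -sumrB (le_trans (ler_norm_sum _ _ _))//.
rewrite [in leRHS](big_mkcond bad) -big_split/=; apply: ler_sum => i _.
rewrite [c * _]mulrC -mulrBr normrM (ger0_norm (w0 i)) mulrC.
case: ifPn => bi; last by rewrite addr0 ler_wpM2r// ge.
by rewrite ler_wpDl// ?mulr_ge0// ler_wpM2r// gB.
Qed.

End deviation.

Section binomial_collision.
Context {R : realType}.
Implicit Types (p q : R) (N M : nat).

(** The probability that two independent binomial variables coincide. *)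
Definition collision N p : R := \sum_(k < N.+1) binomial_pmf N p k ^+ 2.

Definition return_prob M : R := if odd M then 0 else central_prob M./2.

Lemma binomial_pmfE N p k :
  binomial_pmf N p k = p ^+ k * (1 - p) ^+ (N - k) *+ 'C(N, k).
Proof. by []. Qed.

Lemma coef_binomial_poly (a b : R) N k : (k <= N)%N ->
  ((a%:P + b *: 'X) ^+ N)`_k = a ^+ (N - k) * b ^+ k *+ 'C(N, k).
Proof.
move=> kN; rewrite exprDn coef_sum.
have E (i : nat) : (a%:P ^+ (N - i) * (b *: 'X) ^+ i *+ 'C(N, i))`_k =
    if k == i then a ^+ (N - i) * b ^+ i *+ 'C(N, i) else 0.
  rewrite coefMn exprZn -rmorphXn/= -scalerAr coefZ coefCM coefXn.
  by case: eqP => _; rewrite ?mulr1 ?mulr0 ?mul0rn// mulrC.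
have kN' : (k < N.+1)%N by rewrite ltnS.
rewrite (bigD1 (Ordinal kN'))//= E eqxx big1 ?addr0// => i ik; rewrite E.
by case: eqP => // ki; move: ik; rewrite -val_eqE/= ki eqxx.
Qed.

Lemma coef_1DX2 M : ((1 + 'X^2 : {poly R}) ^+ M)`_M =
  if odd M then 0 else 'C(M, M./2)%:R.
Proof.
rewrite exprDn coef_sum.
under eq_bigr => i _ do rewrite expr1n mul1r -exprM coefMn coefXn.
case: ifPn => oM.
  rewrite big1// => i _; case: eqP => [Mi|]; last by rewrite mul0rn.
  by move: oM; have := congr1 odd Mi; rewrite mul2n odd_double => ->.
have hM : (M./2 < M.+1)%N by rewrite ltnS -{2}(odd_double_half M) -addnn addnA leq_addl.
rewrite (bigD1 (Ordinal hM))//= mul2n halfK (negPf oM) subn0 eqxx mulr1n.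
rewrite big1 ?addr0// => i /eqP iM; case: eqP => [Mi|]; last by rewrite mul0rn.
by exfalso; apply: iM; apply: val_inj; have := congr1 half Mi; rewrite /= mul2n doubleK => ->.
Qed.

(** The difference of two independent binomial variables is a lazy simple
    random walk: each of its [N] steps moves with probability [2 p (1 - p)],
    and then by [+1] or [-1] with equal probabilities. *)
Lemma collision_return N p : collision N p =
  \sum_(M < N.+1) binomial_pmf N (2 * p * (1 - p)) M * return_prob M.
Proof.
set q := 1 - p; set th := 2 * p * q.
have E : (q%:P + p *: 'X) * (p%:P + q *: 'X) =
    (1 - th) *: 'X + (p * q) *: (1 + 'X^2) :> {poly R}.
  have -> : 1 - th = p ^+ 2 + q ^+ 2 by rewrite /th /q; ring.
  move: (q : R) => r; rewrite -!mul_polyC polyCD !polyC_exp polyCM; ring.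
have : ((q%:P + p *: 'X) ^+ N * (p%:P + q *: 'X) ^+ N)`_N =
       (((1 - th) *: 'X + (p * q) *: (1 + 'X^2)) ^+ N : {poly R})`_N.
  by rewrite -exprMn E.
move=> h; transitivity
  (\sum_(j < N.+1) ((q%:P + p *: 'X) ^+ N)`_j * ((p%:P + q *: 'X) ^+ N)`_(N - j)).
  apply: eq_bigr => k _; have kN : (k <= N)%N by rewrite -ltnS.
  rewrite !coef_binomial_poly ?leq_subr// subKn// bin_sub//.
  by rewrite binomial_pmfE -/q expr2 [q ^+ _ * _]mulrC.
rewrite -coefM {}h exprDn coef_sum; apply: eq_bigr => M _; have MN : (M <= N)%N by rewrite -ltnS.
rewrite coefMn !exprZn -scalerAl -scalerAr scalerA coefZ coefXnM ltnNge leq_subr/=.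
rewrite subKn// coef_1DX2 /return_prob.
rewrite binomial_pmfE; case: ifPn => oM; first by rewrite !mulr0 mul0rn.
have -> : central_prob M./2 = 'C(M, M./2)%:R / 2 ^+ M :> R.
  rewrite /central_prob (_ : 4 = 2 ^+ 2); last by rewrite -natrX.
  by rewrite -exprM mul2n halfK (negPf oM) subn0.
have -> : th ^+ M = 2 ^+ M * (p * q) ^+ M by rewrite -exprMn /th mulrA.
have t0 : (2 ^+ M : R) != 0 by rewrite expf_neq0.
rewrite mulrnAl; congr (_ *+ _); rewrite exprMn [p ^+ M *: _](_ : _ = p ^+ M * q ^+ M)//.
by move: (2 ^+ M : R) t0 => t t0; field.
Qed.

Lemma sum_binomial_pmf N p : \sum_(k < N.+1) binomial_pmf N p k = 1.
Proof.
rewrite -[RHS](expr1n _ N) -[1](subrK p) exprDn; apply: eq_bigr => k _.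
by rewrite binomial_pmfE mulrC.
Qed.

Lemma binomial_mgf N p t :
  \sum_(k < N.+1) binomial_pmf N p k * expR (t * k%:R) =
  (1 + p * (expR t - 1)) ^+ N.
Proof.
rewrite (_ : 1 + p * _ = (1 - p) + p * expR t); last by ring.
rewrite exprDn; apply: eq_bigr => k _.
rewrite binomial_pmfE expRM_natr exprMn mulrnAl; congr (_ *+ _); ring.
Qed.

(** The number of moving steps of the lazy walk has to be even for a return; half
    of the mass is on even values, up to an exponentially small term. *)
Lemma sum_binomial_even N p : \sum_(k < N.+1)
    (if odd k then 0 else binomial_pmf N p k) = (1 + (1 - 2 * p) ^+ N) / 2.
Proof.
rewrite -{1}(sum_binomial_pmf N p) (_ : 1 - 2 * p = (1 - p) + - p); last by ring.
rewrite exprDn -big_split/= mulr_suml; apply: eq_bigr => k _.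
rewrite binomial_pmfE exprNn -signr_odd; case: (odd k) => /=.
  by rewrite expr1 -mulrnDl mulN1r mulrN [p ^+ k * _]mulrC subrr mul0rn mul0r.
by rewrite expr0 mul1r -mulrnDl [p ^+ k * _]mulrC -mulr2n -mulr_natr
  -mulrnAr mulrnAl -[_ *+ 'C(_, _)]mulr_natr; field.
Qed.

Lemma binomial_pmf_nneg N p k : 0 <= p <= 1 -> 0 <= binomial_pmf N p k.
Proof.
by move=> /andP[p0 p1]; rewrite mulrn_wge0// mulr_ge0 ?exprn_ge0 ?subr_ge0.
Qed.

End binomial_collision.

Section local_limit.
Context {R : realType}.

(** The number [k] of moving steps concentrates around [N * th p], where
    [return_prob k] is close to [sqrt (2 / (pi * k))] by Wallis' inequalities and
    vanishes for odd [k], whence the factor one half. The limit is taken jointly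
    in [N] and [p]: applications have a success probability depending on [N]. *)
Lemma collision_cvg (p : R) : 0 < p < 1 ->
  (fun z : nat * R => Num.sqrt z.1%:R * collision z.1 z.2)
    @ filter_prod \oo (nbhs p) --> (Num.sqrt (4 * pi * p * (1 - p)))^-1.
Proof.
move=> /andP[p0 p1].
pose th (x : R) := 2 * x * (1 - x).
have th0 : 0 < th p by rewrite /th !mulr_gt0// subr_gt0.
have th1 : th p <= 2^-1 by rewrite /th; have := sqr_ge0 (2 * p - 1); nra.
have pi0 := @pi_gt0 R.
pose c := Num.sqrt (2 / (pi * th p)).
have c0 : 0 < c by rewrite sqrtr_gt0 divr_gt0// mulr_gt0.
have -> : (Num.sqrt (4 * pi * p * (1 - p)))^-1 = c / 2.
  apply/eqP; rewrite -(@eqrXn2 _ 2)// ?invr_ge0 ?sqrtr_ge0 ?divr_ge0 ?ltW//.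
  rewrite exprVn exprMn !sqr_sqrtr.
  - rewrite /th; have := gt_eqF p0; have : 1 - p == 0 = false by rewrite subr_eq0 gt_eqF.
    have := gt_eqF pi0; move: (pi : R) => P P0 q0 p00; apply/eqP.
    by field; rewrite P0 q0 p00.
  - by rewrite divr_ge0// mulr_ge0 ?ltW.
  - by rewrite !mulr_ge0 ?subr_ge0// ltW.
have cts : th x @[x --> p] --> th p.
  by apply: cvgM; [apply: cvgM; [exact: cvg_cst|exact: cvg_id]|
                   apply: cvgB; [exact: cvg_cst|exact: cvg_id]].
apply/cvgrPdist_le => /= e e0.
have e4 : 0 < e / 4 by rewrite divr_gt0.
(* [d] controls how far from [th p] the proportion of moving steps may be. *)
have : (fun r : R => 2 / (pi * r)) @ nbhs (th p) --> 2 / (pi * th p).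
  apply: cvgM; first exact: cvg_cst.
  apply: cvgV; first by rewrite mulf_neq0// gt_eqF.
  by apply: cvgM; [exact: cvg_cst|exact: cvg_id].
move=> /cvgrPdist_le/(_ _ (mulr_gt0 e4 c0)) [d /= d0 hd].
pose D := Num.min (d / 4) (Num.min (th p / 8) 1).
have D0 : 0 < D by rewrite !lt_min !divr_gt0 ?ltr01.
have D1 : D <= 1 by rewrite !ge_min lexx !orbT.
have Dd : D <= d / 4 by rewrite ge_min lexx.
have Dth : D <= th p / 8 by rewrite !ge_min lexx !orbT.
have F0 : \forall N \near \oo, (0 < N)%N by exact: nbhs_infty_gt.
have F1 : \forall N \near \oo, D^-1 <= N%:R by exact: nbhs_infty_ger.
have F2 : \forall N \near \oo, (1 - th p) ^+ N <= e / 4 / c.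
  have : (fun N => (1 - th p) ^+ N) @ \oo --> (0 : R).
    by apply: cvg_expr; rewrite ger0_norm; lra.
  move=> /cvgrPdist_le/(_ _ (divr_gt0 e4 c0)).
  by apply: filterS => N; rewrite sub0r normrN; apply: le_trans; exact: ler_norm.
have F3 : \forall N \near \oo,
    (1 + c) * (N%:R * (2 * expR (- (D ^+ 2 / 8 * N%:R)))) <= e / 4.
  have D8 : 0 < D ^+ 2 / 8 by rewrite divr_gt0 ?exprn_gt0.
  have e8 : 0 < e / 4 / (2 * (1 + c)) by rewrite divr_gt0// mulr_gt0// addr_gt0.
  have := cvg_poly_exp 1 D8 => /cvgrPdist_le/(_ _ e8).
  apply: filterS => N; rewrite sub0r normrN expr1 => h.
  have {}h := le_trans (ler_norm _) h.
  rewrite ler_pdivlMr ?mulr_gt0 ?addr_gt0// in h.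
  by apply: le_trans h; rewrite le_eqVlt; apply/orP; left; apply/eqP; ring.
have G1 : \forall x \near p, `|th p - th x| <= D.
  by move/cvgrPdist_le : cts; exact.
have G2 : \forall x \near p, 0 < x < 1.
  have p01 : p \in `]0, 1[ by rewrite in_itv/= p0 p1.
  by apply: filterS (near_in_itvoo p01) => x; rewrite in_itv/=.
near=> z.
have N0 : 0 < z.1%:R :> R.
  by rewrite ltr0n; near: z; exact: (near_prodl F0).
have ND : z.1%:R^-1 <= D.
  rewrite -[leRHS]invrK lef_pV2 ?posrE ?invr_gt0//; near: z; exact: (near_prodl F1).
have zth : `|th p - th z.2| <= D by near: z; exact: (near_prodr G1).
have z01 : 0 < z.2 < 1 by near: z; exact: (near_prodr G2).
have tail1 : (1 - th p) ^+ z.1 <= e / 4 / c by near: z; exact: (near_prodl F2).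
have tail2 : (1 + c) * (z.1%:R * (2 * expR (- (D ^+ 2 / 8 * z.1%:R)))) <= e / 4.
  by near: z; exact: (near_prodl F3).
have N1 : 1 <= z.1%:R :> R by rewrite ler1n -(ltr0n R).
move: (z.1) (z.2) N0 ND zth z01 tail1 tail2 N1 => N x N0 ND zth x01 tail1 tail2 N1.
rewrite collision_return -/(th x).
have thx : `|th x - th p| <= D by rewrite distrC.
have th01 : 0 <= th x <= 1.
  by move: thx; rewrite ler_norml /th; move: x01 p0 p1; nra.
pose w (k : 'I_N.+1) := if odd k then 0 else binomial_pmf N (th x) k.
pose g (k : 'I_N.+1) := Num.sqrt N%:R * central_prob k./2 : R.
have -> : Num.sqrt N%:R * \sum_(M < N.+1) binomial_pmf N (th x) M * return_prob M
    = \sum_k w k * g k.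
  rewrite mulr_sumr; apply: eq_bigr => k _; rewrite /w /g /return_prob.
  by case: (odd k); rewrite ?mulr0 ?mul0r// mulrCA.
have w0 k : 0 <= w k by rewrite /w; case: (odd k) => //; exact: binomial_pmf_nneg.
pose bad (k : 'I_N.+1) := D * N%:R <= `|k%:R - th x * N%:R|.
have W := sum_binomial_even N (th x).
have good k : ~~ bad k -> ~~ odd k -> `|g k - c| <= e / 4.
  rewrite /bad -ltNge => kN ok.
  have k2 : k = k./2.*2 :> nat by rewrite halfK (negPf ok) subn0.
  have hk : `|k%:R / N%:R - th x| < D.
    rewrite -(@ltr_pM2r _ N%:R)// -[X in _ * X < _](gtr0_norm N0) -normrM mulrBl.
    by rewrite divfK ?gt_eqF.
  have kth : th p / 2 < k%:R / N%:R.
    by move: hk thx Dth th0; rewrite ltr_norml ler_norml; clear; lra.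
  have k0 : 0 < k%:R :> R.
    have : 0 < k%:R / N%:R :> R by move: kth th0; clear; lra.
    by rewrite pmulr_lgt0// invr_gt0.
  have h1 : `|2 / (pi * th p) - 2 / (pi * (k%:R / N%:R))| <= e / 4 * c.
    apply: hd => /=; move: hk thx Dd D0; rewrite !ltr_norml !ler_norml; clear; lra.
  have h2 : `|2 / (pi * th p) - 2 / (pi * (k.+1%:R / N%:R))| <= e / 4 * c.
    apply: hd => /=; move: hk thx; rewrite !ltr_norml !ler_norml -natr1 mulrDl mul1r.
    move: ND Dd D0; have : 0 < N%:R^-1 :> R by rewrite invr_gt0.
    clear; lra.
  have gk0 : 0 <= g k by rewrite /g mulr_ge0 ?sqrtr_ge0// ltW// central_prob_gt0.
  have gu : g k ^+ 2 <= 2 / (pi * (k%:R / N%:R)).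
    rewrite /g exprMn (sqr_sqrtr (ltW N0)).
    have k20 : (0 < k./2)%N by rewrite -double_gt0 -k2 -(ltr0n R).
    have := @central_prob_sqr_le R _ k20.
    have -> : (k%:R : R) = 2 * k./2%:R by rewrite {1}k2 -natrM mul2n.
    have K0 : 0 < k./2%:R :> R by rewrite ltr0n.
    rewrite -(ler_pM2l N0) => /le_trans; apply; rewrite le_eqVlt; apply/orP; left.
    move: (k./2%:R : R) K0 N%:R N0 (pi : R) pi0 => a a0 b b0 P P0; apply/eqP.
    by field; rewrite !gt_eqF.
  have gl : 2 / (pi * (k.+1%:R / N%:R)) <= g k ^+ 2.
    rewrite /g exprMn (sqr_sqrtr (ltW N0)).
    have := @central_prob_sqr_ge R k./2; rewrite -k2 -(ler_pM2l N0); apply: le_trans.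
    have K0 : 0 < k.+1%:R :> R by [].
    rewrite le_eqVlt; apply/orP; left.
    move: (k.+1%:R : R) K0 N%:R N0 (pi : R) pi0 => a a0 b b0 P P0; apply/eqP.
    by field; rewrite !gt_eqF.
  have c2 : c ^+ 2 = 2 / (pi * th p) by rewrite /c sqr_sqrtr// divr_ge0// mulr_ge0 ?ltW.
  rewrite -c2 in h1 h2.
  have : `|g k ^+ 2 - c ^+ 2| <= e / 4 * c.
    move: h1 h2 gu gl; move: (2 / (pi * (k%:R / N%:R))) (2 / (pi * (k.+1%:R / N%:R))).
    by move=> A B; rewrite !ler_norml; clear; lra.
  rewrite subr_sqr normrM => h; rewrite -(ler_pM2r c0); apply: le_trans h.
  by rewrite ler_wpM2l// ger0_norm ?addr_ge0 ?(ltW c0)// lerDr.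
have gB k : `|g k - c| <= (1 + c) * N%:R.
  apply: le_trans (ler_normB _ _) _.
  rewrite (ger0_norm (ltW c0)) ger0_norm; last first.
    by rewrite /g mulr_ge0 ?sqrtr_ge0// ltW// central_prob_gt0.
  rewrite mulrDl mul1r lerD// ?ler_peMr ?(ltW c0)//.
  apply: (@le_trans _ _ (Num.sqrt N%:R * 1)).
    rewrite /g ler_wpM2l ?sqrtr_ge0// ler_pdivrMr ?exprn_gt0// mul1r.
    rewrite -natrX ler_nat -(expnM 2 2) mul2n.
    have -> : (2 ^ k./2.*2 = \sum_(i < (k./2.*2).+1) 'C(k./2.*2, i))%N.
      by rewrite -[2%N]/((1 + 1)%N) expnDn; apply: eq_bigr => i _; rewrite !exp1n !muln1.
    have h : (k./2 < (k./2.*2).+1)%N by rewrite ltnS -addnn leq_addr.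
    by rewrite (bigD1 (Ordinal h))//= leq_addr.
  rewrite mulr1 -[leRHS](sqr_sqrtr (ltW N0)) expr2 ler_peMr ?sqrtr_ge0//.
  by rewrite -[leLHS]sqrtr1 ler_wsqrtr.
pose bad' (k : 'I_N.+1) := bad k && ~~ odd k.
pose g' (k : 'I_N.+1) := if odd k then c else g k.
have -> : \sum_k w k * g k = \sum_k w k * g' k.
  by apply: eq_bigr => k _; rewrite /w /g'; case: (odd k); rewrite ?mul0r.
have := @weighted_average_dist R _ w g' bad' c (e / 4) ((1 + c) * N%:R) w0 (ltW e4).
have -> : \sum_i w i = (1 + (1 - 2 * th x) ^+ N) / 2 by rewrite -W.
have dev : \sum_(i | bad' i) w i <= 2 * expR (- (D ^+ 2 / 8 * N%:R)).
  apply: le_trans (@binomial_deviation R _ (fun k : 'I_N.+1 => binomial_pmf N (th x) k)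
    (fun k => k%:R) N (th x) D _ th01 _ _) => //.
  - rewrite [leRHS](bigID (fun i : 'I_N.+1 => ~~ odd i))/= ler_wpDr//.
      by apply: sumr_ge0 => i _; exact: binomial_pmf_nneg.
    rewrite le_eqVlt; apply/orP; left; apply/eqP; apply: eq_big => [i|i /andP[_]].
      by [].
    by rewrite /w => /negPf ->.
  - by move=> i; exact: binomial_pmf_nneg.
  - by rewrite D0 D1.
  - by move=> t; rewrite binomial_mgf.
have pw : `|(1 - 2 * th x) ^+ N| <= (1 - th p) ^+ N.
  rewrite normrX lerXn2r ?nnegrE ?normr_ge0//; first by move: th1; clear; lra.
  have := sqr_ge0 (2 * x - 1); rewrite ler_norml; move: thx; rewrite ler_norml.
  by rewrite /th; move: Dth; rewrite /th => *; apply/andP; split; nra.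
have B1 i : ~~ bad' i -> `|g' i - c| <= e / 4.
  rewrite /bad' /g' negb_and negbK; case: ifPn => oi; first by rewrite subrr normr0 ltW.
  by rewrite orbF => bi; exact: good.
have B2 i : bad' i -> `|g' i - c| <= (1 + c) * N%:R.
  by rewrite /bad' /g' => /andP[_ /negPf ->].
move=> /(_ B1 B2).
set s := \sum_k w k * g' k; set r := (1 - 2 * th x) ^+ N => h.
have cr : c * `|r| <= e / 4.
  by rewrite mulrC -ler_pdivlMr//; apply: le_trans pw tail1.
have r1 : `|r| <= 1.
  by apply: le_trans pw _; move: th0 th1; clear; move=> *; rewrite exprn_ile1//; lra.
have bt : (1 + c) * N%:R * (\sum_(i | bad' i) w i) <= e / 4.
  apply: le_trans tail2; rewrite -mulrA ler_wpM2l ?addr_ge0 ?(ltW c0)//.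
  by rewrite ler_wpM2l.
have {}h : `|s - c * ((1 + r) / 2)| <= e / 4 + e / 4.
  apply: le_trans h _; apply: lerD => //; rewrite ler_piMr ?(ltW e4)//.
  move: r1; rewrite ler_norml; clear; lra.
have -> : c / 2 - s = (c * ((1 + r) / 2) - s) - c * r / 2 by field.
apply: le_trans (ler_normB _ _) _; rewrite distrC [X in _ + X]normrM normrM.
rewrite (gtr0_norm c0) [`|2^-1|]gtr0_norm// ?invr_gt0//.
move: h cr e0; clear; lra.
Unshelve. all: by end_near. Qed.

End local_limit.

(** * Multinomial sums as coefficients of products of truncated series *)

Section truncated_series.
Context {R : realType}.
Implicit Types (N M : nat) (a b c : nat -> R) (p q : {poly R}).

(** Truncated series multiply correctly only up to their order. *)
Definition eq_upto N p q := forall j, (j <= N)%N -> p`_j = q`_j.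

Lemma eq_uptoM N p1 p2 q1 q2 :
  eq_upto N p1 q1 -> eq_upto N p2 q2 -> eq_upto N (p1 * p2) (q1 * q2).
Proof.
move=> h1 h2 j jN; rewrite !coefM; apply: eq_bigr => i _.
by rewrite h1 ?h2// (leq_trans _ jN)// ?leq_subr// -ltnS.
Qed.

Lemma eq_upto_prod (I : Type) (r : seq I) (P : pred I) N (F G : I -> {poly R}) :
  (forall i, P i -> eq_upto N (F i) (G i)) ->
  eq_upto N (\prod_(i <- r | P i) F i) (\prod_(i <- r | P i) G i).
Proof.
move=> h; elim/big_rec2: _ => [//|i p q Pi h2].
by apply: eq_uptoM => //; exact: h.
Qed.

Definition series_poly N a : {poly R} := \poly_(k < N.+1) a k.

Lemma coef_series_poly N a j : (j <= N)%N -> (series_poly N a)`_j = a j.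
Proof. by move=> jN; rewrite coef_poly ltnS jN. Qed.

Lemma eq_upto_series_poly M N a : (M <= N)%N ->
  eq_upto M (series_poly N a) (series_poly M a).
Proof.
by move=> MN j jM; rewrite !coef_series_poly// (leq_trans jM MN).
Qed.

(** The simplex [\sum_i k i <= N] is the support of the coefficient of degree
    [N] once a slack variable carries the remaining degree. *)
Lemma simplex_sumE (I : finType) N a (c : I -> nat -> R) :
  \sum_(k : {ffun I -> 'I_N.+1} | (\sum_i k i <= N)%N)
    a (N - \sum_i k i)%N * \prod_i c i (k i) =
  (series_poly N a * \prod_i series_poly N (c i))`_N.
Proof.
have -> : \prod_i series_poly N (c i) =
    \sum_(k : {ffun I -> 'I_N.+1}) (\prod_i c i (k i)) *: 'X^(\sum_i k i).
  rewrite /series_poly; under eq_bigr do rewrite poly_def.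
  rewrite bigA_distr_bigA/=; apply: eq_bigr => k _.
  under eq_bigr do rewrite -mul_polyC.
  by rewrite big_split/= -mul_polyC rmorph_prod/= -expr_sum.
rewrite mulr_sumr coef_sum [LHS]big_mkcond/=; apply: eq_bigr => k _.
rewrite -scalerAr coefZ coefMXn ltnNge; case: leqP => kN/=; last by rewrite mulr0.
by rewrite coef_series_poly ?leq_subr// mulrC.
Qed.

Lemma exp_coeffX (x : R) k : exp_coeff x k = x ^+ k / k`!%:R.
Proof. by []. Qed.

Lemma fact_neq0 k : (k`!%:R : R) != 0.
Proof. by rewrite pnatr_eq0 -lt0n fact_gt0. Qed.

(** The binomial theorem, read as the law [e^x e^s = e^(x + s)]. *)
Lemma coef_mul_exp N p x (s : R) :
  (forall j, (j <= N)%N -> p`_j = s ^+ j / j`!%:R) ->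
  forall j, (j <= N)%N ->
    (series_poly N (exp_coeff x) * p)`_j = (x + s) ^+ j / j`!%:R.
Proof.
move=> hp j jN; rewrite coefM addrC exprDn mulr_suml; apply: eq_bigr => i _.
have ij : (i <= j)%N by rewrite -ltnS.
rewrite coef_series_poly ?(leq_trans ij)// hp; last by rewrite (leq_trans (leq_subr _ _)).
rewrite exp_coeffX -[_ *+ 'C(_, _)]mulr_natr -(bin_fact ij) !natrM.
have f0 := fact_neq0.
have : ('C(j, i)%:R : R) != 0 by rewrite pnatr_eq0 -lt0n bin_gt0.
move: ('C(j, i)%:R : R) (i`!%:R : R) (f0 i) ((j - i)`!%:R : R) (f0 (j - i)%N).
move=> u v v0 w w0 u0; field; exact/and3P.
Qed.

Lemma coef_prod_exp (I : Type) (r : seq I) N (x0 : R) (x : I -> R) j : (j <= N)%N ->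
  (series_poly N (exp_coeff x0) * \prod_(i <- r) series_poly N (exp_coeff (x i)))`_j =
  (x0 + \sum_(i <- r) x i) ^+ j / j`!%:R.
Proof.
elim: r j x0 => [|i r IH] j x0 jN.
  rewrite !big_nil mulr1 addr0 coef_series_poly//.
rewrite !big_cons; apply: coef_mul_exp jN => {}j jN.
by rewrite IH.
Qed.

(** A falling factorial differentiates the exponential series, so it only shifts
    and scales it. *)
Lemma falling_series N e (x : R) :
  eq_upto N (series_poly N (fun k => (k ^_ e)%:R * exp_coeff x k))
            (x ^+ e *: 'X^e * series_poly N (exp_coeff x)).
Proof.
move=> j jN; rewrite coef_series_poly// -scalerAl coefZ coefXnM.
case: ltnP => je; first by rewrite ffact_small// mul0r mulr0.
rewrite coef_series_poly ?(leq_trans (leq_subr _ _))// !exp_coeffX [RHS]mulrA -exprD subnKC//.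
rewrite mulrCA; congr (_ * _).
have f0 := @fact_neq0 (j - e)%N.
rewrite -(ffact_fact je) natrM invfM mulrA mulfV ?mul1r//.
by rewrite pnatr_eq0 -lt0n ffact_gt0.
Qed.

End truncated_series.

Section multinomial.
Context {R : realType} {d : nat}.
Implicit Types (x : 'rV[R]_d) (N : nat) (k : 'I_d -> nat).

Notation slack x := (1 - \sum_i `|x ord0 i|).

Local Notation mindex N := {ffun 'I_d -> 'I_N.+1}.

Lemma multinomial_probE N k x : multinomial_prob N k x =
  N`!%:R * (exp_coeff (slack x) (N - \sum_i k i)%N *
            \prod_i exp_coeff (x 0 i) (k i)).
Proof.
rewrite /multinomial_prob invfM -prodfV exp_coeffX; under [X in _ = _ * (_ * X)]eq_bigr do rewrite exp_coeffX.
rewrite [in RHS]big_split/=.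
move: (\prod_i _ ^+ _) (\prod_i _^-1) => u v; ring.
Qed.

(** Expectations of products of functions of the individual counts. *)
Lemma multinomial_sumE N x (g : 'I_d -> nat -> R) :
  \sum_(k : mindex N | (\sum_i k i <= N)%N)
    multinomial_prob N (fun i => k i) x * \prod_i g i (k i) =
  N`!%:R * (series_poly N (exp_coeff (slack x)) *
    \prod_i series_poly N (fun j => g i j * exp_coeff (x 0 i) j))`_N.
Proof.
rewrite -simplex_sumE mulr_sumr; apply: eq_bigr => k _.
rewrite multinomial_probE [in RHS]big_split/=.
by move: (\prod_i g _ _) (\prod_i exp_coeff _ _) (exp_coeff _ _) => a b c; ring.
Qed.

Lemma simplex_norm x : simplex x -> \sum_i `|x 0 i| = \sum_i x 0 i.
Proof. by case=> x0 _; apply: eq_bigr => i _; rewrite ger0_norm//; case/andP: (x0 i). Qed.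

Lemma simplex_slack x : simplex x -> slack x + \sum_i x 0 i = 1.
Proof. by move=> sx; rewrite simplex_norm// subrK. Qed.

Lemma multinomial_gf N x (b : 'I_d -> R) :
  \sum_(k : mindex N | (\sum_i k i <= N)%N)
    multinomial_prob N (fun i => k i) x * \prod_i b i ^+ k i =
  (slack x + \sum_i b i * x 0 i) ^+ N.
Proof.
rewrite (multinomial_sumE N x (fun i j => b i ^+ j)).
have E : eq_upto N (series_poly N (exp_coeff (slack x)) *
    \prod_i series_poly N (fun j => b i ^+ j * exp_coeff (x 0 i) j))
  (series_poly N (exp_coeff (slack x)) *
    \prod_i series_poly N (exp_coeff (b i * x 0 i))).
  apply: eq_uptoM => //; apply: eq_upto_prod => i _ j jN.
  by rewrite !coef_series_poly// !exp_coeffX exprMn mulrA.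
by rewrite E// coef_prod_exp// mulrCA mulfV ?mulr1// fact_neq0.
Qed.

Lemma multinomial_sum1 N x : simplex x ->
  \sum_(k : mindex N | (\sum_i k i <= N)%N) multinomial_prob N (fun i => k i) x = 1.
Proof.
move=> sx; have := multinomial_gf N x (fun=> 1).
under [X in _ + X]eq_bigr do rewrite mul1r.
rewrite simplex_slack// expr1n => <-; apply: eq_bigr => k _.
by rewrite big1 ?mulr1// => i _; rewrite expr1n.
Qed.

Lemma multinomial_ge0 N k x : simplex x -> 0 <= multinomial_prob N k x.
Proof.
move=> [x0 x1]; rewrite multinomial_probE mulr_ge0// mulr_ge0//.
  by rewrite divr_ge0// exprn_ge0// subr_ge0.
by apply: prodr_ge0 => i _; rewrite divr_ge0// exprn_ge0//; case/andP: (x0 i).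
Qed.

Lemma multinomial_le1 N (k : mindex N) x : simplex x -> (\sum_i k i <= N)%N ->
  multinomial_prob N (fun i => k i) x <= 1.
Proof.
move=> sx kN; rewrite -(multinomial_sum1 N sx) (bigD1 k)//= lerDl.
by apply: sumr_ge0 => j _; exact: multinomial_ge0.
Qed.

Lemma factorial_moment N x (e : 'I_d -> nat) : simplex x ->
  \sum_(k : mindex N | (\sum_i k i <= N)%N)
    multinomial_prob N (fun i => k i) x * \prod_i ((k i) ^_ (e i))%:R =
  (N ^_ (\sum_i e i))%:R * \prod_i x 0 i ^+ e i.
Proof.
move=> sx; rewrite (multinomial_sumE N x (fun i j => (j ^_ (e i))%:R)).
set s := (\sum_i e i)%N.
have E : eq_upto N (series_poly N (exp_coeff (slack x)) *
    \prod_i series_poly N (fun j => (j ^_ (e i))%:R * exp_coeff (x 0 i) j))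
  ((\prod_i x 0 i ^+ e i) *: 'X^s * (series_poly N (exp_coeff (slack x)) *
    \prod_i series_poly N (exp_coeff (x 0 i)))).
  rewrite [RHS in eq_upto _ _ RHS]mulrCA; apply: eq_uptoM => //.
  rewrite (_ : (\prod_i _) *: 'X^s = \prod_i (x 0 i ^+ e i *: 'X^(e i))); last first.
    under [RHS]eq_bigr do rewrite -mul_polyC.
    by rewrite big_split/= -mul_polyC rmorph_prod/= -expr_sum.
  by rewrite -big_split/=; apply: eq_upto_prod => i _; exact: falling_series.
rewrite E// -scalerAl coefZ coefXnM; case: ltnP => Ns.
  by rewrite ffact_small// !mulr0 mul0r.
rewrite coef_prod_exp ?leq_subr// simplex_slack// expr1n mul1r mulrCA mulrC.
by congr (_ * _); rewrite -(ffact_fact Ns) natrM mulfK// fact_neq0.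
Qed.

End multinomial.

(** * The local limit for coinciding multinomial vectors *)

Section multinomial_collision.
Context {R : realType}.
Implicit Types (a x : R) (s : seq R) (N M k : nat).

Definition sqr_coeff a : nat -> R := fun k => exp_coeff a k ^+ 2.

Lemma ratio01 (x t : R) : 0 < x -> 0 < t -> 0 < x / (x + t) < 1.
Proof.
move=> x0 t0; rewrite divr_gt0 ?addr_gt0//=.
by rewrite ltr_pdivrMr ?addr_gt0// mul1r ltrDl.
Qed.

(** The squared multinomial weights of total mass [(a + \sum_(x <- s) x) ^+ N],
    summed over all the count vectors. *)
Definition mcollision N a s : R := N`!%:R ^+ 2 *
  (series_poly N (sqr_coeff a) * \prod_(x <- s) series_poly N (sqr_coeff x))`_N.

Lemma mcollision_nil N a : mcollision N a [::] = a ^+ (2 * N).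
Proof.
rewrite /mcollision big_nil mulr1 coef_series_poly// /sqr_coeff exp_coeffX exprMn.
by rewrite mulrCA -exprMn divff ?fact_neq0// expr1n mulr1 -exprM mulnC.
Qed.

Lemma mcollision_cons N a x s : mcollision N a (x :: s) =
  \sum_(k < N.+1) (x ^+ k *+ 'C(N, k)) ^+ 2 * mcollision (N - k) a s.
Proof.
rewrite /mcollision big_cons mulrCA coefM mulr_sumr; apply: eq_bigr => k _.
have kN : (k <= N)%N by rewrite -ltnS.
rewrite coef_series_poly// /sqr_coeff exp_coeffX.
have -> : (series_poly N (sqr_coeff a) * \prod_(x <- s) series_poly N (sqr_coeff x))`_(N - k)
   = (series_poly (N - k) (sqr_coeff a) *
      \prod_(x <- s) series_poly (N - k) (sqr_coeff x))`_(N - k).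
  apply: (@eq_uptoM _ (N - k)) => //; first exact/eq_upto_series_poly/leq_subr.
  by apply: eq_upto_prod => y _; exact/eq_upto_series_poly/leq_subr.
rewrite -[x ^+ k *+ _]mulr_natr -(bin_fact kN) !natrM.
move: (_`_(N - k)) => c.
move: (k`!%:R : R) (@fact_neq0 R k) ((N - k)`!%:R : R) => u u0 v.
by move: ('C(N, k)%:R : R) (x ^+ k) => w y; field.
Qed.

(** Normalized by its total mass, [mcollision] is a probability. *)
Definition collision_prob N a s : R :=
  mcollision N a s / (a + \sum_(x <- s) x) ^+ (2 * N).

Lemma collision_prob_cons N a x s : 0 < a -> all (> 0) s -> 0 < x ->
  collision_prob N a (x :: s) =
  \sum_(k < N.+1) binomial_pmf N (x / (x + (a + \sum_(y <- s) y))) k ^+ 2 *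
    collision_prob (N - k) a s.
Proof.
move=> a0 s0 x0; rewrite /collision_prob big_cons mcollision_cons mulr_suml.
have S0 : 0 <= \sum_(y <- s) y.
  by rewrite big_seq; apply: sumr_ge0 => y /(allP s0)/ltW.
rewrite addrCA; have : 0 < a + \sum_(y <- s) y by rewrite ltr_pwDl.
move: (a + _) => t t0; apply: eq_bigr => k _; have kN : (k <= N)%N by rewrite -ltnS.
rewrite binomial_pmfE (_ : 1 - x / (x + t) = t / (x + t)); last first.
  by field; rewrite gt_eqF ?addr_gt0.
rewrite !expr_div_n -[x ^+ k *+ _]mulr_natr -[_ / _ * _ *+ _]mulr_natr.
move: (mcollision _ _ _) ('C(N, k)%:R : R) => m bin; rewrite !exprMn !exprVn.
rewrite [(2 * N)%N](_ : _ = (k * 2 + (N - k) * 2)%N); last by rewrite -mulnDl subnKC// mulnC.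
rewrite exprD [(2 * (N - k))%N]mulnC !exprM.
have t1 j : t ^+ j != 0 by rewrite expf_neq0 ?gt_eqF.
have t2 j : (x + t) ^+ j != 0 by rewrite expf_neq0 ?gt_eqF ?addr_gt0.
move: (t ^+ (N - k)) (t1 (N - k)%N) ((x + t) ^+ (N - k)) (t2 (N - k)%N) => u u0 v v0.
move: ((x + t) ^+ k) (t2 k) => w w0.
by field; rewrite u0 v0 w0.
Qed.

Lemma collision_prob01 N a s : 0 < a -> all (> 0) s -> 0 <= collision_prob N a s <= 1.
Proof.
move=> a0; elim: s N => [|x s IH] N /=.
  move=> _; rewrite /collision_prob mcollision_nil big_nil addr0 divff ?ler01 ?lexx//.
  by rewrite expf_neq0 ?gt_eqF.
move=> /andP[x0 s0]; rewrite collision_prob_cons//.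
set p := x / _.
have p01 : 0 <= p <= 1.
  have S0 : 0 <= \sum_(y <- s) y.
    by rewrite big_seq; apply: sumr_ge0 => y /(allP s0)/ltW.
  have t0 : 0 < a + \sum_(y <- s) y by rewrite ltr_pwDl.
  by case/andP: (ratio01 x0 t0) => *; rewrite !ltW.
have b0 (k : 'I_N.+1) : 0 <= binomial_pmf N p k <= 1.
  rewrite binomial_pmf_nneg//= -(sum_binomial_pmf N p) (bigD1 k)//= lerDl.
  by apply: sumr_ge0 => j _; exact: binomial_pmf_nneg.
apply/andP; split.
  by apply: sumr_ge0 => k _; rewrite mulr_ge0 ?exprn_even_ge0//; case/andP: (IH (N - k)%N s0).
rewrite -(sum_binomial_pmf N p); apply: ler_sum => k _.
case/andP: (b0 k) (IH (N - k)%N s0) => b1 b2 /andP[c1 c2].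
by rewrite -[leRHS]mulr1 ler_pM ?exprn_even_ge0// expr2 ler_piMr.
Qed.

Definition collision_limit a s : R :=
  Num.sqrt ((a + \sum_(x <- s) x) ^+ (size s).+1 /
            ((4 * pi) ^+ size s * (a * \prod_(x <- s) x))).

(** By induction on the number of categories: given the count of the first
    one, which is binomial and concentrates at a fixed proportion of [N], the
    remaining ones are again multinomial. *)
Lemma collision_prob_cvg s a : all (> 0) s -> 0 < a ->
  (fun z : nat * R => Num.sqrt z.1%:R ^+ size s * collision_prob z.1 z.2 s)
    @ filter_prod \oo (nbhs a) --> collision_limit a s.
Proof.
have pi0 := @pi_gt0 R.
elim: s a => [|x s IH] a /=.
  move=> _ a0; rewrite /collision_limit !big_nil addr0 expr0 mul1r mulr1 divff ?gt_eqF// sqrtr1.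
  apply: cvg_near_cst.
  have Ga : \forall y \near a, 0 < y by exact: lt_nbhsr.
  apply: filterS (near_prodr (F := \oo) Ga) => z z0.
  by rewrite expr0 mul1r /collision_prob mcollision_nil big_nil addr0 divff// expf_neq0// gt_eqF.
move=> /andP[x0 s0] a0.
have S0 : 0 <= \sum_(y <- s) y.
  by rewrite big_seq; apply: sumr_ge0 => y /(allP s0)/ltW.
pose S := \sum_(y <- s) y.
pose p (y : R) := x / (x + (y + S)).
have p01 y : 0 < y -> 0 < p y < 1.
  by move=> y0; apply: ratio01 => //; rewrite ltr_pwDl.
have tS : 0 < a + S by rewrite ltr_pwDl.
have q0 : 0 < 1 - p a by rewrite subr_gt0; case/andP: (p01 _ a0).
have pcvg : p y @[y --> a] --> p a.
  apply: cvgM; first exact: cvg_cst.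
  apply: cvgV; first by rewrite gt_eqF// (addr_gt0 x0 tS).
  apply: cvgD; first exact: cvg_cst.
  by apply: cvgD; [exact: cvg_id|exact: cvg_cst].
set r := size s.
pose l1 : R := (Num.sqrt (4 * pi * p a * (1 - p a)))^-1.
pose psi := collision_limit a s.
pose h (y : R) := (Num.sqrt y)^-1 ^+ r.
pose c := h (1 - p a) * psi.
have l10 : 0 <= l1 by rewrite invr_ge0 sqrtr_ge0.
have psi0 : 0 <= psi by exact: sqrtr_ge0.
have h0 y : 0 <= h y by rewrite exprn_ge0// invr_ge0 sqrtr_ge0.
have c0 : 0 <= c by rewrite mulr_ge0.
have -> : collision_limit a (x :: s) = c * l1.
  apply/eqP; rewrite -(@eqrXn2 _ 2)// ?sqrtr_ge0 ?mulr_ge0//.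
  have P0 : 0 < \prod_(y <- s) y by rewrite big_seq; apply: prodr_gt0 => y /(allP s0).
  have xt0 := addr_gt0 x0 tS.
  have q1 : 1 - p a = (a + S) / (x + (a + S)) by rewrite /p; field; rewrite gt_eqF.
  have E1 : h (1 - p a) ^+ 2 = (x + (a + S)) ^+ r / (a + S) ^+ r.
    rewrite /h -exprM mulnC exprM exprVn sqr_sqrtr ?ltW// q1 exprVn expr_div_n.
    by rewrite invfM invrK mulrC.
  have E2 : l1 ^+ 2 = (4 * pi * p a * (1 - p a))^-1.
    case/andP: (p01 _ a0) => pa0 _; rewrite /l1 exprVn sqr_sqrtr//.
    exact: mulr_ge0 (mulr_ge0 (mulr_ge0 _ (ltW pi0)) (ltW pa0)) (ltW q0).
  have E3 : psi ^+ 2 = (a + S) ^+ r.+1 / ((4 * pi) ^+ r * (a * \prod_(y <- s) y)).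
    rewrite /psi /collision_limit sqr_sqrtr// divr_ge0 ?exprn_ge0 ?(ltW tS)//.
    by rewrite mulr_ge0 ?exprn_ge0 ?mulr_ge0 ?(ltW a0) ?(ltW P0) ?(ltW pi0).
  have E4 : collision_limit a (x :: s) ^+ 2 = (x + (a + S)) ^+ r.+2 /
      ((4 * pi) ^+ r.+1 * (a * (x * \prod_(y <- s) y))).
    rewrite /collision_limit !big_cons -/S [a + (x + S)]addrCA sqr_sqrtr//.
    rewrite divr_ge0 ?exprn_ge0 ?(ltW xt0)// mulr_ge0 ?exprn_ge0 ?mulr_ge0//;
      by rewrite ?mulr_ge0 ?(ltW a0) ?(ltW x0) ?(ltW P0) ?(ltW pi0).
  rewrite E4 /c [(_ * l1) ^+ 2]exprMn [(_ * psi) ^+ 2]exprMn E1 E2 E3 q1 /p !exprS.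
  have := gt_eqF tS; have := gt_eqF xt0.
  have := gt_eqF P0; have := gt_eqF a0; have := gt_eqF x0; have := gt_eqF pi0.
  move: (\prod_(y <- s) y) (pi : R) (a + S) => P pp t pp0 x00 a00 P00 u0 t0.
  have ur : (x + t) ^+ r != 0 by rewrite expf_neq0// u0.
  have tr : t ^+ r != 0 by rewrite expf_neq0// t0.
  have pr : (4 * pp) ^+ r != 0 by rewrite expf_neq0// mulf_neq0 ?pp0.
  move: ((x + t) ^+ r) (t ^+ r) ((4 * pp) ^+ r) ur tr pr => ur tr pr ur0 tr0 pr0.
  by apply/eqP; field; rewrite ?u0 ?t0 ?pp0 ?x00 ?a00 ?P00 ?tr0 ?pr0.
have {}IH := IH _ s0 a0.
apply/cvgrPdist_le => /= e e0.
have k0 : 0 < l1 + 1 + c + 1 by rewrite ltr_pwDr// !addr_ge0.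
pose e1 := Num.min 1 (e / (l1 + 1 + c + 1)).
have e10 : 0 < e1 by rewrite lt_min ltr01 divr_gt0.
have e11 : e1 <= 1 by rewrite ge_min lexx.
have e1e : e1 * (l1 + 1 + c + 1) <= e.
  by rewrite -ler_pdivlMr// ge_min lexx orbT.
(* continuity of multiplication at the pair of limits *)
have : (fun u : R * R => h u.1 * u.2) @ filter_prod (nbhs (1 - p a)) (nbhs psi) --> c.
  have hc : h y @[y --> 1 - p a] --> h (1 - p a).
    have sc : (Num.sqrt y)^-1 @[y --> 1 - p a] --> (Num.sqrt (1 - p a))^-1.
      by apply: cvgV; [rewrite gt_eqF// sqrtr_gt0|exact: sqrt_continuous].
    rewrite /h; elim: (r) => [|j IHj].
      by under eq_fun do rewrite expr0; exact: cvg_cst.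
    by under eq_fun do rewrite exprS; rewrite exprS; exact: cvgM.
  by apply: cvgM; [exact: (cvg_comp _ _ cvg_fst hc)|exact: cvg_snd].
move=> /cvgrPdist_le/(_ _ e10)[[A B] /= [hA hB] AB].
have [dA /= dA0 {}hA] : exists2 D : R, 0 < D & ball (1 - p a) D `<=` A by exact/nbhs_ballP.
have [dB /= dB0 {}hB] : exists2 D : R, 0 < D & ball psi D `<=` B by exact/nbhs_ballP.
(* [D] is the tolerated deviation of the first count. *)
pose D := Num.min (dA / 4) (Num.min ((1 - p a) / 8) 1).
have D0 : 0 < D by rewrite !lt_min !divr_gt0 ?ltr01.
have D1 : D <= 1 by rewrite !ge_min lexx !orbT.
have Dd : D <= dA / 4 by rewrite ge_min lexx.
have Dq : D <= (1 - p a) / 8 by rewrite !ge_min lexx !orbT.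
have dB2 : 0 < dB / 2 by rewrite divr_gt0.
move/cvgrPdist_le: IH => /(_ _ dB2)[[F G] /= [[M0 _ hM0] hG] FG].
have F1 : \forall N \near \oo, M0%:R / ((1 - p a) / 2) <= N%:R by exact: nbhs_infty_ger.
have F2 : \forall N \near \oo, (0 < N)%N by exact: nbhs_infty_gt.
have F3 : \forall N \near \oo,
    (1 + c) * (N%:R ^+ r.+1 * (2 * expR (- (D ^+ 2 / 8 * N%:R)))) <= e1.
  have D8 : 0 < D ^+ 2 / 8 by rewrite divr_gt0 ?exprn_gt0.
  have e8 : 0 < e1 / (2 * (1 + c)) by rewrite divr_gt0// mulr_gt0// ltr_pwDl.
  have := cvg_poly_exp r.+1 D8 => /cvgrPdist_le/(_ _ e8).
  apply: filterS => N; rewrite sub0r normrN => g.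
  have {}g := le_trans (ler_norm _) g.
  rewrite ler_pdivlMr ?mulr_gt0 ?ltr_pwDl// in g.
  by apply: le_trans g; rewrite le_eqVlt; apply/orP; left; apply/eqP; ring.
have G1 : \forall y \near a, `|p a - p y| <= D by move/cvgrPdist_le : pcvg; exact.
have G2 : \forall y \near a, 0 < y by exact: lt_nbhsr.
have G3 : \forall z \near filter_prod \oo (nbhs a),
    `|l1 - Num.sqrt z.1%:R * collision z.1 (p z.2)| <= e1.
  have cc := collision_cvg (p01 _ a0).
  have pp : (fun z : nat * R => (z.1, p z.2)) @ filter_prod \oo (nbhs a) -->
      filter_prod \oo (nbhs (p a)).
    by move=> P [[A' B'] /= [hA' hB'] AB']; exists (A', p @^-1` B') => [|u []]; [split=> //; exact: pcvg|move=> *; exact: AB'].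
  by have /cvgrPdist_le := cvg_comp _ _ pp cc; exact.
near=> z.
have : (0 < z.1)%N by near: z; exact: (near_prodl F2).
have : M0%:R / ((1 - p a) / 2) <= z.1%:R by near: z; exact: (near_prodl F1).
have : (1 + c) * (z.1%:R ^+ r.+1 * (2 * expR (- (D ^+ 2 / 8 * z.1%:R)))) <= e1.
  by near: z; exact: (near_prodl F3).
have : `|p a - p z.2| <= D by near: z; exact: (near_prodr G1).
have : 0 < z.2 by near: z; exact: (near_prodr G2).
have : G z.2 by near: z; exact: (near_prodr hG).
have : `|l1 - Num.sqrt z.1%:R * collision z.1 (p z.2)| <= e1 by near: z; exact: G3.
move: (z.1) (z.2) => N y W1 Gy y0 py tail NM N0.
have NR : 0 < N%:R :> R by rewrite ltr0n.
have N1 : 1 <= N%:R :> R by rewrite ler1n.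
have py01 : 0 <= p y <= 1 by case/andP: (p01 _ y0) => *; rewrite !ltW.
have sN1 : 1 <= Num.sqrt N%:R :> R by rewrite -[leLHS]sqrtr1 ler_wsqrtr.
have sNN : Num.sqrt N%:R <= N%:R :> R.
  by rewrite -[leRHS](sqr_sqrtr (ltW NR)) expr2 ler_peMr ?sqrtr_ge0.
rewrite collision_prob_cons// -[x / _]/(p y).
pose w (k : 'I_N.+1) := Num.sqrt N%:R * binomial_pmf N (p y) k ^+ 2.
pose g (k : 'I_N.+1) := Num.sqrt N%:R ^+ r * collision_prob (N - k) y s.
have -> : Num.sqrt N%:R ^+ r.+1 * \sum_(k < N.+1) binomial_pmf N (p y) k ^+ 2 *
    collision_prob (N - k) y s = \sum_k w k * g k.
  rewrite mulr_sumr; apply: eq_bigr => k _; rewrite /w /g exprS.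
  ring.
pose bad (k : 'I_N.+1) := D * N%:R <= `|k%:R - p y * N%:R|.
have w0 (k : 'I_N.+1) : 0 <= w k by rewrite mulr_ge0 ?sqrtr_ge0 ?exprn_even_ge0.
have sw : \sum_k w k = Num.sqrt N%:R * collision N (p y) by rewrite -mulr_sumr.
have good (k : 'I_N.+1) : ~~ bad k -> `|g k - c| <= e1.
  rewrite /bad -ltNge => kD.
  have kN : (k <= N)%N by rewrite -ltnS.
  have MN : (N - k)%:R / N%:R = 1 - k%:R / N%:R :> R.
    by rewrite natrB// mulrBl divff ?gt_eqF.
  have hk : `|k%:R / N%:R - p y| < D.
    rewrite -(@ltr_pM2r _ N%:R)// -[X in _ * X < _](gtr0_norm NR) -normrM mulrBl.
    by rewrite divfK ?gt_eqF.
  have hA1 : A ((N - k)%:R / N%:R).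
    apply: hA; rewrite /ball/= MN; move: hk py Dd D0; rewrite !ltr_norml !ler_norml; clear; lra.
  have Mbig : (1 - p a) / 2 <= (N - k)%:R / N%:R.
    by rewrite MN; move: hk py Dq q0; rewrite !ltr_norml !ler_norml; clear; lra.
  have MR : 0 < (N - k)%:R :> R.
    by rewrite -(@pmulr_lgt0 _ N%:R^-1) ?invr_gt0//; apply: lt_le_trans Mbig; rewrite divr_gt0.
  have FM : F (N - k)%N.
    apply: hM0 => /=; rewrite -(ler_nat R).
    move: NM; rewrite ler_pdivrMr ?divr_gt0// => /le_trans; apply.
    by move: Mbig; rewrite ler_pdivlMr// mulrC.
  have hB1 : B (Num.sqrt (N - k)%:R ^+ r * collision_prob (N - k) y s).
    apply: hB; rewrite /ball/=; apply: le_lt_trans (FG (_, y) (conj FM Gy)) _.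
    by move: dB0; clear; lra.
  have := AB (_, _) (conj hA1 hB1); rewrite /= distrC.
  rewrite (_ : h _ * _ = g k)// /h /g mulrA -exprMn; congr (_ ^+ _ * _).
  rewrite sqrtrM ?ltW// sqrtrV ?ltW// invfM invrK.
  by rewrite mulrAC mulVf ?mul1r// gt_eqF// sqrtr_gt0.
have gB (k : 'I_N.+1) : bad k -> `|g k - c| <= (1 + c) * N%:R ^+ r.
  move=> _; case/andP: (collision_prob01 (N - k) y0 s0) => c1 c2.
  apply: le_trans (ler_normB _ _) _; rewrite (ger0_norm c0) ger0_norm; last first.
    by rewrite mulr_ge0 ?exprn_ge0 ?sqrtr_ge0.
  rewrite mulrDl mul1r lerD// ?ler_peMr ?exprn_ege1//.
  rewrite -[leRHS]mulr1 ler_pM ?exprn_ge0 ?sqrtr_ge0//.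
  by rewrite lerXn2r ?nnegrE ?sqrtr_ge0.
have := weighted_average_dist w0 (ltW e10) good gB.
have dev : \sum_(k | bad k) w k <= N%:R * (2 * expR (- (D ^+ 2 / 8 * N%:R))).
  rewrite -mulr_sumr ler_pM ?sqrtr_ge0//; first by apply: sumr_ge0 => *; rewrite exprn_even_ge0.
  apply: (@le_trans _ _ (\sum_(k | bad k) binomial_pmf N (p y) k)).
    apply: ler_sum => k _; rewrite expr2 ler_piMr ?binomial_pmf_nneg//.
    rewrite -(sum_binomial_pmf N (p y)) (bigD1 k)//= lerDl.
    by apply: sumr_ge0 => j _; exact: binomial_pmf_nneg.
  apply: (@binomial_deviation R _ (fun k : 'I_N.+1 => binomial_pmf N (p y) k)
    (fun k : 'I_N.+1 => k%:R)) => //.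
  - by move=> k; exact: binomial_pmf_nneg.
  - by rewrite D0 D1.
  - by move=> t; rewrite binomial_mgf.
rewrite sw; set W := Num.sqrt _ * collision _ _; move=> hs.
have t1 : (1 + c) * N%:R ^+ r * (\sum_(k | bad k) w k) <= e1.
  apply: le_trans tail; rewrite -[leLHS]mulrA ler_wpM2l ?addr_ge0//.
  by rewrite exprSr -[leRHS]mulrA ler_wpM2l ?exprn_ge0.
have W2 : W <= l1 + 1 by move: W1 e11; rewrite -/W ler_norml; clear; lra.
have cW : `|c * l1 - c * W| <= c * e1 by rewrite -mulrBr normrM (ger0_norm c0) ler_wpM2l.
have eW : e1 * W <= e1 * (l1 + 1) by rewrite ler_wpM2l// ltW.
apply: le_trans e1e; apply: le_trans (ler_distD (c * W) _ _) _.
rewrite [`|c * W - _|]distrC; apply: le_trans (lerD cW hs) _.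
by move: eW t1; rewrite !mulrDr mulr1; clear; lra.
Unshelve. all: by end_near. Qed.

End multinomial_collision.

(** * The Poisson limit for coinciding multinomial vectors *)

Section poisson.
Context {R : realType}.
Implicit Types (l u : R) (ls : seq R) (N j m : nat).

Lemma sum_exp_coeff_le N l : 0 <= l -> \sum_(k < N) exp_coeff l k <= expR l.
Proof.
move=> l0; rewrite /expR -(big_mkord xpredT (exp_coeff l)).
apply: nondecreasing_cvgn_le (is_cvg_series_exp_coeff l) N.
by apply: nondecreasing_series => n _ _; rewrite exp_coeff_ge0.
Qed.

Lemma exp_coeff_le l k : 0 <= l -> exp_coeff l k <= expR l.
Proof.
move=> l0; apply: le_trans (sum_exp_coeff_le k.+1 l0).
rewrite big_ord_recr/= lerDr; apply: sumr_ge0 => j _; exact: exp_coeff_ge0.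
Qed.

(** The tail of [\sum_k (l ^ k / k!) ^ 2] is exponentially small: each of its
    terms gains a factor [e ^ k] at the price of a larger constant. *)
Lemma sum_sqr_coeff_exp_le N l : 0 <= l ->
  \sum_(k < N) expR 1 ^+ k * sqr_coeff l k <= expR (l + expR 1 * l).
Proof.
move=> l0; rewrite expRD.
have e0 : 0 <= expR 1 * l by rewrite mulr_ge0 ?expR_ge0.
apply: le_trans (ler_wpM2l (expR_ge0 l) (sum_exp_coeff_le N e0)).
rewrite mulr_sumr; apply: ler_sum => k _.
rewrite [exp_coeff (_ * _) _]exp_coeffX exprMn -[_ * _ / _]mulrA -exp_coeffX.
rewrite /sqr_coeff expr2 mulrA [leRHS]mulrC ler_wpM2l ?exp_coeff_le//.
by rewrite mulr_ge0 ?exprn_ge0 ?expR_ge0 ?exp_coeff_ge0.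
Qed.

Lemma sqr_coeff_ge0 l k : 0 <= sqr_coeff l k.
Proof. by rewrite exprn_even_ge0. Qed.

Lemma bessel_I0_partial l N : 0 <= l -> (0 < N)%N ->
  \sum_(k < N) sqr_coeff l k <= bessel_I0 (2 * l) <=
    \sum_(k < N) sqr_coeff l k + expR (l + expR 1 * l) / N%:R.
Proof.
move=> l0 N0.
have E : (fun k => (2 * l / 2) ^+ (2 * k) / (k`!%:R) ^+ 2) = sqr_coeff l.
  apply/funext => k; rewrite /sqr_coeff exp_coeffX mulrAC divff// mul1r.
  by rewrite mulnC exprM expr_div_n.
rewrite /bessel_I0 E.
have nd : nondecreasing_seq (series (sqr_coeff l)).
  by apply: nondecreasing_series => n _ _; exact: sqr_coeff_ge0.
have tail M : (N <= M)%N ->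
    series (sqr_coeff l) M <= \sum_(k < N) sqr_coeff l k + expR (l + expR 1 * l) / N%:R.
  move=> NM; rewrite /series/= (big_cat_nat _ NM)//= big_mkord lerD2l.
  rewrite ler_pdivlMr ?ltr0n// mulrC mulr_sumr.
  apply: le_trans (sum_sqr_coeff_exp_le M l0).
  rewrite -(big_mkord xpredT (fun k => expR 1 ^+ k * sqr_coeff l k)).
  rewrite [leRHS](big_cat_nat _ NM)//= ler_wpDl//.
    by apply: sumr_ge0 => k _; rewrite mulr_ge0 ?sqr_coeff_ge0// exprn_ge0 ?expR_ge0.
  rewrite big_nat_cond [leRHS]big_nat_cond; apply: ler_sum => k /andP[/andP[Nk _] _].
  rewrite ler_wpM2r ?sqr_coeff_ge0// -expRM_natr mul1r.
  apply: (@le_trans _ _ k%:R); first by rewrite ler_nat.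
  by apply: le_trans (expR_ge1Dx _); rewrite lerDr.
have cv : cvgn (series (sqr_coeff l)).
  apply: nondecreasing_is_cvgn => //.
  exists (\sum_(k < N) sqr_coeff l k + expR (l + expR 1 * l) / N%:R) => _ [M _ <-].
  case: (leqP N M) => [/tail//|/ltnW MN]; apply: le_trans (nd _ _ MN) (tail _ _).
  exact: leqnn.
apply/andP; split.
  by rewrite -(big_mkord xpredT); exact: nondecreasing_cvgn_le.
by apply: limr_le => //; near=> M; apply: tail; near: M; exact: nbhs_infty_ge.
Unshelve. all: by end_near. Qed.

Lemma sum_sqr_coeff_le N l : 0 <= l -> \sum_(k < N) sqr_coeff l k <= expR (2 * l).
Proof.
move=> l0; rewrite mulr_natl mulr2n expRD.
apply: le_trans (ler_wpM2l (expR_ge0 l) (sum_exp_coeff_le N l0)).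
rewrite mulr_sumr; apply: ler_sum => k _.
by rewrite /sqr_coeff expr2 ler_wpM2r ?exp_coeff_ge0// exp_coeff_le.
Qed.

(** The weight is a collision probability of two Poisson variables; the bound
    passes to the limit from finite sums. *)
Lemma bessel_weight01 l : 0 <= l -> 0 <= expR (- (2 * l)) * bessel_I0 (2 * l) <= 1.
Proof.
move=> l0; have [+ _] := andP (bessel_I0_partial l0 (ltn0Sn 0)).
rewrite big_ord_recl big_ord0 addr0 => h.
rewrite mulr_ge0 ?expR_ge0 ?(le_trans _ h) ?sqr_coeff_ge0//=.
rewrite expRN mulrC ler_pdivrMr ?expR_gt0// mul1r.
apply/ler_addgt0Pr => e e0.
have [n n0] : exists n, expR (l + expR 1 * l) / n.+1%:R <= e.
  have K0 : 0 <= expR (l + expR 1 * l) / e by rewrite divr_ge0 ?expR_ge0 ?ltW.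
  have := archi_boundP K0; set n := Num.bound _; rewrite ltr_pdivrMr// => /ltW Kn.
  exists n; rewrite ler_pdivrMr// [e * _]mulrC; apply: le_trans Kn _.
  by rewrite ler_pM2r// ler_nat.
have [_ h2] := andP (bessel_I0_partial l0 (ltn0Sn n)).
by apply: le_trans h2 _; rewrite lerD ?sum_sqr_coeff_le.
Qed.

Lemma bessel_weight_gt0 l : 0 <= l -> 0 < expR (- (2 * l)) * bessel_I0 (2 * l).
Proof.
move=> l0; have [+ _] := andP (bessel_I0_partial l0 (ltn0Sn 0)).
rewrite big_ord_recl big_ord0 addr0 => h; rewrite mulr_gt0 ?expR_gt0//.
by apply: lt_le_trans h; rewrite /sqr_coeff exp_coeffX expr0 divr1 expr1n.
Qed.

Lemma prod_dist01 (I : eqType) (r : seq I) (a b : I -> R) :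
  {in r, forall i, 0 <= a i <= 1} -> {in r, forall i, 0 <= b i <= 1} ->
  `|\prod_(i <- r) a i - \prod_(i <- r) b i| <= \sum_(i <- r) `|a i - b i|.
Proof.
elim: r => [|i r IH] a01 b01; first by rewrite !big_nil subrr normr0.
have rj (j : I) : j \in r -> j \in i :: r by move=> jr; rewrite in_cons jr orbT.
have {}IH := IH (fun (j : I) jr => a01 j (rj j jr)) (fun (j : I) jr => b01 j (rj j jr)).
rewrite !big_cons.
have -> : a i * \prod_(j <- r) a j - b i * \prod_(j <- r) b j =
  (a i - b i) * \prod_(j <- r) a j + b i * (\prod_(j <- r) a j - \prod_(j <- r) b j).
  by ring.
have ra (j : I) : j \in r -> 0 <= a j <= 1 by move=> /rj; exact: a01.
apply: le_trans (ler_normD _ _) _; rewrite !normrM lerD//.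
  rewrite ler_piMr// big_seq ger0_norm; last by apply: prodr_ge0 => j /ra/andP[].
  apply: (@le_trans _ _ (\prod_(j <- r | j \in r) 1)); last by rewrite big1.
  exact: ler_prod.
have /andP[b0 b1] := b01 i (mem_head _ _).
by rewrite (ger0_norm b0); apply: le_trans IH; rewrite ler_piMl.
Qed.

(** [poisson_weight m N ls j] sums the squared probabilities of the values of
    total [j] of the counts with small means [l], [l \in ls], in [N] trials
    with probabilities [l / m]. *)
Definition poisson_weight m N ls j : R :=
  ((N ^_ j)%:R * (1 - (\sum_(l <- ls) l) / m%:R) ^+ (N - j)) ^+ 2 *
  (\prod_(l <- ls) series_poly N (sqr_coeff (l / m%:R)))`_j.

Lemma coef_prod_sqr_scale N ls u j : (j <= N)%N ->
  (\prod_(l <- ls) series_poly N (sqr_coeff (l * u)))`_j =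
  u ^+ (2 * j) * (\prod_(l <- ls) series_poly N (sqr_coeff l))`_j.
Proof.
elim: ls j => [|l ls IH] j jN.
  by rewrite !big_nil !coef1; case: j {jN} => [|j]; rewrite ?mulr1 ?mulr0// muln0 expr0.
rewrite !big_cons !coefM mulr_sumr; apply: eq_bigr => i _.
have ij : (i <= j)%N by rewrite -ltnS.
rewrite !coef_series_poly ?(leq_trans ij)// IH; last by rewrite (leq_trans (leq_subr _ _)).
rewrite /sqr_coeff !exp_coeffX exprMn.
rewrite [(2 * j)%N](_ : _ = (i * 2 + 2 * (j - i))%N); last first.
  by rewrite [(i * 2)%N]mulnC -mulnDr subnKC.
rewrite exprD [u ^+ (i * 2)]exprM !exprMn; move: (_`_(j - i)) (u ^+ (2 * _)) (u ^+ i) => a b c; ring.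
Qed.

Lemma ffact_ratio N j :
  1 - (1 + j%:R) ^+ 2 / N.+1%:R <= ((N ^_ j)%:R / N.+1%:R ^+ j : R) <= 1.
Proof.
have m0 : 0 < N.+1%:R :> R by [].
elim: j => [|j /andP[IH1 IH2]].
  by rewrite ffactn0 expr0 divr1 lexx andbT lerBlDr lerDl divr_ge0// exprn_ge0.
have t0 : 0 <= (N ^_ j)%:R / N.+1%:R ^+ j :> R by rewrite divr_ge0// exprn_ge0.
have E : (N ^_ j.+1)%:R / N.+1%:R ^+ j.+1 =
   (N ^_ j)%:R / N.+1%:R ^+ j * ((N - j)%:R / N.+1%:R) :> R.
  by rewrite ffactnSr natrM exprSr invfM mulrACA.
have q1 : (N - j)%:R / N.+1%:R <= 1 :> R.
  by rewrite ler_pdivrMr// mul1r ler_nat leqW// leq_subr.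
have q2 : 1 - (1 + j%:R) / N.+1%:R <= (N - j)%:R / N.+1%:R :> R.
  rewrite lerBlDr -mulrDl ler_pdivlMr// mul1r nat1r -natrD ler_nat addnS ltnS.
  by rewrite addnC -leq_subLR.
have q0 : 0 <= (N - j)%:R / N.+1%:R :> R by rewrite divr_ge0.
rewrite E -[in (1 + j.+1%:R)]natr1; move: q0 q1 q2 t0 IH1 IH2 {E}.
rewrite [_ ^+ 2 / _]mulrC [(1 + _) / _]mulrC [(_ + _) ^+ 2 / _]mulrC.
move: (_ / _ ^+ _) (_ / N.+1%:R) => t q q0 q1 q2 t0 h1 h2.
have im : 0 < N.+1%:R^-1 :> R by rewrite invr_gt0.
have J0 : 0 <= j%:R :> R by [].
move: (N.+1%:R^-1 : R) im (j%:R : R) J0 q2 h1 => w w0 J J0 q2 h1.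
apply/andP; split; last by rewrite mulr_ile1.
have : t - t * (1 - q) = t * q by ring.
have : t * (1 - q) <= 1 - q by rewrite ler_piMl// subr_ge0.
have : w * (1 + (J + 1)) ^+ 2 - w * (1 + J) ^+ 2 - w * (1 + J) = w * (2 + J) by ring.
have : 0 <= w * (2 + J) by rewrite mulr_ge0 ?(ltW w0)// addr_ge0.
lra.
Qed.

(** The factor by which the binomial weight of a total [j] differs from the
    Poisson one. The polynomial growth in [j] of the bound is harmless against the
    exponential moments of [j]. *)
Lemma poisson_ratio N j u : (j <= N)%N -> 0 <= u -> u <= N.+1%:R ->
  let r := (N ^_ j)%:R / N.+1%:R ^+ j * (1 - u / N.+1%:R) ^+ (N - j) * expR u in
  0 <= r <= expR u /\
  `|r - 1| <= (1 + u) ^+ 2 * expR u * (1 + j%:R) ^+ 2 / N.+1%:R.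
Proof.
move=> jN u0 um r; rewrite /r {r}.
have m0 : 0 < N.+1%:R :> R by [].
have [t1 t2] := andP (ffact_ratio N j).
have t0 : 0 <= (N ^_ j)%:R / N.+1%:R ^+ j :> R by rewrite divr_ge0// exprn_ge0.
move: (_ / _ ^+ _) t0 t1 t2 => t t0 t1 t2.
set s := 1 - u / N.+1%:R.
have s0 : 0 <= s by rewrite subr_ge0 ler_pdivrMr// mul1r.
have s1 : s <= 1 by rewrite lerBlDr lerDl divr_ge0.
have e1 : 1 <= expR u by apply: le_trans (expR_ge1Dx _); rewrite lerDl.
have sp : s ^+ (N - j) <= 1 by rewrite exprn_ile1.
have sp0 : 0 <= s ^+ (N - j) by rewrite exprn_ge0.
(* the power of [s] compensates [expR u] up to [(1 + j) / m] *)
have up : s ^+ (N - j) * expR u <= 1 + u * (1 + j%:R) / N.+1%:R * expR u.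
  apply: (@le_trans _ _ (expR (u * (1 + j%:R) / N.+1%:R))).
    apply: (@le_trans _ _ (expR (- (u / N.+1%:R)) ^+ (N - j) * expR u)).
      rewrite ler_wpM2r ?expR_ge0// lerXn2r ?nnegrE ?expR_ge0//.
      exact: expR_ge1Dx.
    rewrite -expRM_natr -expRD ler_expR natrB//.
    rewrite le_eqVlt; apply/orP; left; apply/eqP.
    by rewrite -[N.+1%:R]natr1; field; rewrite natr1.
  have v0 : 0 <= u * (1 + j%:R) / N.+1%:R by rewrite divr_ge0// mulr_ge0// addr_ge0.
  have vu : u * (1 + j%:R) / N.+1%:R <= u.
    by rewrite ler_pdivrMr// ler_wpM2l// nat1r ler_nat.
  apply: (@le_trans _ _ (1 + u * (1 + j%:R) / N.+1%:R * expR (u * (1 + j%:R) / N.+1%:R))).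
    have := expR_ge1Dx (- (u * (1 + j%:R) / N.+1%:R)); rewrite expRN => h.
    have := expR_gt0 (u * (1 + j%:R) / N.+1%:R).
    move: (u * (1 + j%:R) / N.+1%:R) v0 vu h => v _ _ h h0.
    have : (1 - v) * expR v <= 1 by rewrite -ler_pdivlMr// mul1r.
    lra.
  by rewrite lerD2l ler_wpM2l// ler_expR.
have lo : 1 - u ^+ 2 / N.+1%:R <= s ^+ (N - j) * expR u.
  apply: (@le_trans _ _ (s ^+ N.+1 * expR u)); last first.
    by rewrite ler_wpM2r ?expR_ge0// ler_wiXn2l// leqW// leq_subr.
  set v := u / N.+1%:R.
  have v0 : 0 <= v by rewrite divr_ge0.
  have v1 : v <= 1 by rewrite ler_pdivrMr// mul1r.
  apply: (@le_trans _ _ ((1 - v ^+ 2) ^+ N.+1)).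
    have : 1 - N.+1%:R * v ^+ 2 <= (1 - v ^+ 2) ^+ N.+1.
      have w0 : 0 <= v ^+ 2 <= 1 by rewrite exprn_ge0//= exprn_ile1.
      elim: (N.+1) => [|n IHn]; first by rewrite mul0r subr0 expr0.
      rewrite [_ ^+ n.+1]exprS -natr1; move: w0 IHn; have n0 : 0 <= n%:R :> R by [].
      by move: (v ^+ 2) ((1 - v ^+ 2) ^+ n) => w X w0 h; nra.
    apply: le_trans; rewrite /v; rewrite le_eqVlt; apply/orP; left; apply/eqP.
    congr (1 - _); move: (N.+1%:R : R) (gt_eqF m0) => M M0.
    by field; rewrite M0.
  have -> : expR u = expR v ^+ N.+1 by rewrite -expRM_natr /v divfK// gt_eqF.
  rewrite -exprMn; apply: lerXn2r; rewrite ?nnegrE.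
  - by rewrite subr_ge0 exprn_ile1.
  - by rewrite mulr_ge0 ?expR_ge0.
  - have := expR_ge1Dx v; rewrite /s -/v; nra.
have J1 : 1 <= 1 + j%:R :> R by rewrite lerDl.
have im : 0 < N.+1%:R^-1 :> R by rewrite invr_gt0.
split; first by rewrite !mulr_ge0 ?expR_ge0//= -mulrA -[leRHS]mul1r ler_pM ?mulr_ge0 ?expR_ge0// ler_piMl ?expR_ge0.
move: up lo t1; rewrite -[u * _ / _]mulrA -[t * _ * _]mulrA.
move: (s ^+ (N - j) * expR u) (mulr_ge0 sp0 (expR_ge0 u)) => S S0 up lo t1.
set E := leRHS.
have E1 : (1 + j%:R) ^+ 2 / N.+1%:R + u ^+ 2 / N.+1%:R <= E.
  rewrite /E -mulrDl ler_pM2r//.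
  apply: (@le_trans _ _ ((1 + u) ^+ 2 * 1 * (1 + j%:R) ^+ 2)).
    have := J1; move: (1 + j%:R : R) => J J1'.
    have J2 : 1 <= J ^+ 2 by rewrite exprn_ege1.
    have : 0 <= u ^+ 2 * (J ^+ 2 - 1) by rewrite mulr_ge0 ?exprn_ge0// subr_ge0.
    have : 0 <= u * J ^+ 2 by rewrite mulr_ge0 ?exprn_ge0// (le_trans ler01).
    lra.
  by rewrite ler_wpM2r ?exprn_ge0// ler_wpM2l ?exprn_ge0// addr_ge0.
have E2 : u * ((1 + j%:R) / N.+1%:R) * expR u <= E.
  rewrite /E mulrA -[u * _ / _ * _]mulrA [_^-1 * _]mulrC mulrA ler_pM2r//.
  rewrite mulrAC; have := e1; have := J1; move: (1 + j%:R : R) (expR u) => J e J1' e1'.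
  apply: (@le_trans _ _ ((1 + u) ^+ 2 * e * J)); last first.
    by rewrite ler_wpM2l ?mulr_ge0 ?exprn_ge0 ?addr_ge0//; nra.
  by rewrite ler_wpM2r ?ler_wpM2r//; nra.
have tS : t * S <= S by rewrite ler_piMl.
have up' : S <= 1 + E by apply: le_trans up _; rewrite lerD2l.
have a0 : 0 <= u ^+ 2 / N.+1%:R by rewrite divr_ge0 ?exprn_ge0.
have b0 : 0 <= (1 + j%:R) ^+ 2 / N.+1%:R :> R by rewrite divr_ge0 ?exprn_ge0.
move: E1 lo t1 a0 b0; move: (u ^+ 2 / _) ((1 + _) ^+ 2 / _) => a b E1 lo t1 a0 b0.
move: (E : R) E1 up' => F E1 up'.
rewrite ler_norml; apply/andP; split; last by lra.
have tS0 : 0 <= t * S by rewrite mulr_ge0.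
have [E3|E3] := lerP 1 F; first by lra.
have : t * (1 - a) <= t * S by rewrite ler_wpM2l.
have : t * a <= a by rewrite ler_piMl.
lra.
Qed.

Lemma coef_prod_series_ge0 (I : Type) (r : seq I) N (a : I -> nat -> R) j :
  (forall i k, 0 <= a i k) -> 0 <= (\prod_(i <- r) series_poly N (a i))`_j.
Proof.
move=> a0; elim: r j => [|i r IH] j; first by rewrite big_nil coef1 ler0n.
rewrite big_cons coefM; apply: sumr_ge0 => k _; rewrite mulr_ge0//.
by rewrite coef_poly; case: ifP.
Qed.

Lemma sum_coef_horner (p : {poly R}) (x : R) n : (forall j, 0 <= p`_j) -> 0 <= x ->
  \sum_(j < n) p`_j * x ^+ j <= p.[x].
Proof.
move=> p0 x0.
have E : forall k, (size p <= k)%N -> p.[x] = \sum_(j < k) p`_j * x ^+ j.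
  move=> k sk; rewrite horner_coef -!(big_mkord xpredT (fun j => p`_j * x ^+ j)).
  rewrite [RHS](big_cat_nat _ sk)//= [X in _ = _ + X]big_nat_cond [X in _ = _ + X]big1 ?addr0// => j.
  by rewrite andbT => /andP[sj _]; rewrite nth_default// mul0r.
rewrite (E (maxn n (size p))) ?leq_maxr//.
rewrite -!(big_mkord xpredT (fun j => p`_j * x ^+ j)).
rewrite [leRHS](big_cat_nat _ (leq_maxl n (size p)))//= lerDl.
by apply: sumr_ge0 => j _; rewrite mulr_ge0 ?exprn_ge0.
Qed.

(** Three errors of order [1/m]: the ratio of binomial to Poisson weights, the
    totals [j > N], and the truncation of each Bessel series. The last two are tails
    of series that converge after multiplication of their terms by [e^j]. *)
Lemma sum_poisson_weight ls : all (>= 0) ls -> exists2 C : R, 0 <= C &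
  forall N, \sum_(l <- ls) l <= N.+1%:R ->
  `|\sum_(j < N.+1) poisson_weight N.+1 N ls j -
    \prod_(l <- ls) (expR (- (2 * l)) * bessel_I0 (2 * l))| <= C / N.+1%:R.
Proof.
move=> ls0.
pose L := \sum_(l <- ls) l.
have L0 : 0 <= L by rewrite /L big_seq; apply: sumr_ge0 => l /(allP ls0).
pose K := \prod_(l <- ls) expR (l + expR 1 * l).
have K0 : 0 <= K by apply: prodr_ge0 => l _; exact: expR_ge0.
pose C1 := (1 + L) ^+ 2 * expR L * (expR L + 1).
have C10 : 0 <= C1 by rewrite !mulr_ge0 ?exprn_ge0 ?addr_ge0 ?expR_ge0.
pose C2 := \sum_(l <- ls) expR (l + expR 1 * l).
have C20 : 0 <= C2 by apply: sumr_ge0 => l _; exact: expR_ge0.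
exists (4 * C1 * K + K + C2) => [|N LN]; first exact: addr_ge0 (addr_ge0 (mulr_ge0 (mulr_ge0 _ C10) K0) K0) C20.
have m0 : 0 < N.+1%:R :> R by [].
pose p := \prod_(l <- ls) series_poly N (sqr_coeff l).
have p0 j : 0 <= p`_j by apply: coef_prod_series_ge0 => *; exact: sqr_coeff_ge0.
have pE x : p.[x] = \prod_(l <- ls) \sum_(k < N.+1) x ^+ k * sqr_coeff l k.
  rewrite /p horner_prod; apply: eq_bigr => l _.
  by rewrite horner_poly; apply: eq_bigr => k _; rewrite mulrC.
have pe : p.[expR 1] <= K.
  rewrite pE /K big_seq [leRHS]big_seq; apply: ler_prod => l /(allP ls0) l0.
  rewrite sum_sqr_coeff_exp_le// andbT; apply: sumr_ge0 => k _.
  by apply: mulr_ge0; rewrite ?sqr_coeff_ge0 ?exprn_ge0 ?expR_ge0.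
have e2 j : (1 + j%:R) ^+ 2 <= 4 * expR 1 ^+ j :> R.
  have -> : expR 1 ^+ j = expR (j%:R / 2) ^+ 2 :> R.
    by rewrite -!expRM_natr mul1r divfK.
  have := expR_ge1Dx (j%:R / 2 : R); have : 0 <= j%:R :> R by [].
  by move: (expR (j%:R / 2) : R) (j%:R : R) => e J h1 h2; nra.
have pj : \sum_(j < N.+1) (1 + j%:R) ^+ 2 * p`_j <= 4 * K.
  apply: (@le_trans _ _ (4 * \sum_(j < N.+1) p`_j * expR 1 ^+ j)).
    by rewrite mulr_sumr; apply: ler_sum => j _; rewrite [p`_j * _]mulrC mulrA ler_wpM2r.
  by rewrite ler_wpM2l//; apply: le_trans pe; apply: sum_coef_horner; rewrite ?expR_ge0.
have ptail : `|\sum_(j < N.+1) p`_j - p.[1]| <= K / N.+1%:R.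
  pose n := maxn N.+1 (size p).
  have -> : p.[1] = \sum_(0 <= j < n) p`_j.
    rewrite (@horner_coef_wide _ n) ?leq_maxr// big_mkord; apply: eq_bigr => j _.
    by rewrite expr1n mulr1.
  rewrite (big_cat_nat _ (leq_maxl N.+1 (size p)))//= big_mkord opprD addrA subrr sub0r normrN.
  rewrite ger0_norm; last by apply: sumr_ge0.
  rewrite ler_pdivlMr// mulrC mulr_sumr; apply: le_trans pe.
  apply: le_trans (sum_coef_horner n p0 (expR_ge0 1)).
  rewrite -(big_mkord xpredT (fun j => p`_j * expR 1 ^+ j)).
  rewrite [leRHS](big_cat_nat _ (leq_maxl N.+1 (size p)))//= ler_wpDl//.
    by apply: sumr_ge0 => k _; rewrite mulr_ge0// exprn_ge0 ?expR_ge0.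
  rewrite big_nat_cond [leRHS]big_nat_cond; apply: ler_sum => k /andP[/andP[Nk _] _].
  rewrite mulrC ler_wpM2l// -expRM_natr mul1r.
  apply: (@le_trans _ _ k%:R); first by rewrite ler_nat.
  by apply: le_trans (expR_ge1Dx _); rewrite lerDr.
pose r j := (N ^_ j)%:R / N.+1%:R ^+ j * (1 - L / N.+1%:R) ^+ (N - j) * expR L.
have WE (j : 'I_N.+1) : poisson_weight N.+1 N ls j = r j ^+ 2 * (expR (- (2 * L)) * p`_j).
  rewrite /poisson_weight coef_prod_sqr_scale -1?ltnS// -/p -/L.
  have -> : expR (- (2 * L)) = (expR L)^-1 ^+ 2.
    by rewrite -expRN -expRM_natr mulNr mulrC.
  rewrite /r !exprMn [(2 * j)%N]mulnC exprM !exprVn.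
  move: (expR L) (expR_gt0 L) (p`_j) => e e0 c.
  have : (N.+1%:R ^+ j : R) != 0 by rewrite expf_neq0.
  move: ((1 - L / _) ^+ _) ((N ^_ j)%:R : R) (N.+1%:R ^+ j : R) => s t q q0.
  by field; rewrite q0 gt_eqF.
have eL : 0 <= expR (- (2 * L)) <= 1.
  by rewrite expR_ge0 -[leRHS]expR0 ler_expR oppr_le0 mulr_ge0.
have [eL0 eL1] := andP eL.
have h1 : `|\sum_(j < N.+1) poisson_weight N.+1 N ls j - expR (- (2 * L)) * \sum_(j < N.+1) p`_j|
    <= 4 * C1 * K / N.+1%:R.
  rewrite mulr_sumr -sumrB; apply: le_trans (ler_norm_sum _ _ _) _.
  apply: (@le_trans _ _ (C1 / N.+1%:R * \sum_(j < N.+1) (1 + j%:R) ^+ 2 * p`_j)); last first.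
    apply: le_trans (ler_wpM2l _ pj) _; first by rewrite divr_ge0.
    by rewrite le_eqVlt; apply/orP; left; apply/eqP; ring.
  rewrite [leRHS]mulr_sumr; apply: ler_sum => j _; rewrite WE -[X in _ - X]mul1r -mulrBl normrM.
  rewrite [`|_ * p`_j|]ger0_norm ?mulr_ge0//.
  have jN : (j <= N)%N by rewrite -ltnS.
  have [/andP[r0 r1] r2] := poisson_ratio jN L0 LN; rewrite -/(r j) in r0 r1 r2.
  have -> : C1 / N.+1%:R * ((1 + j%:R) ^+ 2 * p`_j) =
     (C1 * (1 + j%:R) ^+ 2 / N.+1%:R) * p`_j by ring.
  rewrite ler_pM ?mulr_ge0//; last by rewrite ler_piMl.
  rewrite -[X in _ - X](expr1n _ 2) subr_sqr normrM.
  have -> : C1 * (1 + j%:R) ^+ 2 / N.+1%:R =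
    (1 + L) ^+ 2 * expR L * (1 + j%:R) ^+ 2 / N.+1%:R * (expR L + 1) by rewrite /C1; ring.
  by rewrite ler_pM// ger0_norm ?addr_ge0// lerD2r.
have h2 : `|expR (- (2 * L)) * \sum_(j < N.+1) p`_j - expR (- (2 * L)) * p.[1]| <= K / N.+1%:R.
  rewrite -mulrBr normrM (ger0_norm eL0); apply: le_trans ptail.
  by rewrite ler_piMl.
have h3 : `|expR (- (2 * L)) * p.[1] -
    \prod_(l <- ls) (expR (- (2 * l)) * bessel_I0 (2 * l))| <= C2 / N.+1%:R.
  have -> : expR (- (2 * L)) = \prod_(l <- ls) expR (- (2 * l)).
    by rewrite /L mulr_sumr -sumrN expR_sum.
  rewrite pE -big_split/=; apply: le_trans (prod_dist01 _ _) _.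
  - move=> l /(allP ls0) l0; rewrite mulr_ge0 ?expR_ge0//=; last first.
      by apply: sumr_ge0 => k _; rewrite expr1n mul1r sqr_coeff_ge0.
    rewrite expRN mulrC ler_pdivrMr ?expR_gt0// mul1r.
    apply: le_trans (sum_sqr_coeff_le N.+1 l0); apply: ler_sum => k _.
    by rewrite expr1n mul1r.
  - by move=> l /(allP ls0); exact: bessel_weight01.
  rewrite /C2 mulr_suml big_seq [leRHS]big_seq; apply: ler_sum => l /(allP ls0) l0.
  rewrite -mulrBr normrM ger0_norm ?expR_ge0// -[leRHS]mul1r ler_pM ?expR_ge0//.
    by rewrite -[leRHS]expR0 ler_expR oppr_le0 mulr_ge0.
  under eq_bigr do rewrite expr1n mul1r.
  have [b1 b2] := andP (bessel_I0_partial l0 (ltn0Sn N)).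
  by rewrite ler0_norm ?subr_le0// opprB lerBlDl.
apply: le_trans (ler_distD (expR (- (2 * L)) * \sum_(j < N.+1) p`_j) _ _) _.
apply: le_trans (lerD h1 (ler_distD (expR (- (2 * L)) * p.[1]) _ _)) _.
apply: le_trans (lerD (lexx _) (lerD h2 h3)) _.
by rewrite !mulrDl addrA.
Qed.

(** Only the values of total [j] close to its mean matter: [poisson_weight] is
    at most the probability that the counts with small means add up to [j]. *)
Lemma poisson_weight_le N ls j : all (>= 0) ls -> \sum_(l <- ls) l <= N.+1%:R ->
  (j <= N)%N ->
  0 <= poisson_weight N.+1 N ls j <=
    binomial_pmf N ((\sum_(l <- ls) l) / N.+1%:R) j.
Proof.
move=> ls0 LN jN; set L := \sum_(l <- ls) l.
have L0 : 0 <= L by rewrite /L big_seq; apply: sumr_ge0 => l /(allP ls0).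
have m0 : 0 < N.+1%:R :> R by [].
have u01 : 0 <= L / N.+1%:R <= 1 by rewrite divr_ge0//= ler_pdivrMr// mul1r.
have p0 : 0 <= (\prod_(l <- ls) series_poly N (sqr_coeff (l / N.+1%:R)))`_j.
  by apply: coef_prod_series_ge0 => *; exact: sqr_coeff_ge0.
rewrite /poisson_weight mulr_ge0 ?exprn_even_ge0//=.
have pe : (\prod_(l <- ls) series_poly N (sqr_coeff (l / N.+1%:R)))`_j <=
    exp_coeff (L / N.+1%:R) j ^+ 2.
  rewrite /L mulr_suml {p0 u01 L L0 LN}.
  elim: ls ls0 j jN => [_|l ls IH /= /andP[l0 ls0]] j jN.
    rewrite !big_nil coef1 exp_coeffX; case: j jN => [|j] _.
      by rewrite expr0 divr1 expr1n.
    by rewrite mulr0n exprn_even_ge0.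
  rewrite !big_cons coefM.
  have E : exp_coeff (l / N.+1%:R + \sum_(i <- ls) i / N.+1%:R) j =
     \sum_(i < j.+1) exp_coeff (l / N.+1%:R) i *
        exp_coeff (\sum_(i <- ls) i / N.+1%:R) (j - i)%N.
    have := @coef_mul_exp R N (series_poly N (exp_coeff (\sum_(i <- ls) i / N.+1%:R)))
      (l / N.+1%:R) (\sum_(i <- ls) i / N.+1%:R) _ j jN.
    rewrite exp_coeffX => <-; last by move=> i iN; rewrite coef_series_poly.
    rewrite coefM; apply: eq_bigr => i _; have ij : (i <= j)%N by rewrite -ltnS.
    by rewrite !coef_series_poly// ?(leq_trans ij)// (leq_trans (leq_subr _ _)).
  have s0 : 0 <= \sum_(i <- ls) i / N.+1%:R.
    by rewrite big_seq; apply: sumr_ge0 => i /(allP ls0) i0; rewrite divr_ge0.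
  have e0 x k : 0 <= x -> 0 <= exp_coeff x k :> R by exact: exp_coeff_ge0.
  have l'0 : 0 <= l / N.+1%:R by rewrite divr_ge0.
  rewrite E; apply: (@le_trans _ _ (\sum_(i < j.+1) (exp_coeff (l / N.+1%:R) i *
        exp_coeff (\sum_(i <- ls) i / N.+1%:R) (j - i)%N) ^+ 2)).
    apply: ler_sum => i _; have ij : (i <= j)%N by rewrite -ltnS.
    rewrite coef_series_poly ?(leq_trans ij)// exprMn ler_wpM2l ?exprn_even_ge0//.
    by apply: IH => //; rewrite (leq_trans (leq_subr _ _)).
  rewrite [leRHS]expr2 mulr_suml; apply: ler_sum => i _.
  rewrite [leLHS]expr2; apply: ler_wpM2l; first by apply: mulr_ge0; exact: e0.
  rewrite [leRHS](bigD1 i)//= lerDl.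
  by apply: sumr_ge0 => k _; apply: mulr_ge0; exact: e0.
have b01 : 0 <= binomial_pmf N (L / N.+1%:R) j <= 1.
  rewrite binomial_pmf_nneg//= -[leRHS](sum_binomial_pmf N (L / N.+1%:R)).
  rewrite (bigD1 (Ordinal (jN : (j < N.+1)%N)))//= lerDl.
  by apply: sumr_ge0 => k _; exact: binomial_pmf_nneg.
apply: le_trans (ler_wpM2l _ pe) _; first by rewrite exprn_even_ge0.
have -> : ((N ^_ j)%:R * (1 - L / N.+1%:R) ^+ (N - j)) ^+ 2 * exp_coeff (L / N.+1%:R) j ^+ 2
   = binomial_pmf N (L / N.+1%:R) j ^+ 2.
  rewrite -exprMn binomial_pmfE exp_coeffX -bin_ffact natrM -[_ *+ 'C(_, _)]mulr_natr.
  congr (_ ^+ 2); move: (j`!%:R : R) (@fact_neq0 R j) => f f0.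
  by field.
by case/andP: b01 => b0 b1; rewrite expr2 ler_piMr.
Qed.

End poisson.

(** * Twice differentiable functions on the simplex *)

Section simplex_calculus.
Context {R : realType} {d : nat}.
Implicit Types (x y z w v : 'rV[R]_d) (f g : 'rV[R]_d -> R) (A : {set 'I_d}).

Local Notation e_ i := (delta_mx 0 i : 'rV[R]_d).

Lemma derivable_line f x v (s : R) : derivable f (x + s *: v) v ->
  is_derive s (1 : R) (fun t : R => f (x + t *: v)) ('D_v f (x + s *: v)).
Proof.
have E : (fun h : R => h^-1 *: (((fun t : R => f (x + t *: v)) \o shift s) (h *: (1 : R)) -
      f (x + s *: v))) =
    (fun h : R => h^-1 *: ((f \o shift (x + s *: v)) (h *: v) - f (x + s *: v))).
  apply/funext => h /=; congr (_ *: (f _ - _)).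
  by rewrite [h *: (1 : R)]mulr1 scalerDl addrCA.
by move=> df; apply: DeriveDef; rewrite /derivable /derive/= E.
Qed.

Lemma axis_MVT f x (i : 'I_d) (t : R) : 0 <= t ->
  (forall s, 0 <= s <= t -> derivable f (x + s *: e_ i) (e_ i)) ->
  exists2 s, 0 <= s <= t & f (x + t *: e_ i) - f x = t * partial i f (x + s *: e_ i).
Proof.
move=> t0 df.
pose g (u : R) : R := f (x + u *: e_ i).
pose dg (u : R) : R := partial i f (x + u *: e_ i).
have gd s : s \in `[0, t] -> is_derive s (1 : R) g (dg s).
  by rewrite in_itv/= => st; apply: derivable_line; exact: df.
have gdoo s : s \in `]0, t[ -> is_derive s (1 : R) g (dg s).
  by move=> st; apply: gd; exact: subset_itv_oo_cc.
have gc : {within `[0, t], continuous g}.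
  by apply: derivable_within_continuous => s /gd ds; exact: ex_derive.
have [s st E] := MVT_segment t0 gdoo gc.
exists s; first by move: st; rewrite in_itv.
by move: E; rewrite /g /dg scale0r addr0 subr0 mulrC.
Qed.

Lemma zero_onE A x i : zero_on A x 0 i = if i \in A then 0 else x 0 i.
Proof. by rewrite mxE. Qed.

Lemma zero_onT x : zero_on [set: 'I_d]%SET x = 0.
Proof. by apply/rowP => i; rewrite zero_onE inE mxE. Qed.

Lemma simplexP x : simplex x <-> (forall i, 0 <= x 0 i) /\ \sum_i x 0 i <= 1.
Proof.
split=> [sx|[x0 x1]].
  by split; [move=> i; case/andP: (sx.1 i)|rewrite -simplex_norm//; exact: sx.2].
split; last by under eq_bigr do rewrite ger0_norm//.
move=> i; rewrite x0/=; apply: le_trans x1; rewrite (bigD1 i)//= lerDl.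
exact: sumr_ge0.
Qed.

Lemma simplex_below z w : simplex z -> (forall i, 0 <= w 0 i <= z 0 i) -> simplex w.
Proof.
move=> /simplexP[z0 z1] wz; apply/simplexP; split=> [i|]; first by case/andP: (wz i).
by apply: le_trans z1; apply: ler_sum => i _; case/andP: (wz i).
Qed.

Lemma simplex_zero_on A z : simplex z -> simplex (zero_on A z).
Proof.
move=> sz; apply: (simplex_below sz) => i; have /simplexP[z0 _] := sz.
by rewrite zero_onE; case: ifP; rewrite ?lexx ?z0.
Qed.

Lemma simplex0 : simplex (0 : 'rV[R]_d).
Proof.
by apply/simplexP; split=> [i|]; rewrite ?mxE// big1// => i _; rewrite mxE.
Qed.

(** Coordinates are moved to [0] one at a time: along such a path the simplex
    is not left, and only partial derivatives are needed. *)
Lemma simplex_path f A z (B : R) : simplex z ->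
  (forall w, simplex w -> forall i, derivable f w (e_ i)) ->
  (forall w i, i \in A -> (forall j, 0 <= w 0 j <= z 0 j) ->
    (forall j, j \notin A -> w 0 j = z 0 j) -> `|partial i f w| <= B) ->
  `|f z - f (zero_on A z)| <= B * \sum_(i in A) z 0 i.
Proof.
move=> sz df; have /simplexP[z0 _] := sz.
move: {2}#|A| (leqnn #|A|) => n; elim: n A => [|n IH] A.
  rewrite leqn0 cards_eq0 => /eqP -> _.
  have -> : zero_on finset.set0 z = z by apply/rowP => i; rewrite zero_onE inE.
  by rewrite subrr normr0 big_set0 mulr0.
have [->|[i iA]] := set_0Vmem A; first by move=> _; apply: IH; rewrite cards0.
move=> An pf.
have An' : (#|A :\ i| <= n)%N by move: An; rewrite (cardsD1 i) iA.
have {}IH : `|f z - f (zero_on (A :\ i) z)| <= B * \sum_(j in A :\ i) z 0 j.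
  apply: IH An' _ => w j; rewrite !inE => /andP[ji jA] wz wA; apply: pf => // k kA.
  by apply: wA; rewrite !inE negb_and kA orbT.
have E : zero_on (A :\ i) z = zero_on A z + z 0 i *: e_ i.
  apply/rowP => j; rewrite !mxE !inE eqxx/=; have [->|ji] := eqVneq j i.
    by rewrite iA mulr1 add0r.
  by rewrite mulr0 addr0.
have below s : 0 <= s <= z 0 i -> forall j, 0 <= (zero_on A z + s *: e_ i) 0 j <= z 0 j.
  move=> /andP[s0 s1] j; rewrite !mxE eqxx/=; have [->|ji] := eqVneq j i.
    by rewrite iA mulr1 add0r s0.
  by rewrite mulr0 addr0; case: ifP; rewrite ?lexx ?z0.
have [|s si D] := @axis_MVT f (zero_on A z) i (z 0 i) (z0 i).
  by move=> s si; apply: df; apply: simplex_below sz _; exact: below.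
rewrite (big_setD1 i iA)/= mulrDr [leRHS]addrC; apply: le_trans (ler_distD (f (zero_on (A :\ i) z)) _ _) _.
rewrite lerD// E D normrM (ger0_norm (z0 i)) mulrC ler_wpM2r//.
apply: pf => // [|j jA]; first exact: below.
rewrite !mxE eqxx/= (negPf jA); have [ji|ji] := eqVneq j i; first by rewrite ji iA in jA.
by rewrite mulr0 addr0.
Qed.

Lemma is_derive_coord (j : 'I_d) x v :
  is_derive x v (fun z : 'rV[R]_d => z 0 j) (v 0 j).
Proof.
have E : (fun h : R => h^-1 *: (((fun z : 'rV[R]_d => z 0 j) \o shift x) (h *: v) - x 0 j))
    @ 0^' --> v 0 j.
  apply: cvg_near_cst; near=> h => /=.
  have h0 : h != 0 by near: h; exact: nbhs_dnbhs_neq.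
  by rewrite !mxE addrK /GRing.scale/= mulrA mulVf// mul1r.
by apply: DeriveDef; [apply/cvg_ex; exists (v 0 j)|exact: cvg_lim E].
Unshelve. all: by end_near. Qed.

Section extension.
Variables (f : 'rV[R]_d -> R) (U : set 'rV[R]_d).
Hypotheses (U_simplex : simplex `<=` U) (f_C2 : C2_on U f).

Let f1 w i : simplex w -> derivable f w (e_ i).
Proof. by move=> /U_simplex/f_C2[_ /(_ i)[]]. Qed.

Let f2 w i j : simplex w -> derivable (partial i f) w (e_ j).
Proof. by move=> /U_simplex/f_C2[_ /(_ i)[_ _ /(_ j)[]]]. Qed.

Let f2_cts w i j : simplex w -> {for w, continuous (partial j (partial i f))}.
Proof. by move=> /U_simplex/f_C2[_ /(_ i)[_ _ /(_ j)[]]]. Qed.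

Lemma simplex_compact : compact (@simplex R d).
Proof.
apply: bounded_closed_compact.
  exists 1; split; first exact: num_real.
  move=> M M1 x sx; apply: le_trans (ltW M1).
  rewrite /Num.norm/= mx_normrE; apply/bigmax_leP; split=> // -[i j] _ /=.
  by rewrite ord1; have /andP[a b] := sx.1 j; rewrite ger0_norm.
have -> : simplex = [set x : 'rV[R]_d | \sum_i x 0 i <= 1] `&`
    \bigcap_(i in [set: 'I_d]) [set x : 'rV[R]_d | 0 <= x 0 i].
  apply/seteqP; split=> x; first by move=> /simplexP[x0 x1]; split=> // i _; exact: x0.
  by move=> [x1 x0]; apply/simplexP; split=> // i; exact: x0.
have coord (i : 'I_d) : continuous (fun x : 'rV[R]_d => x 0 i) by exact: coord_continuous.
apply: closedI.
  apply: (@preimage_closed _ _ (fun x : 'rV[R]_d => \sum_i x 0 i) [set y | y <= 1]).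
    move=> x _; elim: (index_enum _) => [|i r IH].
      have -> : (fun x : 'rV[R]_d => \sum_(i <- [::]) x 0 i) = cst 0.
        by apply/funext => y; rewrite big_nil.
      exact: cst_continuous.
    have -> : (fun x : 'rV[R]_d => \sum_(k <- i :: r) x 0 k) =
        (fun x : 'rV[R]_d => x 0 i) + (fun x : 'rV[R]_d => \sum_(k <- r) x 0 k).
      by apply/funext => y; rewrite big_cons.
    by apply: continuousD => //; exact: coord.
  exact: closed_le.
apply: closed_bigI => i _.
apply: (@preimage_closed _ _ (fun x : 'rV[R]_d => x 0 i) [set y | 0 <= y]); last exact: closed_ge.
by move=> x _; exact: coord.
Qed.

Lemma simplex_bounded g : (forall w, simplex w -> {for w, continuous g}) ->
  exists2 M : R, 0 <= M & forall w, simplex w -> `|g w| <= M.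
Proof.
move=> gc.
have : compact (g @` simplex).
  apply: continuous_compact; last exact: simplex_compact.
  by apply: continuous_in_subspaceT => w; rewrite inE; exact: gc.
move=> /compact_bounded[M [_ hM]]; exists (`|M| + 1); first by rewrite addr_ge0.
move=> w sw; apply: hM; last by exists w.
by rewrite (le_lt_trans (ler_norm _))// ltrDl.
Qed.

Lemma second_partials_bounded : exists2 M : R, 0 <= M &
  forall w, simplex w -> forall i j, `|partial j (partial i f) w| <= M.
Proof.
have /choice[M hM] (p : 'I_d * 'I_d) : exists M : R, 0 <= M /\
    forall w, simplex w -> `|partial p.2 (partial p.1 f) w| <= M.
  have [M M0 hM] := @simplex_bounded (partial p.2 (partial p.1 f)) (fun w => @f2_cts w p.1 p.2).
  by exists M.
exists (\sum_p M p) => [|w sw i j]; first by apply: sumr_ge0 => p _; case: (hM p).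
apply: le_trans ((hM (i, j)).2 w sw) _; rewrite (bigD1 (i, j))//= lerDl.
by apply: sumr_ge0 => p _; case: (hM p).
Qed.

Lemma partial_shift i g v w : partial i (fun u => g (u + v)) w = partial i g (w + v).
Proof.
rewrite /partial /derive; set a := (X in lim (X @ _) = _); set b := (X in _ = lim (X @ _)).
by have -> : a = b by apply/funext => h; rewrite /a /b /= addrA.
Qed.

Lemma derivable_shift i g v w : derivable g (w + v) (e_ i) ->
  derivable (fun u => g (u + v)) w (e_ i).
Proof.
rewrite /derivable; set a := (X in cvg (X @ _) -> _); set b := (X in _ -> cvg (X @ _)).
by have -> : a = b by apply/funext => h; rewrite /a /b /= addrA.
Qed.

Definition corner i j (s t : R) : 'rV[R]_d := s *: e_ i + t *: e_ j.

Lemma cornerE i j s t k : corner i j s t 0 k = s * (k == i)%:R + t * (k == j)%:R.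
Proof. by rewrite !mxE eqxx. Qed.

Lemma simplex_corner i j (s t : R) : 0 <= s -> 0 <= t -> s + t <= 1 ->
  simplex (corner i j s t).
Proof.
move=> s0 t0 st; apply/simplexP; split=> [k|].
  by rewrite cornerE addr_ge0 ?mulr_ge0.
apply: le_trans st; under eq_bigr do rewrite cornerE.
rewrite big_split/= (bigD1 i)//= [X in _ + X <= _](bigD1 j)//= !eqxx !mulr1.
rewrite !big1 ?addr0// => k /negPf ->; by rewrite mulr0.
Qed.

(** Two mean value theorems, along the axis [i] and then along the axis [j]; the
    second difference itself is symmetric in the two axes. *)
Lemma second_difference i j (t : R) : 0 <= t <= 2^-1 -> exists s u : R,
  [/\ 0 <= s <= t, 0 <= u <= t &
   f (corner i j t t) - f (corner i j t 0) - f (corner i j 0 t) + f 0 =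
   t ^+ 2 * partial j (partial i f) (corner i j s u)].
Proof.
move=> /andP[t0 t2].
have cornerD (s s' u u' : R) : corner i j s u + corner i j s' u' = corner i j (s + s') (u + u').
  by rewrite /corner !scalerDl addrACA.
have ci (s u h : R) : corner i j s u + h *: e_ i = corner i j (s + h) u.
  by rewrite /corner scalerDl addrAC.
have cj (s u h : R) : corner i j s u + h *: e_ j = corner i j s (u + h).
  by rewrite /corner scalerDl addrA.
pose g w := f (w + t *: e_ j) - f w.
have sc s u : 0 <= s <= t -> 0 <= u <= t -> simplex (corner i j s u).
  by move=> /andP[? ?] /andP[? ?]; apply: simplex_corner => //; lra.
have dg s : 0 <= s <= t -> derivable (fun u => f (u + t *: e_ j)) (corner i j s 0) (e_ i) /\
    derivable f (corner i j s 0) (e_ i).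
  move=> st; split; last by apply: f1; apply: sc => //; rewrite lexx t0.
  by apply: derivable_shift; rewrite cj add0r; apply: f1; apply: sc => //; rewrite t0 lexx.
have [|s st D] := @axis_MVT g (corner i j 0 0) i t t0.
  by move=> s st; rewrite ci add0r; exact: derivableB (dg s st).1 (dg s st).2.
have [|u ut D2] := @axis_MVT (partial i f) (corner i j s 0) j t t0.
  by move=> u ut; rewrite cj add0r; apply: f2; exact: sc.
exists s, u; split; [exact: st|exact: ut|].
move: D; rewrite ci add0r /g !cj ci !add0r.
have -> : partial i (fun w => f (w + t *: e_ j) - f w) (corner i j s 0) =
    partial i f (corner i j s t) - partial i f (corner i j s 0).
  have [d1 d2] := dg s st.
  rewrite {1}/partial (deriveB d1 d2) -/(partial i _ _) -/(partial i f _) partial_shift.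
  by rewrite cj add0r.
rewrite cj add0r in D2; rewrite D2 cj add0r.
have -> : corner i j 0 0 = 0 by rewrite /corner !scale0r addr0.
by rewrite mulrA -expr2 => <-; ring.
Qed.

Lemma corner_near i j (P : set 'rV[R]_d) : nbhs (0 : 'rV[R]_d) P ->
  exists2 e : R, 0 < e & forall s u, 0 <= s < e -> 0 <= u < e -> P (corner i j s u).
Proof.
move=> /nbhs_ballP[e /= e0 he]; exists (e / 2); first by rewrite divr_gt0.
move=> s u /andP[s0 s1] /andP[u0 u1]; apply: he; split=> // k l.
rewrite ord1 cornerE mxE /ball/= sub0r normrN.
rewrite ger0_norm ?addr_ge0 ?mulr_ge0//.
have : s * (l == i)%:R <= s by rewrite ler_piMr// lern1; case: (_ == _).
have : u * (l == j)%:R <= u by rewrite ler_piMr// lern1; case: (_ == _).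
lra.
Qed.

(** Both mixed partial derivatives equal the same second difference quotient at
    points close to [0], so by continuity they agree at [0]. *)
Lemma second_partials_sym i j :
  partial i (partial j f) 0 = partial j (partial i f) 0.
Proof.
apply/eqP; rewrite -subr_eq0 -normr_le0; apply/ler_addgt0Pr => e e0; rewrite add0r.
have e2 : 0 < e / 2 by rewrite divr_gt0.
have /cvgrPdist_le/(_ _ e2)/(corner_near i j) := @f2_cts 0 i j simplex0.
have /cvgrPdist_le/(_ _ e2)/(corner_near j i) := @f2_cts 0 j i simplex0.
move=> [a a0 ha] [b b0 hb].
pose t := Num.min (2^-1) (Num.min (a / 2) (b / 2)).
have t0 : 0 < t by rewrite !lt_min invr_gt0 ltr0n !divr_gt0.
have t2 : 0 <= t <= 2^-1 by rewrite (ltW t0) ge_min lexx.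
have ta : t < a by apply: (@le_lt_trans _ _ (a / 2)); [rewrite !ge_min lexx ?orbT|lra].
have tb : t < b by apply: (@le_lt_trans _ _ (b / 2)); [rewrite !ge_min lexx ?orbT|lra].
have [s [u [/andP[s0 s1] /andP[u0 u1] D]]] := second_difference i j t2.
have [s' [u' [/andP[s'0 s'1] /andP[u'0 u'1] D']]] := second_difference j i t2.
have cC (x y : R) : corner j i x y = corner i j y x by rewrite /corner addrC.
have h1 := hb s u; have h2 := ha s' u'.
rewrite s0 u0 (le_lt_trans s1 tb) (le_lt_trans u1 tb) in h1.
rewrite s'0 u'0 (le_lt_trans s'1 ta) (le_lt_trans u'1 ta) in h2.
move: (h1 isT isT) (h2 isT isT) => {}h1 {}h2.
have E : partial i (partial j f) (corner j i s' u') = partial j (partial i f) (corner i j s u).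
  have tt : t ^+ 2 != 0 by rewrite expf_neq0// gt_eqF.
  apply: (mulfI tt); rewrite -[LHS]D' -[RHS]D !cC; ring.
rewrite E in h2.
apply: le_trans (ler_distD (partial j (partial i f) (corner i j s u)) _ _) _.
rewrite [leRHS]splitr; apply: lerD; first exact: h2.
by rewrite distrC; exact: h1.
Qed.

Section flat_face.
Variable J : {set 'I_d}.
Hypothesis grad0 : forall x, simplex x -> forall i, partial i f (zero_on J x) = 0.

(** A path of points of the face leads to [0], and the gradient vanishes along it. *)
Lemma constant_on_face z : simplex z -> f (zero_on J z) = f 0.
Proof.
move=> sz; apply/eqP; rewrite -subr_eq0 -normr_le0.
have := @simplex_path f [set: 'I_d]%SET (zero_on J z) 0 (simplex_zero_on J sz) (fun w sw i => @f1 w i sw).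
rewrite zero_onT mul0r; apply=> w i _ wz _.
have sw : simplex w by apply: simplex_below (simplex_zero_on J sz) wz.
suff -> : w = zero_on J w by rewrite grad0// normr0.
apply/rowP => j; rewrite zero_onE; case: ifP => // jJ.
by have := wz j; rewrite zero_onE jJ -eq_le => /eqP.
Qed.

(** The gradient vanishes on the face and is Lipschitz, so it is [O(\sum_(i in J) z i)]
    along the path to the face. *)
Lemma quadratic_near_face : exists2 M : R, 0 <= M & forall z, simplex z ->
  `|f z - f 0| <= M * (\sum_(i in J) z 0 i) ^+ 2.
Proof.
have [M M0 hM] := second_partials_bounded; exists M => // z sz.
have /simplexP[z0 _] := sz.
rewrite -(constant_on_face sz) expr2 mulrA.
apply: simplex_path => // [w sw i|w i iJ wz wJ]; first exact: f1.
have sw : simplex w by apply: simplex_below sz wz.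
rewrite -[partial i f w]subr0 -[X in _ - X](grad0 sw i).
apply: (@le_trans _ _ (M * \sum_(j in J) w 0 j)).
  apply: simplex_path => // [u su j|u j jJ uw uJ]; first exact: f2.
  by apply: hM; apply: simplex_below sw uw.
by rewrite ler_wpM2l//; apply: ler_sum => j _; case/andP: (wz j).
Qed.

End flat_face.

Lemma simplex_sum_ge x i : simplex x -> x 0 i <= \sum_j x 0 j.
Proof. by move=> /simplexP[x0 _]; rewrite (bigD1 i)//= lerDl sumr_ge0. Qed.

Lemma small_sum_near (P : set 'rV[R]_d) : nbhs (0 : 'rV[R]_d) P ->
  exists2 e : R, 0 < e & forall w, simplex w -> \sum_i w 0 i < e -> P w.
Proof.
move=> /nbhs_ballP[e /= e0 he]; exists e => // w sw we; apply: he; split=> // k l.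
rewrite ord1 mxE /ball/= sub0r normrN ger0_norm; last by have /simplexP[w0 _] := sw.
exact: le_lt_trans (simplex_sum_ge l sw) we.
Qed.

Definition hessian i j : R := partial i (partial j f) 0.

Definition hessian_form z : R := 2^-1 * \sum_i \sum_j hessian i j * (z 0 i * z 0 j).

(** Taylor's formula at the vertex [0]: the remainder, its gradient and its
    Hessian vanish at [0], so two applications of [simplex_path] bound it. *)
Lemma taylor_vertex : (forall i, partial i f 0 = 0) ->
  forall e : R, 0 < e -> exists2 D : R, 0 < D & forall z, simplex z ->
    \sum_i z 0 i < D -> `|f z - f 0 - hessian_form z| <= e * (\sum_i z 0 i) ^+ 2.
Proof.
move=> grad0 e e0.
have hsym i j : hessian i j = hessian j i by exact: second_partials_sym.
(* The second derivatives vary by less than [e] near the vertex, uniformly in the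
   indices. *)
have [D D0 hD] : exists2 D : R, 0 < D & forall w, simplex w -> \sum_i w 0 i < D ->
    forall i j, `|hessian j i - partial j (partial i f) w| <= e.
  have /choice[r hr] (p : 'I_d * 'I_d) : exists r : R, 0 < r /\
      forall w, simplex w -> \sum_i w 0 i < r ->
        `|hessian p.2 p.1 - partial p.2 (partial p.1 f) w| <= e.
    have /cvgrPdist_le/(_ _ e0)/small_sum_near[r r0 hr] := @f2_cts 0 p.1 p.2 simplex0.
    by exists r.
  have s0 : 0 <= \sum_p (r p)^-1 by apply: sumr_ge0 => p _; rewrite invr_ge0 ltW// (hr p).1.
  exists (1 + \sum_p (r p)^-1)^-1; first by rewrite invr_gt0 ltr_pwDl.
  move=> w sw ws i j; apply: ((hr (i, j)).2) => //; apply: lt_le_trans ws _.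
  rewrite -[leRHS]invrK lef_pV2 ?posrE ?invr_gt0 ?(hr (i, j)).1 ?ltr_pwDl//.
  rewrite (bigD1 (i, j))//= addrCA lerDl addr_ge0// sumr_ge0// => p _.
  by rewrite invr_ge0 ltW// (hr p).1.
exists D => // z sz zD; have /simplexP[z0 _] := sz.
pose lin i w : R := \sum_j hessian i j * w 0 j.
have dlin i j w : is_derive w (e_ j) (lin i) (hessian i j).
  have -> : lin i = \sum_(k < d) (hessian i k \*: (fun w : 'rV[R]_d => w 0 k)).
    by apply/funext => v; rewrite fct_sumE.
  have -> : hessian i j = \sum_(k < d) hessian i k *: (e_ j 0 k).
    rewrite (bigD1 j)//= big1 ?addr0 => [|k kj]; rewrite mxE eqxx/=.
      by rewrite eqxx /GRing.scale/= mulr1.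
    by rewrite (negPf kj) scaler0.
  by apply: is_derive_sum => k; apply: is_deriveZ; exact: is_derive_coord.
have dquad k w : is_derive w (e_ k) hessian_form (lin k w).
  have -> : hessian_form = 2^-1 \*: (\sum_(i < d) \sum_(j < d)
      (hessian i j \*: ((fun w : 'rV[R]_d => w 0 i) * (fun w : 'rV[R]_d => w 0 j)))).
    apply/funext => v; rewrite /hessian_form /= fct_sumE; congr (_ * _).
    by apply: eq_bigr => i _; rewrite fct_sumE.
  have -> : lin k w = 2^-1 *: (\sum_(i < d) \sum_(j < d)
      hessian i j *: (w 0 i *: (e_ k 0 j) + w 0 j *: (e_ k 0 i))).
    under eq_bigr do under eq_bigr do rewrite scalerDr.
    under eq_bigr do rewrite big_split/=.
    rewrite big_split/= [X in _ = _ *: (X + _)](_ : _ = lin k w); last first.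
      apply: eq_bigr => i _; rewrite (bigD1 k)//= big1 ?addr0 => [|j jk].
        by rewrite mxE !eqxx /GRing.scale/= mulr1 hsym.
      by rewrite mxE eqxx (negPf jk) !scaler0.
    rewrite [X in _ = _ *: (_ + X)](_ : _ = lin k w); last first.
      rewrite (bigD1 k)//= [X in _ + X]big1 ?addr0 => [|i ik].
        by apply: eq_bigr => j _; rewrite mxE !eqxx /GRing.scale/= mulr1.
      by rewrite big1// => j _; rewrite mxE eqxx (negPf ik) !scaler0.
    by rewrite /GRing.scale/=; field.
  apply: is_deriveZ; apply: is_derive_sum => i; apply: is_derive_sum => j.
  apply: is_deriveZ; apply: is_deriveM; exact: is_derive_coord.
have zform0 : hessian_form 0 = 0.
  by rewrite /hessian_form big1 ?mulr0// => i _; rewrite big1// => j _; rewrite !mxE !mulr0.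
have below_sum w : (forall j, 0 <= w 0 j <= z 0 j) -> \sum_j w 0 j <= \sum_j z 0 j.
  by move=> wz; apply: ler_sum => j _; case/andP: (wz j).
have -> : f z - f 0 - hessian_form z = (f z - hessian_form z) - (f 0 - hessian_form 0).
  by rewrite zform0; ring.
have sumT (w : 'rV[R]_d) : \sum_(i in [set: 'I_d]%SET) w 0 i = \sum_i w 0 i.
  by apply: eq_bigl => i; rewrite inE.
rewrite -(zero_onT z) expr2 mulrA -{2}(sumT z).
apply: (@simplex_path (fun w => f w - hessian_form w)) => //.
  by move=> w sw i; apply: derivableB; [exact: f1|exact: ex_derive].
move=> w i _ wz _; have sw : simplex w by apply: simplex_below sz wz.
have -> : partial i (fun w => f w - hessian_form w) w = partial i f w - lin i w.
  have d1 := @f1 w i sw; have d2 : derivable hessian_form w (e_ i) by exact: ex_derive.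
  by rewrite {1}/partial (deriveB d1 d2) [X in _ - X]derive_val.
have lin0 : partial i f 0 - lin i 0 = 0.
  by rewrite grad0 /lin big1 ?subrr// => j _; rewrite mxE mulr0.
apply: (@le_trans _ _ (e * \sum_j w 0 j)); last by rewrite ler_wpM2l ?(ltW e0)// below_sum.
have := @simplex_path (fun w => partial i f w - lin i w) [set: 'I_d]%SET w e sw.
rewrite zero_onT lin0 subr0 sumT; apply.
  by move=> u su j; apply: derivableB; [exact: f2|exact: ex_derive].
move=> u j _ uw _; have su : simplex u by apply: simplex_below sw uw.
have -> : partial j (fun w => partial i f w - lin i w) u = partial j (partial i f) u - hessian i j.
  have d1 := @f2 u i j su; have d2 : derivable (lin i) u (e_ j) by exact: ex_derive.
  by rewrite {1}/partial (deriveB d1 d2) [X in _ - X]derive_val.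
rewrite distrC hsym; apply: hD => //; apply: le_lt_trans zD; apply: le_trans (below_sum _ wz).
by apply: ler_sum => k _; case/andP: (uw k).
Qed.

End extension.

End simplex_calculus.

(** * Cells and the mean square error *)

Section cells.
Context {R : realType} {d : nat}.
Local Notation Rm := (measurableTypeR R).

Lemma cell_box m (k : 'I_d -> nat) : @cell R d m k =
  [set t : d.-tuple Rm | forall i,
    (`](k i)%:R / m%:R, (k i).+1%:R / m%:R]%classic : set Rm) (tnth t i)].
Proof. by apply/seteqP; split=> t /= tk i; have := tk i; rewrite in_itv. Qed.

Lemma measurable_cell m (k : 'I_d -> nat) : measurable (@cell R d m k).
Proof.
rewrite cell_box.
exact: (measurable_box (fun i => measurable_itv _)).
Qed.

Lemma lebesgue_cell m (k : 'I_d -> nat) : (0 < m)%N ->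
  lebesgue_tuple d (@cell R d m k) = (m%:R ^- d)%:E.
Proof.
move=> m0; rewrite cell_box.
rewrite (lebesgue_tuple_box (fun i => measurable_itv _)).
have side i : @lebesgue_measure R `](k i)%:R / m%:R, (k i).+1%:R / m%:R]%classic =
    (m%:R^-1)%:E.
  rewrite lebesgue_measure_itv /= lte_fin ltr_pM2r ?invr_gt0 ?ltr0n // ltr_nat.
  by rewrite ltnSn -EFinB -mulrBl -natrB // subSnn mul1r.
rewrite (eq_bigr (fun=> (m%:R^-1)%:E)); last by move=> i _; exact: side.
by rewrite prodEFin prodr_const card_ord exprVn.
Qed.

Lemma cell_disjoint m (k k' : 'I_d -> nat) : (0 < m)%N ->
  (exists i, k i != k' i) -> @cell R d m k `&` cell m k' = set0.
Proof.
move=> m0 [i ki]; apply/seteqP; split=> // t /= [/(_ i)/andP[lt1 le1] /(_ i)/andP[lt2 le2]].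
have m'0 : (0 : R) < m%:R^-1 by rewrite invr_gt0 ltr0n.
have := lt_le_trans lt1 le2; have := lt_le_trans lt2 le1.
rewrite !ltr_pM2r // !ltr_nat !ltnS => k1 k2.
by move: ki; rewrite eqn_leq k1 k2.
Qed.

End cells.

Section mean_square.
Context {R : realType} {disp : measure_display} {T : measurableType disp}.
Variable P : probability T R.

Lemma integral_indic_sum (I : finType) (c : I -> R) (D : I -> set T) :
  (forall i, measurable (D i)) ->
  (\int[P]_w (\sum_i c i * \1_(D i) w)%:E = (\sum_i c i * fine (P (D i)))%:E)%E.
Proof.
move=> mD.
under eq_integral do rewrite -sumEFin.
have int1 i : P.-integrable setT (fun w => (\1_(D i) w)%:E : \bar R).
  exact: integrable_indic.
rewrite integral_sum //; last first.
  by move=> i; under [X in _.-integrable _ X]eq_fun do rewrite EFinM; exact: integrableZl.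
rewrite -sumEFin; apply: eq_bigr => i _.
under eq_integral do rewrite EFinM.
rewrite integralZl // integral_indic // setIT EFinM fineK //.
by rewrite fin_num_measure.
Qed.

(** Expanding the square leaves only probabilities of pairwise intersections;
    the constant [c] enters as a multiple of the indicator of the whole space. *)
Lemma mean_square_indic (I : finType) (b : I -> R) (D : I -> set T) (c : R) :
  (forall i, measurable (D i)) ->
  ('E_P[fun w => ((\sum_i b i * \1_(D i) w - c) ^+ 2)%R])%E =
   (\sum_i \sum_j b i * b j * fine (P (D i `&` D j))
    - 2 * c * (\sum_i b i * fine (P (D i))) + c ^+ 2)%:E.
Proof.
move=> mD.
pose D' (u : unit + I) := if u is inr i then D i else setT.
pose b' (u : unit + I) := if u is inr i then b i else - c.
have mD' u : measurable (D' u) by case: u => [?|i] /=.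
have unit1 (F : unit -> R) : \sum_i F i = F tt by rewrite (big_pred1 tt) // => -[].
have step (w : T) : (\sum_i b i * \1_(D i) w - c) ^+ 2 =
    \sum_(p : (unit + I) * (unit + I))
      b' p.1 * b' p.2 * \1_(D' p.1 `&` D' p.2) w.
  have -> : \sum_i b i * \1_(D i) w - c = \sum_u b' u * \1_(D' u) w.
    by rewrite big_sumType /= unit1 indicT mulr1 addrC.
  rewrite expr2 big_distrlr /= pair_bigA /=; apply: eq_bigr => -[u v] _ /=.
  by rewrite indicI /= mulrACA.
rewrite unlock; under eq_integral do rewrite step.
rewrite (@integral_indic_sum ((unit + I) * (unit + I))%type
  (fun p => b' p.1 * b' p.2) (fun p => D' p.1 `&` D' p.2)); last first.
  by move=> p; exact: measurableI.
congr EFin; rewrite -(pair_bigA _ (fun u v => b' u * b' v * fine (P (D' u `&` D' v)))) /=.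
rewrite big_sumType /= unit1 big_sumType /= unit1 setIT probability_setT /=.
under [X in _ + X]eq_bigr do rewrite big_sumType /= unit1 setIT.
rewrite big_split /= mulr1.
have -> : \sum_i (- c * b i * fine (P (setT `&` D i))) = - c * \sum_i b i * fine (P (D i)).
  by rewrite mulr_sumr; apply: eq_bigr => i _; rewrite setTI mulrA.
have -> : \sum_i (b i * - c * fine (P (D i))) = - c * \sum_i b i * fine (P (D i)).
  by rewrite mulr_sumr; apply: eq_bigr => i _; rewrite (mulrC (b i)) mulrA.
ring.
Qed.

End mean_square.

Section sampling.
Context {R : realType} {d : nat}.
Local Notation Rm := (measurableTypeR R).
Variable f : 'rV[R]_d -> R.

Definition cell_mass m (k : 'I_d -> nat) : R :=
  fine (\int[lebesgue_tuple d]_(t in cell m k) (f (row_of_tuple t))%:E).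

Context {disp : measure_display} {T : measurableType disp}.
Variable P : probability T R.
Variable X : nat -> {RV P >-> d.-tuple Rm}.
Hypothesis X_iid : iid_sample X f.

Lemma measurable_preimage l (A : set (d.-tuple Rm)) :
  measurable A -> measurable (X l @^-1` A).
Proof. by move=> mA; rewrite -[X in measurable X]setTI; exact: (measurable_funP (X l)). Qed.

Lemma cell_prob l m k : fine (P (X l @^-1` cell m k)) = cell_mass m k.
Proof. by have [_ /(_ l)/(_ _ (measurable_cell m k))] := X_iid; rewrite /cell_mass => <-. Qed.

Lemma indep_pair l l' (A A' : set (d.-tuple Rm)) : l != l' ->
  measurable A -> measurable A' ->
  (P (X l @^-1` A `&` X l' @^-1` A') = P (X l @^-1` A) * P (X l' @^-1` A'))%E.
Proof.
move=> ll' mA mA'.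
have [+ _] := X_iid.
pose B k := if k == l then A else if k == l' then A' else setT.
move=> /(_ (maxn l l').+1 B) indep.
have ln : (l < (maxn l l').+1)%N by rewrite ltnS leq_maxl.
have ln' : (l' < (maxn l l').+1)%N by rewrite ltnS leq_maxr.
rewrite -(_ : \bigcap_(k in `I_(maxn l l').+1) (X k @^-1` B k) =
    X l @^-1` A `&` X l' @^-1` A'); last first.
  apply/seteqP; split=> w /= wB.
    split; first by have := wB l ln; rewrite /B eqxx.
    by have := wB l' ln'; rewrite /B eqxx eq_sym (negbTE ll').
  move=> k _; rewrite /B; have [->|_] := eqVneq k l; first by case: wB.
  by have [->|_] := eqVneq k l'; [case: wB|].
rewrite indep; last by move=> k; rewrite /B; do 2 case: ifP => //.
rewrite (bigD1 (Ordinal ln)) //= (bigD1 (Ordinal ln')) /=; last first.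
  by rewrite -val_eqE /= eq_sym.
rewrite big1 ?mule1 ?/B ?eqxx.
  by rewrite eq_sym (negbTE ll').
move=> k /andP[kl kl']; rewrite -val_eqE /= in kl.
by rewrite -val_eqE /= in kl'; rewrite /B (negbTE kl) (negbTE kl') preimage_setT probability_setT.
Qed.

(** Expanding the square gives pairs of sample points: the [n] diagonal ones see a
    single cell since cells are disjoint, the [n (n - 1)] others are independent. *)
Lemma MSE_decomposition n m (x : 'rV[R]_d) : (0 < n)%N -> (0 < m)%N ->
  let a k := m%:R ^+ d * multinomial_prob m.-1 k x in
  let S := \sum_(k : {ffun 'I_d -> 'I_m} | (\sum_i k i <= m.-1)%N)
     a (fun i => k i) * cell_mass m (fun i => k i) in
  let Q := \sum_(k : {ffun 'I_d -> 'I_m} | (\sum_i k i <= m.-1)%N)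
     a (fun i => k i) ^+ 2 * cell_mass m (fun i => k i) in
  MSE X f n m x = (n%:R^-1 * (Q - S ^+ 2) + (S - f x) ^+ 2)%:E.
Proof.
move=> n0 m0 a S Q.
pose K := {ffun 'I_d -> 'I_m}.
pose ok (k : K) := (\sum_i k i <= m.-1)%N.
pose b (p : 'I_n * K) := n%:R^-1 * (if ok p.2 then a (fun i => p.2 i) else 0).
pose D (p : 'I_n * K) := X p.1 @^-1` cell m (fun i => p.2 i).
have mD p : measurable (D p) by exact: (measurable_preimage _ (@measurable_cell R d m _)).
have n_neq0 : (n%:R : R) != 0 by rewrite pnatr_eq0 -lt0n.
have bernE w : bernstein X n m x w = \sum_p b p * \1_(D p) w.
  rewrite /bernstein -(pair_bigA _ (fun l k => b (l, k) * \1_(D (l, k)) w)) /=.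
  rewrite exchange_big /= [LHS]big_mkcond /=; apply: eq_bigr => k _.
  rewrite /b /= /ok; case: ifP => _; last by rewrite big1 // => i _; rewrite mulr0 mul0r.
  rewrite !mulr_sumr mulr_suml; apply: eq_bigr => l _.
  rewrite /a /D /= !indicE /=; set u := (_ \in _); set v := (_ \in _).
  have -> : u = v by rewrite /u /v; apply/idP/idP; rewrite !inE.
  ring.
rewrite /MSE; under eq_fun do rewrite bernE.
rewrite (mean_square_indic P b (f x) mD).
congr EFin.
have one (j : 'I_n) : \sum_(k : K) b (j, k) * fine (P (D (j, k))) = n%:R^-1 * S.
  rewrite /S mulr_sumr [RHS]big_mkcond /=; apply: eq_bigr => k _.
  rewrite /b /D /= cell_prob /ok; case: ifP => _; first exact: esym (mulrA _ _ _).
  by rewrite mulr0 mul0r.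
have E1 : \sum_p b p * fine (P (D p)) = S.
  rewrite -(pair_bigA _ (fun l k => b (l, k) * fine (P (D (l, k))))) /=.
  rewrite (eq_bigr (fun=> n%:R^-1 * S)); last by move=> l _; exact: one.
  by rewrite sumr_const card_ord -[LHS]mulr_natl mulrA divff ?mul1r.
have E2 : \sum_p \sum_q b p * b q * fine (P (D p `&` D q)) = n%:R^-1 * (Q - S ^+ 2) + S ^+ 2.
  have inner (l l' : 'I_n) : \sum_(k : K) \sum_(k' : K)
      b (l, k) * b (l', k') * fine (P (D (l, k) `&` D (l', k'))) =
      n%:R^-1 ^+ 2 * (S ^+ 2 + (l == l')%:R * (Q - S ^+ 2)).
    have [->|ll'] := eqVneq l l'.
      rewrite mul1r addrC subrK /Q mulr_sumr [RHS]big_mkcond /=; apply: eq_bigr => k _.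
      rewrite (bigD1 k) //= big1 ?addr0; last first.
        move=> k' kk'.
        have kneq : exists i, (k i : nat) != k' i.
          apply/existsP; apply: contraNT kk' => /existsPn kk'; apply/eqP/ffunP => i.
          by apply/val_inj/eqP; have := kk' i; rewrite negbK eq_sym.
        by rewrite /D /= -preimage_setI (cell_disjoint m0 kneq) preimage_set0 measure0 mulr0.
      rewrite setIid /D /= cell_prob /b /= /ok.
      by case: ifP => _; [ring|rewrite !mulr0 mul0r].
    rewrite mul0r addr0 -E1.
    transitivity ((\sum_(k : K) b (l, k) * fine (P (D (l, k)))) *
                  (\sum_(k : K) b (l', k) * fine (P (D (l', k))))).
      rewrite big_distrlr /=; apply: eq_bigr => k _; apply: eq_bigr => k' _.
      rewrite /D /= indep_pair //; last 2 first.
        exact: (@measurable_cell R d m).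
        exact: (@measurable_cell R d m).
      by rewrite fineM ?fin_num_measure //; [ring|exact: (measurable_preimage _ (@measurable_cell R d m _))|exact: (measurable_preimage _ (@measurable_cell R d m _))].
    by rewrite !one E1; ring.
  rewrite -(pair_bigA _ (fun l k => \sum_q b (l, k) * b q * fine (P (D (l, k) `&` D q)))) /=.
  transitivity (\sum_(l < n) \sum_(l' < n) n%:R^-1 ^+ 2 * (S ^+ 2 + (l == l')%:R * (Q - S ^+ 2))).
    apply: eq_bigr => l _.
    under eq_bigr => k _ do rewrite -(pair_bigA _ (fun l' k' => b (l, k) * b (l', k') * fine (P (D (l, k) `&` D (l', k'))))) /=.
    by rewrite exchange_big /=; apply: eq_bigr => l' _; exact: inner.
  transitivity (\sum_(l < n) n%:R^-1 ^+ 2 * (n%:R * S ^+ 2 + (Q - S ^+ 2))).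
    apply: eq_bigr => l _; rewrite -mulr_sumr big_split /=; congr (_ * (_ + _)).
      by rewrite sumr_const card_ord mulr_natl.
    rewrite (bigD1 l) //= eqxx mul1r big1 ?addr0 // => l' l'l.
    by rewrite eq_sym (negbTE l'l) mul0r.
  by rewrite sumr_const card_ord -[LHS]mulr_natl; field.
by rewrite E1 E2; ring.
Qed.

End sampling.

Section product_integral.
Context {R : realType}.
Local Notation Rm := (measurableTypeR R).
Local Notation leb := (@lebesgue_measure R).

(** Tonelli, one coordinate at a time: the measure on tuples is by construction
    the image of a product measure. *)
Lemma integral_tuple_prod n (h : 'I_n -> Rm -> R) :
  (forall i, measurable_fun setT (h i)) -> (forall i s, 0 <= h i s) ->
  (\int[lebesgue_tuple n]_t (\prod_(i < n) h i (tnth t i))%:E =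
   \prod_(i < n) \int[leb]_s (h i s)%:E)%E.
Proof.
elim: n h => [|n IH] h mh h0.
  rewrite big_ord0 /= integral_dirac //=; last first.
    under eq_fun do rewrite big_ord0; exact: measurable_cst.
  by rewrite diracE mem_set // big_ord0 mul1e.
have mprod p (g : 'I_p -> Rm -> R) : (forall i, measurable_fun setT (g i)) ->
    measurable_fun setT (EFin \o (fun t : p.-tuple Rm => \prod_(i < p) g i (tnth t i))).
  move=> mg; apply/measurable_EFinP; apply: measurable_prod => i _.
  exact: (measurableT_comp (mg i) (measurable_tnth i)).
rewrite big_ord_recl -IH; [|by move=> i; exact: mh|by move=> i s; exact: h0].
rewrite /= /lebesgue_step.
rewrite ge0_integral_pushforward //=; [|exact: measurable_pcons|exact: mprod|]; last first.
  by move=> t _; rewrite lee_fin; apply: prodr_ge0 => i _; exact: h0.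
rewrite preimage_setT.
set G := (\int[lebesgue_tuple n]_t _)%E.
have E (x : Rm * n.-tuple Rm) : (\prod_(i < n.+1) h i (tnth (pcons x) i))%:E =
    ((h ord0 x.1)%:E * (\prod_(i < n) h (lift ord0 i) (tnth x.2 i))%:E)%E.
  rewrite big_ord_recl -EFinM; congr (_ * _)%:E.
  by apply: eq_bigr => i _; rewrite /pcons tnthS.
under eq_integral do rewrite /= E.
rewrite fubini_tonelli1 //; last 2 first.
- apply: emeasurable_funM.
    by apply/measurable_EFinP; exact: (measurableT_comp (mh ord0) measurable_fst).
  by apply: (measurableT_comp (mprod n (fun i => h (lift ord0 i)) _) measurable_snd) => i; exact: mh.
- by move=> x; apply: mule_ge0; rewrite lee_fin ?h0 //; apply: prodr_ge0 => i _; exact: h0.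
rewrite /fubini_F /=.
have pos (t : n.-tuple Rm) : (0 <= (\prod_(i < n) h (lift ord0 i) (tnth t i))%:E)%E.
  by rewrite lee_fin; apply: prodr_ge0 => i _; exact: h0.
have mp := mprod n (fun i => h (lift ord0 i)) (fun i => mh _).
have G0 : (0 <= G)%E by apply: integral_ge0 => t _; exact: pos.
under eq_integral => s _.
  rewrite ge0_integralZl //; last by rewrite lee_fin; exact: h0.
  rewrite muleC; over.
rewrite ge0_integralZl //; last 2 first.
- by apply/measurable_EFinP; exact: mh.
- by move=> s _; rewrite lee_fin; exact: h0.
by rewrite muleC.
Qed.

Lemma integral_itv_power (a b : R) e : a < b -> 0 <= a ->
  (\int[leb]_s (s ^+ e * \1_(`]a, b]%classic) s)%:E =
   ((b ^+ e.+1 - a ^+ e.+1) / e.+1%:R)%:E)%E.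
Proof.
move=> ab a0.
have mX (D : set Rm) : measurable D -> measurable_fun D (EFin \o (fun s : Rm => s ^+ e)).
  move=> mD; apply/measurable_EFinP.
  by apply: (@measurable_funS _ _ _ _ setT) => //; exact: measurable_funX.
have E s : (s ^+ e * \1_(`]a, b]%classic) s)%:E =
    ((EFin \o (fun s : R => s ^+ e)) \_ `]a, b]%classic) s.
  by rewrite patchE indicE; case: ifP => _; rewrite ?mulr1 ?mulr0.
under eq_integral do rewrite E.
rewrite -integral_mkcond integral_itv_obnd_cbnd; last exact: mX.
pose F : R -> R := e.+1%:R^-1 \*: (fun s : R => s ^+ e.+1).
have dF (s : R) : is_derive s 1 (F : R -> R) (s ^+ e).
  have dX := DeriveDef (@exprn_derivable R e.+1 s 1) (@exp_derive R e.+1 s 1).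
  apply: is_derive_eq; rewrite /= /GRing.scale /= mulr1 mulrA mulVf ?mul1r //.
have cF (s : R) : {for s, continuous F}.
  by apply: differentiable_continuous; apply/derivable1_diffP; case: (dF s).
rewrite (@continuous_FTC2 _ _ F) //.
- by rewrite -EFinB /F /= /GRing.scale /= -mulrBr mulrC.
- by apply: continuous_subspaceT => s; exact: exprn_continuous.
- split.
  + by move=> s _; case: (dF s).
  + exact/cvg_at_right_filter/cF.
  + exact/cvg_at_left_filter/cF.
- by move=> s _; rewrite derive1E; case: (dF s).
Qed.

End product_integral.

Section cell_mass_theory.
Context {R : realType} {d : nat}.
Local Notation Rm := (measurableTypeR R).
Implicit Types (f g : 'rV[R]_d -> R) (m : nat) (k : 'I_d -> nat) (c : R).

Definition cell_integrable f m k :=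
  (lebesgue_tuple d).-integrable (cell m k) (EFin \o (f \o @row_of_tuple R d)).

Lemma cell_massE f m k :
  cell_mass f m k = \int[lebesgue_tuple d]_(t in cell m k) (f (row_of_tuple t)).
Proof. by []. Qed.

Lemma density_cell_integrable f m k : is_density f -> cell_integrable f m k.
Proof.
move=> [f0 mf int1]; apply: (@integrableS _ _ _ _ setT) => //; first exact: measurable_cell.
apply/integrableP; split; first exact/measurable_EFinP.
under eq_integral => t _ do rewrite gee0_abs ?lee_fin ?f0 //.
by rewrite int1 ltry.
Qed.

Lemma bounded_cell_integrable f m k M : (0 < m)%N ->
  measurable_fun setT (f \o @row_of_tuple R d) ->
  (forall t, cell m k t -> `|f (row_of_tuple t)| <= M) -> cell_integrable f m k.
Proof.
move=> m0 mf fM; apply: measurable_bounded_integrable.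
- exact: measurable_cell.
- by rewrite [ltLHS](lebesgue_cell k m0) ltry.
- exact: measurable_funS mf.
- exists M; split; first exact: num_real.
  by move=> M' MM' t /= /fM h; apply: le_trans h _; exact: ltW.
Qed.

Lemma cell_mass_cst c m k : (0 < m)%N -> cell_mass (fun=> c : R) m k = c * m%:R ^- d.
Proof.
move=> m0; rewrite cell_massE /= Rintegral_cst; last exact: measurable_cell.
by rewrite [X in fine X](lebesgue_cell k m0).
Qed.

Lemma cst_cell_integrable c m k : (0 < m)%N -> cell_integrable (fun=> c) m k.
Proof.
by move=> m0; apply: (@bounded_cell_integrable _ _ _ `|c|) => //; exact: measurable_cst.
Qed.

Lemma cell_mass_dist f g m k e : (0 < m)%N ->
  cell_integrable f m k -> cell_integrable g m k ->
  (forall t, cell m k t -> `|f (row_of_tuple t) - g (row_of_tuple t)| <= e) ->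
  `|cell_mass f m k - cell_mass g m k| <= e * m%:R ^- d.
Proof.
move=> m0 If Ig fg; rewrite !cell_massE -RintegralB //; last exact: measurable_cell.
have Ie := cst_cell_integrable e k m0.
have mc := @measurable_cell R d m k.
have Ifg : (lebesgue_tuple d).-integrable (cell m k)
    (EFin \o (fun t => f (row_of_tuple t) - g (row_of_tuple t))).
  exact: (@integrableB _ _ _ _ _ mc _ _ If Ig).
apply: le_trans (le_normr_Rintegral mc Ifg) _.
rewrite -(cell_mass_cst e k m0) cell_massE.
apply: le_Rintegral => //.
exact: (@integrable_norm _ _ _ _ _ _ Ifg).
Qed.

Lemma cell_mass_sum (I : finType) (F : I -> 'rV[R]_d -> R) (c : I -> R) m k :
  (forall i, cell_integrable (F i) m k) ->
  cell_mass (fun z => \sum_i c i * F i z) m k = \sum_i c i * cell_mass (F i) m k.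
Proof.
move=> IF; have mc := @measurable_cell R d m k.
rewrite /cell_mass; under eq_integral do rewrite -sumEFin.
rewrite (@integral_sum _ _ _ _ _ mc _ (fun i t => (c i * F i (row_of_tuple t))%:E)); last first.
  move=> i; under [X in _.-integrable _ X]eq_fun do rewrite EFinM.
  exact: (integrableZl mc _ (IF i)).
under eq_bigr => i _.
  under eq_integral do rewrite EFinM.
  rewrite (integralZl mc (IF i)) -(fineK (integrable_fin_num mc (IF i))) -EFinM.
  over.
by rewrite sumEFin.
Qed.

Lemma cell_sum_integrable (I : finType) (F : I -> 'rV[R]_d -> R) (c : I -> R) m k :
  (forall i, cell_integrable (F i) m k) ->
  cell_integrable (fun z => \sum_i c i * F i z) m k.
Proof.
move=> IF; have mc := @measurable_cell R d m k; rewrite /cell_integrable.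
under [X in _.-integrable _ X]eq_fun do rewrite /= -sumEFin.
apply: integrable_sum => // i _.
under [X in _.-integrable _ X]eq_fun do rewrite EFinM.
exact: (integrableZl mc _ (IF i)).
Qed.

Definition monomial (e : 'I_d -> nat) (z : 'rV[R]_d) := \prod_i z 0 i ^+ e i.

Lemma measurable_monomial e : measurable_fun setT (monomial e \o @row_of_tuple R d).
Proof.
rewrite (_ : _ \o _ = fun t : d.-tuple Rm => \prod_i (tnth t i : R) ^+ e i); last first.
  by apply/funext => t; apply: eq_bigr => i _ /=; rewrite mxE.
by apply: measurable_prod => i _; apply: measurable_funX; exact: measurable_tnth.
Qed.

Lemma cell_coord m k (t : d.-tuple Rm) i : (0 < m)%N -> cell m k t ->
  (0 : R) <= (k i)%:R / m%:R < row_of_tuple t 0 i /\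
  row_of_tuple t 0 i <= (k i).+1%:R / m%:R.
Proof.
move=> m0 /(_ i)/andP[lt le]; rewrite mxE; split => //.
by rewrite lt andbT divr_ge0 // ler0n.
Qed.

Lemma monomial_cell_integrable e m k : (0 < m)%N -> cell_integrable (monomial e) m k.
Proof.
move=> m0; apply: (@bounded_cell_integrable _ _ _ (\prod_i ((k i).+1%:R / m%:R) ^+ e i)) => //.
  exact: measurable_monomial.
move=> t tk; rewrite normr_prod; apply: ler_prod => i _.
have [/andP[k0 kt] tk'] := cell_coord i m0 tk.
have t0 := le_trans k0 (ltW kt).
by rewrite normr_ge0 /= ger0_norm ?exprn_ge0 // lerXn2r // nnegrE (le_trans t0).
Qed.

Lemma cell_mass_monomial e m k : (0 < m)%N ->
  cell_mass (monomial e) m k =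
  \prod_i ((((k i).+1%:R / m%:R) ^+ (e i).+1 - ((k i)%:R / m%:R) ^+ (e i).+1)
           / (e i).+1%:R).
Proof.
move=> m0; rewrite /cell_mass integral_mkcond.
pose h i (s : Rm) : R :=
  s ^+ e i * \1_(`](k i)%:R / m%:R, (k i).+1%:R / m%:R]%classic : set R) s.
have step t : ((fun t => (monomial e (row_of_tuple t))%:E) \_ (cell m k)) t =
    (\prod_i h i (tnth t i))%:E.
  rewrite /h big_split /= patchE; have [|] := boolP (t \in cell m k).
    rewrite in_setE cell_box /= => tk.
    congr EFin; rewrite [X in _ * X]big1 ?mulr1.
      by apply: eq_bigr => i _; rewrite mxE.
    by move=> i _; rewrite indicE mem_set //; exact: tk.
  rewrite notin_setE cell_box => tk.
  have [i ti] : exists i, ~ (`](k i)%:R / m%:R, (k i).+1%:R / m%:R]%classic : set Rm) (tnth t i).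
    exact/existsNP.
  by rewrite [X in _ * X](bigD1 i) //= indicE memNset // mul0r mulr0.
under eq_integral do rewrite step.
have ab i : ((k i)%:R / m%:R < (k i).+1%:R / m%:R :> R).
  by rewrite ltr_pM2r ?invr_gt0 ?ltr0n // ltr_nat.
have k0 i : 0 <= (k i)%:R / m%:R :> R by rewrite divr_ge0.
rewrite integral_tuple_prod.
- rewrite (eq_bigr _ (fun i _ => integral_itv_power (e i) (ab i) (k0 i))).
  by rewrite prodEFin.
- move=> i; apply: measurable_funM; first exact: measurable_funX.
  exact: measurable_indic.
- move=> i s; rewrite /h indicE; have [|_] := boolP (s \in _); last by rewrite mulr0.
  rewrite in_setE /= in_itv /= => /andP[lt _]; rewrite mulr1 exprn_ge0 //.
  exact: le_trans (k0 i) (ltW lt).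
Qed.

Lemma monomial2E i j (z : 'rV[R]_d) :
  monomial (fun l => (l == i) + (l == j))%N z = z 0 i * z 0 j.
Proof.
rewrite /monomial; under eq_bigr do rewrite exprD.
rewrite big_split /= (bigD1 i) //= eqxx big1 ?mulr1; last by move=> l /negbTE->.
by rewrite (bigD1 j) //= eqxx big1 ?mulr1 // => l /negbTE->.
Qed.

(** [m^2] times the mean of [z i * z j] for a uniform point [z] of the cell [k]. *)
Definition cell_moment2 k i j : R :=
  if i == j then (k i)%:R ^+ 2 + (k i)%:R + 3^-1
  else ((k i)%:R + 2^-1) * ((k j)%:R + 2^-1).

Lemma cell_mass_monomial2 m k i j : (0 < m)%N ->
  cell_mass (fun z => z 0 i * z 0 j) m k = m%:R ^- d * (cell_moment2 k i j / m%:R ^+ 2).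
Proof.
move=> m0; have m_neq0 : (m%:R : R) != 0 by rewrite pnatr_eq0 -lt0n.
under [X in cell_mass X]eq_fun do rewrite -monomial2E.
rewrite (cell_mass_monomial _ _ m0).
have -> : m%:R ^- d = \prod_(l < d) m%:R^-1 :> R by rewrite prodr_const card_ord exprVn.
pose G (l : 'I_d) : R := (((k l).+1%:R / m%:R) ^+ ((l == i) + (l == j)).+1 -
  ((k l)%:R / m%:R) ^+ ((l == i) + (l == j)).+1) / ((l == i) + (l == j)).+1%:R.
rewrite -/G.
rewrite [LHS](eq_bigr (fun l => m%:R^-1 * (m%:R * G l))); last first.
  by move=> l _; rewrite mulrA mulVf ?mul1r.
rewrite big_split /=; congr (_ * _).
rewrite /cell_moment2; have [ij|ij] := eqVneq i j.
  rewrite /G -ij (bigD1 i) //= big1 ?mulr1; last first.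
    move=> l /negbTE li; rewrite li -[(k l).+1]addn1 natrD /=; field.
    by rewrite m_neq0.
  by rewrite eqxx -[(k i).+1]addn1 natrD /=; field; rewrite m_neq0.
rewrite (bigD1 i) //= (bigD1 j) ?(eq_sym j) //= big1 ?mulr1; last first.
  move=> l /andP[/negbTE li /negbTE lj]; rewrite /G li lj -[(k l).+1]addn1 natrD /=; field.
  by rewrite m_neq0.
rewrite /G !eqxx (negbTE ij) eq_sym (negbTE ij) -[(k i).+1]addn1 -[(k j).+1]addn1 !natrD /=.
by field; rewrite m_neq0.
Qed.

End cell_mass_theory.

(** * Squared multinomial probabilities near a face *)

Section collision_average.
Context {R : realType}.
Implicit Types (s ls : seq R) (m N : nat).

Lemma near_sqrt_power r (e : R) : 0 < e -> exists2 D : R, 0 < D &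
  forall t : R, `|t - 1| < D -> `|Num.sqrt t ^+ r - 1| <= e.
Proof.
move=> e0.
have : (fun t : R => Num.sqrt t ^+ r) @ (1 : R) --> (1 : R).
  rewrite -[X in _ --> X](expr1n _ r) -[X in X ^+ r]sqrtr1.
  by apply: (@cvg_comp _ _ _ (@Num.sqrt R) (fun u => u ^+ r) _ (nbhs (Num.sqrt (1 : R))));
    [exact: sqrt_continuous|exact: exprn_continuous].
move/cvgrPdist_le/(_ e e0)/nbhs_ballP => -[D /= D0 DP]; exists D => // t tD.
by rewrite distrC; apply: DP; rewrite /ball /= distrC.
Qed.

(** Chernoff's bounds survive the normalization by a power of [sqrt m]. *)
Lemma exp_tail_small (K c e : R) r : 0 < c -> 0 < e -> 0 <= K -> \forall N \near \oo,
  Num.sqrt N.+1%:R ^+ r * (K * expR (- (c * N%:R))) <= e.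
Proof.
move=> c0 e0 K0.
have lim : (fun N => 2 ^+ r * K * (N%:R ^+ r * expR (- (c * N%:R)))) @ \oo --> (0 : R).
  rewrite [X in _ --> X](_ : _ = 2 ^+ r * K * 0); last by rewrite mulr0.
  by apply: cvgMr; exact: cvg_poly_exp.
move/cvgrPdist_le/(_ e e0): lim => lim; near=> N.
have N1 : (1 : R) <= N%:R by near: N; exact: nbhs_infty_ger.
have : `|0 - 2 ^+ r * K * (N%:R ^+ r * expR (- (c * N%:R)))| <= e by near: N.
rewrite sub0r normrN => /(le_trans (ler_norm _)); apply: le_trans.
have -> : 2 ^+ r * K * (N%:R ^+ r * expR (- (c * N%:R))) =
    (2 * N%:R) ^+ r * (K * expR (- (c * N%:R))) by rewrite exprMn; ring.
apply: ler_wpM2r; first by rewrite mulr_ge0 ?expR_ge0.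
rewrite lerXn2r ?nnegrE ?sqrtr_ge0 ?mulr_ge0 //.
rewrite -(ler_sqr (sqrtr_ge0 _)) ?nnegrE ?mulr_ge0 // sqr_sqrtr ?ler0n //.
have := mulr_ge0 (le_trans ler01 N1) (_ : 0 <= N%:R - 1); rewrite subr_ge0 => /(_ N1).
by rewrite -natr1 expr2; lra.
Unshelve. all: by end_near.
Qed.

(** After [j] of the [N] draws have gone to the short coordinates, the other
    coordinates see a multinomial law with [N - j] draws.  The local limit
    theorem applies uniformly as long as [j] is a small fraction of [N], and
    larger values of [j] are exponentially unlikely. *)
Lemma collision_average s : all (fun x : R => 0 < x) s -> \sum_(x <- s) x < 1 ->
  forall e : R, 0 < e -> exists2 h : R, 0 < h & \forall N \near \oo,
    forall ls, all (fun l : R => 0 <= l) ls -> \sum_(l <- ls) l <= h * N.+1%:R ->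
    `|Num.sqrt N.+1%:R ^+ size s * (\sum_(j < N.+1) poisson_weight N.+1 N ls j *
        collision_prob (N - j) (1 - \sum_(x <- s) x - (\sum_(l <- ls) l) / N.+1%:R) s)
      - collision_limit (1 - \sum_(x <- s) x) s * \sum_(j < N.+1) poisson_weight N.+1 N ls j|
    <= e.
Proof.
move=> s0 s1 e e0; set a := 1 - \sum_(x <- s) x; set psi := collision_limit a s.
have a0 : 0 < a by rewrite subr_gt0.
have psi0 : 0 <= psi by rewrite /psi /collision_limit sqrtr_ge0.
have e10 : 0 < e / 8 by rewrite divr_gt0.
have /cvgrPdist_le/(_ _ e10) [[A B] /= [[K _ AK] /nbhs_ballP[D /= D0 BD]] AB] :=
  collision_prob_cvg s0 a0.
have loc (n : nat) (b : R) : (K <= n)%N -> `|b - a| < D ->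
    `|Num.sqrt n%:R ^+ size s * collision_prob n b s - psi| <= e / 8.
  move=> Kn ba; rewrite distrC; apply: (AB (n, b)); split; first exact: AK.
  by apply: BD; rewrite /ball /= distrC.
pose e2 := e / (8 * (psi + e)).
have e20 : 0 < e2 by rewrite divr_gt0 // mulr_gt0 // ltr_wpDl.
have [D2 D20 sq] := near_sqrt_power (size s) e20.
(* [a - p] stays positive and within [D] of [a], and [N.+1 / (N - j)] within [D2]
   of one, since [j < 2 * h * N] for typical [j]. *)
pose h := Num.min (8^-1) (Num.min (a / 2) (Num.min (D / 2) (D2 / 8))).
have h0 : 0 < h by rewrite !lt_min invr_gt0 ltr0n /= !divr_gt0.
have h8 : h <= 8^-1 by rewrite !ge_min lexx.
have ha : h <= a / 2 by rewrite !ge_min lexx ?orbT.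
have hD : h <= D / 2 by rewrite !ge_min lexx ?orbT.
have hD2 : h <= D2 / 8 by rewrite !ge_min lexx ?orbT.
exists h => //.
have rate0 : 0 < h ^+ 2 / 8 by rewrite divr_gt0 // exprn_gt0.
have e40 : 0 < e / 2 by rewrite divr_gt0.
have K0 : 0 <= 2 * (1 + psi) by rewrite mulr_ge0 // addr_ge0.
have tail := exp_tail_small (size s) rate0 e40 K0.
near=> N => ls ls0 lsh.
have N0 : 0 < N%:R :> R by near: N; exact: nbhs_infty_gtr.
have Nh : h^-1 <= N%:R by near: N; exact: nbhs_infty_ger.
have NK : 2 * K%:R <= N%:R :> R by near: N; exact: nbhs_infty_ger.
have hN : 1 <= h * N%:R by rewrite -ler_pdivrMl // mulr1.
have N1 : (1 : R) <= N%:R by near: N; exact: nbhs_infty_ger.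
have m0 : 0 < N.+1%:R :> R by rewrite ltr0n.
set La := \sum_(l <- ls) l in lsh *.
have La0 : 0 <= La by rewrite /La big_seq; apply: sumr_ge0 => l /(allP ls0).
pose p := La / N.+1%:R.
have p0 : 0 <= p by rewrite divr_ge0 // ltW.
have ph : p <= h by rewrite ler_pdivrMr.
have Lm : La <= N.+1%:R.
  by apply: le_trans lsh _; rewrite ger_pMl //; apply: le_trans h8 _; rewrite invf_le1 ?ler1n.
have p1 : p <= 1 by rewrite ler_pdivrMr // mul1r.
rewrite -/p mulr_sumr.
pose w (j : 'I_N.+1) := poisson_weight N.+1 N ls j.
pose g (j : 'I_N.+1) := Num.sqrt N.+1%:R ^+ size s * collision_prob (N - j) (a - p) s.
pose bad (j : 'I_N.+1) := h * N%:R <= `|j%:R - p * N%:R|.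
have wle (j : 'I_N.+1) : 0 <= w j <= binomial_pmf N p j.
  by apply: poisson_weight_le => //; rewrite -ltnS.
have w0 j : 0 <= w j by case/andP: (wle j).
have wbad : \sum_(j | bad j) w j <= 2 * expR (- (h ^+ 2 / 8 * N%:R)).
  apply: (@le_trans _ _ (\sum_(j < N.+1 | bad j) binomial_pmf N p j)).
    by apply: ler_sum => j _; case/andP: (wle j).
  apply: (@binomial_deviation R _ (fun j : 'I_N.+1 => binomial_pmf N p j) (fun j : 'I_N.+1 => j%:R)).
  - by move=> j; apply: binomial_pmf_nneg; rewrite p0 p1.
  - by rewrite p0 p1.
  - by rewrite h0; apply: le_trans h8 _; rewrite invf_le1 ?ler1n.
  - by move=> t; rewrite binomial_mgf.
have w1 : \sum_j w j <= 1.
  by rewrite -(sum_binomial_pmf N p); apply: ler_sum => j _; case/andP: (wle j).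
have ap0 : 0 < a - p by rewrite subr_gt0; apply: le_lt_trans ph _; move: ha a0; clear; lra.
have good j : ~~ bad j -> `|g j - psi| <= e / 2.
  rewrite /bad -ltNge => jh.
  have jN : j%:R < 2 * h * N%:R :> R.
    by move: jh (ler_norm (j%:R - p * N%:R)) (ler_wpM2r (ltW N0) ph); clear; lra.
  have jleN : (j <= N)%N by rewrite -ltnS.
  pose n := (N - j)%N.
  have nE : n%:R = N%:R - j%:R :> R by rewrite natrB.
  have n34 : (1 - 2 * h) * N%:R <= n%:R by rewrite nE; move: jN; clear; lra.
  have nK : (K <= n)%N.
    by rewrite -(ler_nat R); move: (ler_wpM2r (ltW N0) h8) n34 NK (ltW N0); clear; lra.
  have n0 : 0 < n%:R :> R.
    by have := ler_wpM2r (ltW N0) h8; move: n34 N0; clear; lra.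
  have /= := loc n (a - p) nK; rewrite addrAC subrr add0r normrN ger0_norm // => /(_ _) step.
  have {}step : `|Num.sqrt n%:R ^+ size s * collision_prob n (a - p) s - psi| <= e / 8.
    by apply: step; apply: le_lt_trans ph _; move: hD D0; clear; lra.
  have ratio : `|N.+1%:R / n%:R - 1| < D2.
    rewrite -[X in _ - X](divff (lt0r_neq0 n0)) -mulrBl normrM normfV (gtr0_norm n0) ltr_pdivrMr //.
    have nN : n%:R <= N%:R :> R by rewrite nE gerBl.
    rewrite -natr1 ger0_norm; last by move: nN; clear; lra.
    have := ler_wpM2r (ltW N0) h8; have := ler_wpM2r (ltW N0) hD2.
    have : D2 * (n%:R) >= D2 * ((1 - 2 * h) * N%:R) by rewrite ler_pM2l.
    have : D2 * ((1 - 2 * h) * N%:R) >= D2 * ((3 / 4) * N%:R).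
      by rewrite ler_pM2l // ler_pM2r //; move: h8; clear; lra.
    have : h * N%:R > 0 by rewrite mulr_gt0.
    have : D2 * N%:R > 0 by rewrite mulr_gt0.
    by move: hN n34; clear; lra.
  have {}sq := sq _ ratio.
  have gE : g j = Num.sqrt (N.+1%:R / n%:R) ^+ size s *
      (Num.sqrt n%:R ^+ size s * collision_prob n (a - p) s).
    rewrite mulrA -exprMn -sqrtrM ?divr_ge0 ?ler0n // divfK ?lt0r_neq0 //.
  set c := Num.sqrt n%:R ^+ size s * _ in step gE; set rho := Num.sqrt _ ^+ _ in gE sq.
  have -> : g j - psi = (rho - 1) * c + (c - psi) by rewrite gE; ring.
  apply: le_trans (ler_normD _ _) _; rewrite normrM.
  have cle : `|c| <= psi + e.
    rewrite -[c](subrK psi); apply: le_trans (ler_normD _ _) _.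
    rewrite (ger0_norm psi0) addrC lerD2l; apply: le_trans step _.
    by rewrite ler_piMr ?(ltW e0) // invf_le1 ?ler1n.
  have := ler_pM (normr_ge0 _) (normr_ge0 _) sq cle.
  rewrite /e2 invfM mulrA divfK ?lt0r_neq0 //; last by rewrite ltr_wpDl.
  by move: step e0; clear; lra.
have badB j : bad j -> `|g j - psi| <= Num.sqrt N.+1%:R ^+ size s + psi.
  move=> _; apply: le_trans (ler_normB _ _) _; rewrite (ger0_norm psi0) lerD2r.
  rewrite /g normrM ger0_norm ?exprn_ge0 ?sqrtr_ge0 // ler_piMr ?exprn_ge0 ?sqrtr_ge0 //.
  by have /andP[c0 c1] := collision_prob01 (N - j) ap0 s0; rewrite ger0_norm.
have := weighted_average_dist w0 (ltW e40) good badB.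
rewrite [X in `|X - _| <= _](_ : _ = \sum_j Num.sqrt N.+1%:R ^+ size s *
    (w j * collision_prob (N - j) (a - p) s)); last first.
  by apply: eq_bigr => j _; rewrite /g mulrCA.
move/le_trans; apply.
apply: (@le_trans _ _ (e / 2 + e / 2)); last by rewrite -splitr.
apply: lerD; first by rewrite ger_pMr.
(* On the bad [j] the normalization [sqrt m ^ r] is not compensated by the collision
   probability, but it is by the exponential tail. *)
have root1 : 1 <= Num.sqrt N.+1%:R ^+ size s :> R.
  by rewrite exprn_ege1 // -[leLHS]sqrtr1 ler_sqrt // ler1n.
apply: (@le_trans _ _ (Num.sqrt N.+1%:R ^+ size s *
    (2 * (1 + psi) * expR (- (h ^+ 2 / 8 * N%:R))))); last by near: N.
have -> : 2 * (1 + psi) * expR (- (h ^+ 2 / 8 * N%:R)) =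
    (1 + psi) * (2 * expR (- (h ^+ 2 / 8 * N%:R))) by ring.
rewrite [leRHS]mulrA; apply: ler_pM => //.
- by rewrite addr_ge0 // exprn_ge0 // sqrtr_ge0.
- by apply: sumr_ge0.
- by rewrite mulrDr mulr1 lerD2l ler_peMl.
Unshelve. all: by end_near.
Qed.

End collision_average.

Section squared_probabilities.
Context {R : realType} {d : nat}.
Implicit Types (x lam y : 'rV[R]_d) (J : {set 'I_d}).

Lemma big_entries (x : 'rV[R]_d) (A : {set 'I_d}) (V : Type) (e : V)
    (op : Monoid.com_law e) (F : R -> V) :
  \big[op/e]_(u <- [seq x 0 i | i <- enum A]) F u = \big[op/e]_(i in A) F (x 0 i).
Proof. by rewrite big_map big_enum. Qed.

(** The generating polynomial of the squared probabilities is a product over the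
    coordinates: [j] is the degree taken by the factors of [J], and the number of
    remaining draws determines the rest. *)
Lemma sum_sqr_multinomial J N x :
  \sum_(k : {ffun 'I_d -> 'I_N.+1} | (\sum_i k i <= N)%N)
    multinomial_prob N (fun i => k i) x ^+ 2 =
  \sum_(j < N.+1) (N ^_ j)%:R ^+ 2 *
    (\prod_(i in J) series_poly N (sqr_coeff (x 0 i)))`_j *
    mcollision (N - j) (1 - \sum_i `|x 0 i|) [seq x 0 i | i <- enum (~: J)].
Proof.
pose a := 1 - \sum_i `|x 0 i|.
transitivity (N`!%:R ^+ 2 * (series_poly N (sqr_coeff a) *
    \prod_i series_poly N (sqr_coeff (x 0 i)))`_N).
  rewrite -(@simplex_sumE R _ N (sqr_coeff a) (fun i => sqr_coeff (x 0 i))) mulr_sumr.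
  by apply: eq_bigr => k _; rewrite multinomial_probE [LHS]exprMn [X in _ * X]exprMn -prodrXl.
rewrite (bigID (mem J)) /= mulrCA coefM mulr_sumr; apply: eq_bigr => -[j /= jN] _.
rewrite -(ffact_fact (_ : (j <= N)%N)) // natrM exprMn [in RHS]/mcollision -/a.
rewrite [LHS]mulrACA; congr (_ * (_ * _)).
have le : (N - j <= N)%N by exact: leq_subr.
apply: (eq_uptoM (eq_upto_series_poly _ le) _ (leqnn _)).
rewrite big_entries [X in eq_upto _ X](eq_bigl (fun i => i \in ~: J)); last by move=> i; rewrite inE.
by apply: (@eq_upto_prod R _ _ _ (N - j) (fun i => series_poly N (sqr_coeff (x 0 i)))) => i _; exact: eq_upto_series_poly.
Qed.

Variables (J : {set 'I_d}) (lam y : 'rV[R]_d).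
Hypothesis lamJ : scale_params J lam.
Hypothesis yJ : fixed_coords J y.

Definition short_scales := [seq lam 0 i | i <- enum J].
Definition long_coords := [seq y 0 i | i <- enum (~: J)].

Lemma short_scales_ge0 : all (fun l : R => 0 <= l) short_scales.
Proof. by apply/allP => _ /mapP[i + ->]; rewrite mem_enum; have [+ _] := lamJ; apply. Qed.

Lemma long_coords_gt0 : all (fun l : R => 0 < l) long_coords.
Proof.
apply/allP => _ /mapP[i + ->]; rewrite mem_enum inE => iJ.
by have [_ /(_ i iJ)/andP[]] := yJ.
Qed.

Lemma sum_long_coords : \sum_(u <- long_coords) u = \sum_(i | i \notin J) y 0 i.
Proof. by rewrite big_entries; apply: eq_bigl => i; rewrite inE. Qed.

Lemma sum_short_scales : \sum_(l <- short_scales) l = \sum_(i in J) lam 0 i.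
Proof. exact: big_entries. Qed.

Lemma sum_near_face m : \sum_i near_face J lam y m 0 i =
  (\sum_(l <- short_scales) l) / m%:R + \sum_(u <- long_coords) u.
Proof.
rewrite sum_long_coords sum_short_scales (bigID (mem J)) /= mulr_suml.
by congr (_ + _); apply: eq_bigr => i iJ; rewrite mxE ?iJ // (negbTE iJ).
Qed.

Lemma size_long_coords : size long_coords = (d - #|J|)%N.
Proof. by rewrite size_map -cardE [LHS]cardsCs finset.setCK card_ord. Qed.

Lemma near_face_slack m : simplex (near_face J lam y m) ->
  1 - \sum_i `|near_face J lam y m 0 i| =
  1 - \sum_(u <- long_coords) u - (\sum_(l <- short_scales) l) / m%:R.
Proof. by move=> xs; rewrite simplex_norm // sum_near_face opprD addrA addrAC. Qed.

Lemma short_scales_le N : simplex (near_face J lam y N.+1) ->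
  \sum_(l <- short_scales) l <= N.+1%:R.
Proof.
move=> /simplexP[_]; rewrite sum_near_face => le.
rewrite -[leRHS]mul1r -ler_pdivrMr ?ltr0n //; apply: le_trans le; rewrite lerDl.
rewrite sum_long_coords; apply: sumr_ge0 => i iJ.
by have [_ /(_ i iJ)/andP[/ltW]] := yJ.
Qed.

Lemma sum_sqr_near_face N : simplex (near_face J lam y N.+1) ->
  \sum_(k : {ffun 'I_d -> 'I_N.+1} | (\sum_i k i <= N)%N)
    multinomial_prob N (fun i => k i) (near_face J lam y N.+1) ^+ 2 =
  if J == [set: 'I_d]%SET then \sum_(j < N.+1) poisson_weight N.+1 N short_scales j
  else \sum_(j < N.+1) poisson_weight N.+1 N short_scales j *
    collision_prob (N - j)
      (1 - \sum_(u <- long_coords) u - (\sum_(l <- short_scales) l) / N.+1%:R) long_coords.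
Proof.
move=> xs; rewrite (sum_sqr_multinomial J) near_face_slack //.
set a := 1 - _ - _.
have -> : [seq near_face J lam y N.+1 0 i | i <- enum (~: J)] = long_coords.
  by apply/eq_in_map => i; rewrite mem_enum inE mxE => /negbTE ->.
have -> : \prod_(i in J) series_poly N (sqr_coeff (near_face J lam y N.+1 0 i)) =
    \prod_(l <- short_scales) series_poly N (sqr_coeff (l / N.+1%:R)).
  by rewrite big_entries; apply: eq_bigr => i iJ; rewrite mxE iJ.
have aE : a + \sum_(u <- long_coords) u = 1 - (\sum_(l <- short_scales) l) / N.+1%:R.
  by rewrite /a; ring.
have [JT|JT] := eqVneq J _.
  apply: eq_bigr => j _; rewrite /poisson_weight.
  have long0 : long_coords = [::].
    by apply: size0nil; rewrite size_long_coords JT cardsT card_ord subnn.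
  rewrite -aE long0 /mcollision !big_nil mulr1 addr0 coef_series_poly // /sqr_coeff /exp_coeff /=.
  have : ((N - j)`!%:R : R) != 0 by rewrite pnatr_eq0 -lt0n fact_gt0.
  by set F := _`!%:R => F0; field.
apply: eq_bigr => j _; rewrite /poisson_weight /collision_prob aE.
have sig : 0 < 1 - (\sum_(l <- short_scales) l) / N.+1%:R.
  have [_] := (simplexP _).1 xs; rewrite sum_near_face => le.
  suff : 0 < \sum_(u <- long_coords) u.
    by move: le; set A := _ / _; set B := \sum_(u <- _) u; lra.
  have /subsetPn[i _ iJ] : ~~ ([set: 'I_d]%SET \subset J) by rewrite finset.subTset.
  have [_ yp _] := yJ.
  rewrite sum_long_coords (bigD1 i) //=; apply: ltr_wpDr; last by case/andP: (yp i iJ).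
  by apply: sumr_ge0 => l /andP[lJ _]; case/andP: (yp l lJ) => /ltW.
set sg := 1 - _ in sig *; rewrite [(2 * _)%N]mulnC exprM.
have : (sg ^+ (N - j)) != 0 by rewrite expf_neq0 // lt0r_neq0.
by set E := sg ^+ _ => E0; field.
Qed.

Lemma psi_collision : J != [set: 'I_d]%SET ->
  psi (~: J) y = collision_limit (1 - \sum_(u <- long_coords) u) long_coords.
Proof.
move=> JT; rewrite /psi /collision_limit subrK expr1n.
rewrite size_long_coords.
have -> : #|~: J| = (d - #|J|)%N by rewrite cardsCs finset.setCK card_ord.
have -> : \sum_(i in ~: J) y 0 i = \sum_(u <- long_coords) u by rewrite big_entries.
have -> : \prod_(i in ~: J) y 0 i = \prod_(u <- long_coords) u by rewrite big_entries.
have pos : 0 <= (4 * pi) ^+ (d - #|J|) * (1 - \sum_(u <- long_coords) u) *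
    \prod_(u <- long_coords) u.
  rewrite !mulr_ge0 ?exprn_ge0 ?mulr_ge0 ?pi_ge0 //.
    by have [_ _] := yJ; rewrite sum_long_coords subr_ge0 => /ltW.
  by rewrite big_seq; apply: prodr_ge0 => u /(allP long_coords_gt0)/ltW.
by rewrite powRN powR12_sqrt // div1r mulrA sqrtrV.
Qed.

Lemma psi_setT : psi (~: [set: 'I_d]%SET) y = 1.
Proof.
by rewrite /psi finset.setCT cards0 expr0 !big_set0 subr0 !mulr1 powR1.
Qed.

Lemma bessel_short_scales :
  \prod_(i in J) (expR (- (2 * lam 0 i)) * bessel_I0 (2 * lam 0 i)) =
  \prod_(l <- short_scales) (expR (- (2 * l)) * bessel_I0 (2 * l)).
Proof. by rewrite big_entries. Qed.

End squared_probabilities.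

(** * Tails and cell averages near a face *)

Section multinomial_tails.
Context {R : realType} {d : nat}.
Implicit Types (x : 'rV[R]_d) (A : {set 'I_d}) (N : nat).
Local Notation mindex N := {ffun 'I_d -> 'I_N.+1}.

(** The number of draws falling in a set of coordinates is binomial, which is
    visible on generating functions. *)
Lemma subset_gf N x A (b : R) : simplex x ->
  \sum_(k : mindex N | (\sum_i k i <= N)%N)
    multinomial_prob N (fun i => k i) x * b ^+ (\sum_(i in A) k i) =
  (1 + (\sum_(i in A) x 0 i) * (b - 1)) ^+ N.
Proof.
move=> sx.
have -> : 1 + (\sum_(i in A) x 0 i) * (b - 1) =
    1 - \sum_i `|x 0 i| + \sum_i (if i \in A then b else 1) * x 0 i.
  rewrite -{1}(simplex_slack sx) -addrA; congr (_ + _).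
  rewrite (bigID (mem A)) /= [in RHS](bigID (mem A)) /= addrAC; congr (_ + _).
    under [RHS]eq_bigr => i iA do rewrite iA.
    by rewrite -mulr_sumr; ring.
  by apply: eq_bigr => i /negbTE ->; rewrite mul1r.
rewrite -multinomial_gf; apply: eq_bigr => k _; congr (_ * _).
rewrite [RHS](bigID (mem A)) /= [X in _ * X]big1 ?mulr1; last first.
  by move=> i /negbTE ->; rewrite expr1n.
by rewrite -prodrXr; apply: eq_bigr => i iA; rewrite iA.
Qed.

Lemma subset_sum_le x A : simplex x -> 0 <= \sum_(i in A) x 0 i <= 1.
Proof.
move=> /simplexP[x0 x1]; rewrite sumr_ge0 //=; apply: le_trans x1.
by rewrite [leRHS](bigID (mem A)) /= lerDl sumr_ge0.
Qed.

Lemma subset_deviation N x A (D : R) : simplex x -> 0 < D <= 1 ->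
  \sum_(k : mindex N | (\sum_i k i <= N)%N &&
      (D * N%:R <= `|(\sum_(i in A) k i)%:R - (\sum_(i in A) x 0 i) * N%:R|))
    multinomial_prob N (fun i => k i) x <= 2 * expR (- (D ^+ 2 / 8 * N%:R)).
Proof.
move=> sx D01.
pose w (k : mindex N) := if (\sum_i k i <= N)%N then multinomial_prob N (fun i => k i) x
  else 0.
have h := @binomial_deviation R (mindex N) w (fun k : mindex N => (\sum_(i in A) k i)%:R)
  N (\sum_(i in A) x 0 i) D.
rewrite -[leLHS](_ : \sum_(k : mindex N | D * N%:R <=
  `|(\sum_(i in A) k i)%:R - (\sum_(i in A) x 0 i) * N%:R|) w k = _).
  apply: h => //; first by move=> k; rewrite /w; case: ifP => // _; exact: multinomial_ge0.
  - exact: subset_sum_le.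
  - move=> t; rewrite -subset_gf // le_eqVlt; apply/orP; left; apply/eqP.
    rewrite [RHS]big_mkcond /=; apply: eq_bigr => k _; rewrite /w.
    by case: ifP => _; rewrite ?mul0r // expRM_natr.
rewrite [LHS]big_mkcond [RHS]big_mkcond /=; apply: eq_bigr => k _; rewrite /w.
by case: (\sum_i k i <= N)%N; case: ifP.
Qed.

(** Cells sticking out of the simplex are charged exponentially little when the
    point stays away from the oblique face. *)
Lemma crossing_prob N x q : simplex x ->
  \sum_(k : mindex N | (\sum_i k i <= N)%N && (N.+1 < \sum_i k i + q)%N)
    multinomial_prob N (fun i => k i) x <= 2 ^+ q * ((1 + \sum_i x 0 i) / 2) ^+ N.
Proof.
move=> sx.
have h : \sum_(k : mindex N | (\sum_i k i <= N)%N)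
    multinomial_prob N (fun i => k i) x * 2 ^+ (\sum_i k i) = (1 + \sum_i x 0 i) ^+ N.
  have := subset_gf N [set: 'I_d]%SET 2 sx.
  have -> : \sum_(i in [set: 'I_d]%SET) x 0 i = \sum_i x 0 i.
    by apply: eq_bigl => i; rewrite inE.
  rewrite (_ : 2 - 1 = 1) ?mulr1; last by ring.
  move=> <-; apply: eq_bigr => k _; congr (_ * _ ^+ _).
  by apply: eq_bigl => i; rewrite inE.
rewrite expr_div_n mulrA -h mulr_sumr mulr_suml.
rewrite [leRHS](bigID (fun k : mindex N => (N.+1 < \sum_i k i + q)%N)) /=.
apply: ler_wpDr.
  apply: sumr_ge0 => k _; apply: mulr_ge0; last by rewrite invr_ge0 exprn_ge0.
  apply: mulr_ge0; first exact: exprn_ge0.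
  by apply: mulr_ge0; [exact: multinomial_ge0|exact: exprn_ge0].
apply: ler_sum => k /andP[_ kq].
rewrite ler_pdivlMr ?exprn_gt0 // mulrCA ler_wpM2l ?multinomial_ge0 //.
by rewrite -exprD ler_eXn2l ?ltr1n // addnC ltnW // ltnW.
Qed.

Lemma cube_le_exp2 c : (c ^ 3 <= 4 * 2 ^ c)%N.
Proof.
case: c => [|[|[|[|c]]]] //.
elim: c => [|c IH] //; rewrite [(2 ^ _)%N]expnS mulnCA.
apply: leq_trans (_ : 2 * c.+4 ^ 3 <= _)%N; last by rewrite leq_mul2l.
rewrite !expnS !expn0; nia.
Qed.

(** Exponential moments stay bounded near the face, and dominate the cubic ones. *)
Lemma cubic_moment N x A (q : nat) : simplex x ->
  \sum_(k : mindex N | (\sum_i k i <= N)%N)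
    multinomial_prob N (fun i => k i) x * (\sum_(i in A) k i + q)%:R ^+ 3 <=
  2 ^+ (q + 2) * expR (N%:R * \sum_(i in A) x 0 i).
Proof.
move=> sx; apply: (@le_trans _ _ (2 ^+ (q + 2) * (1 + \sum_(i in A) x 0 i) ^+ N)).
  have := subset_gf N A 2 sx; rewrite (_ : 2 - 1 = 1); last by ring.
  rewrite mulr1 => <-; rewrite mulr_sumr; apply: ler_sum => k _.
  rewrite [leRHS]mulrCA ler_wpM2l ?multinomial_ge0 // -exprD -!natrX ler_nat.
  apply: leq_trans (cube_le_exp2 _) _.
  set u := (\sum_(i in A) k i)%N; have -> : (q + 2 + u = 2 + (u + q))%N by lia.
  by rewrite [leqRHS]expnD.
rewrite ler_wpM2l ?exprn_ge0 // expRM_natl lerXn2r ?nnegrE ?expR_ge0 //.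
  by rewrite addr_ge0 //; case/andP: (subset_sum_le A sx).
exact: expR_ge1Dx.
Qed.

End multinomial_tails.

Section density_near_face.
Context {R : realType} {d : nat}.
Local Notation mindex N := {ffun 'I_d -> 'I_N.+1}.
Variables (f : 'rV[R]_d -> R) (J : {set 'I_d}) (M : R).
Hypotheses (f_density : is_density f) (f_supp : supported_on simplex f).
Hypotheses (M0 : 0 <= M)
  (f_face : forall z, simplex z -> `|f z - f 0| <= M * (\sum_(i in J) z 0 i) ^+ 2).

Definition density_bound := f 0 + M.
Local Notation B := density_bound.

(** The average of the density over a cell. *)
Definition cell_density m (k : 'I_d -> nat) := m%:R ^+ d * cell_mass f m k.

Lemma density_bound_ge0 : 0 <= B.
Proof. by have [f0 _ _] := f_density; rewrite addr_ge0. Qed.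

Lemma density_le_bound z : 0 <= f z <= B.
Proof.
have [f0 _ _] := f_density; rewrite f0 /=.
have [sz|/f_supp ->] := pselect (simplex z); last exact: density_bound_ge0.
have := f_face sz; rewrite ler_norml => /andP[_]; rewrite lerBlDl => /le_trans; apply.
rewrite lerD2l ler_piMr //.
have /andP[s0 s1] := subset_sum_le J sz.
by rewrite expr_le1.
Qed.

Lemma cell_density_dist (c e : R) m k : (0 < m)%N ->
  (forall t, cell m k t -> `|f (row_of_tuple t) - c| <= e) ->
  `|cell_density m k - c| <= e.
Proof.
move=> m0 fe; rewrite /cell_density.
have md : 0 < m%:R ^+ d :> R by rewrite exprn_gt0 // ltr0n.
have := cell_mass_dist m0 (density_cell_integrable m k f_density)
  (cst_cell_integrable c k m0) fe.
rewrite cell_mass_cst // ler_pdivlMr // -[X in _ * X]gtr0_norm // -normrM mulrBl divfK ?lt0r_neq0 //.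
by rewrite (mulrC (cell_mass _ _ _)).
Qed.

Lemma cell_density_le m k : (0 < m)%N -> 0 <= cell_density m k <= B.
Proof.
move=> m0; have := @cell_density_dist (B / 2) (B / 2) m k m0.
rewrite ler_norml; move=> h; have /andP[h1 h2] : - (B / 2) <= cell_density m k - B / 2 <= B / 2.
  apply: h => t _; have /andP[a b] := density_le_bound (row_of_tuple t).
  by rewrite ler_norml; apply/andP; split; lra.
by apply/andP; split; lra.
Qed.

Lemma cell_in_simplex m k t : (0 < m)%N -> (\sum_i k i + d <= m)%N ->
  @cell R d m k t -> simplex (row_of_tuple t).
Proof.
move=> m0 km tk; apply/simplexP; split=> [i|].
  by have [/andP[k0 kt] _] := cell_coord i m0 tk; exact: le_trans (ltW kt).
apply: (@le_trans _ _ (\sum_i (k i).+1%:R / m%:R)).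
  by apply: ler_sum => i _; have [] := cell_coord i m0 tk.
rewrite -mulr_suml ler_pdivrMr ?ltr0n // mul1r -natr_sum ler_nat.
rewrite (eq_bigr (fun i => k i + 1)%N); last by move=> i _; rewrite addn1.
by rewrite big_split /= sum_nat_const card_ord muln1.
Qed.

Lemma cell_subset_sum m k t (A : {set 'I_d}) : (0 < m)%N -> @cell R d m k t ->
  0 <= \sum_(i in A) row_of_tuple t 0 i <= (\sum_(i in A) k i + d)%:R / m%:R.
Proof.
move=> m0 tk; apply/andP; split.
  by apply: sumr_ge0 => i _; have [/andP[k0 /ltW kt] _] := cell_coord i m0 tk; exact: le_trans kt.
apply: (@le_trans _ _ (\sum_(i in A) (k i).+1%:R / m%:R)).
  by apply: ler_sum => i _; have [] := cell_coord i m0 tk.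
rewrite -mulr_suml ler_wpM2r ?invr_ge0 // -natr_sum ler_nat.
rewrite (eq_bigr (fun i => k i + 1)%N); last by move=> i _; rewrite addn1.
rewrite big_split /= leq_add2l sum_nat_const muln1.
by rewrite -[X in (_ <= X)%N]card_ord max_card.
Qed.

Lemma cell_density_face m k : (0 < m)%N -> (\sum_i k i + d <= m)%N ->
  `|cell_density m k - f 0| <= M * ((\sum_(i in J) k i + d)%:R / m%:R) ^+ 2.
Proof.
move=> m0 km; apply: cell_density_dist => // t tk.
apply: le_trans (f_face (cell_in_simplex m0 km tk)) _; apply: ler_wpM2l => //.
have /andP[a b] := cell_subset_sum J m0 tk.
by rewrite lerXn2r // nnegrE; exact: le_trans b.
Qed.

(** Inside the simplex the density deviates quadratically from its value on the
    face; nothing better than boundedness holds for cells that stick out. *)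
Lemma cell_density_dev m k : (0 < m)%N ->
  `|cell_density m k - f 0| <= M * ((\sum_(i in J) k i + d)%:R / m%:R) ^+ 2 +
    B * (m < \sum_i k i + d)%:R.
Proof.
move=> m0; case: ltnP => [_|km]; last first.
  by rewrite mulr0 addr0; exact: cell_density_face.
rewrite mulr1 ler_wpDl // ?mulr_ge0 ?sqr_ge0 //.
have /andP[a b] := cell_density_le k m0; have /andP[u v] := density_le_bound 0.
by rewrite ler_norml; apply/andP; split; lra.
Qed.

End density_near_face.

(** * The variance *)

Section variance.
Context {R : realType} {d : nat}.
Local Notation mindex N := {ffun 'I_d -> 'I_N.+1}.
Implicit Types (x lam y : 'rV[R]_d) (N : nat).
Variables (f : 'rV[R]_d -> R) (J : {set 'I_d}) (M : R).
Hypotheses (f_density : is_density f) (f_supp : supported_on simplex f).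
Hypotheses (M0 : 0 <= M)
  (f_face : forall z, simplex z -> `|f z - f 0| <= M * (\sum_(i in J) z 0 i) ^+ 2).
Local Notation B := (density_bound f M).

(** The expectation of the estimator. *)
Definition mean_density N x :=
  \sum_(k : mindex N | (\sum_i k i <= N)%N)
    multinomial_prob N (fun i => k i) x * cell_density f N.+1 (fun i => k i).

Definition sqr_density N x :=
  \sum_(k : mindex N | (\sum_i k i <= N)%N)
    multinomial_prob N (fun i => k i) x ^+ 2 * cell_density f N.+1 (fun i => k i).

Definition sqr_mass N x :=
  \sum_(k : mindex N | (\sum_i k i <= N)%N) multinomial_prob N (fun i => k i) x ^+ 2.

(** The variance of the contribution of a single sample point. *)
Definition sample_variance N x := N.+1%:R ^+ d * sqr_density N x - mean_density N x ^+ 2.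

Lemma MSE_moments (disp : measure_display) (T : measurableType disp)
    (P : probability T R) (X : nat -> {RV P >-> d.-tuple (measurableTypeR R)}) n N x :
  iid_sample X f -> (0 < n)%N ->
  MSE X f n N.+1 x =
  (n%:R^-1 * sample_variance N x + (mean_density N x - f x) ^+ 2)%:E.
Proof.
move=> Xf n0; rewrite (MSE_decomposition Xf x n0 (ltn0Sn N)) /=; congr EFin.
have -> : \sum_(k : mindex N | (\sum_i k i <= N)%N)
    N.+1%:R ^+ d * multinomial_prob N (fun i => k i) x * cell_mass f N.+1 (fun i => k i) =
    mean_density N x.
  by apply: eq_bigr => k _; rewrite /cell_density; ring.
congr (_ * (_ - _) + _); rewrite mulr_sumr; apply: eq_bigr => k _.
by rewrite /cell_density; ring.
Qed.

Lemma sqr_multinomial_le N x (k : mindex N) : simplex x -> (\sum_i k i <= N)%N ->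
  0 <= multinomial_prob N (fun i => k i) x ^+ 2 <= multinomial_prob N (fun i => k i) x.
Proof.
move=> sx kN; rewrite sqr_ge0 expr2 ler_piMr ?multinomial_ge0 //.
exact: multinomial_le1.
Qed.

Lemma sqr_mass01 N x : simplex x -> 0 <= sqr_mass N x <= 1.
Proof.
move=> sx; rewrite sumr_ge0 => [|k _]; last exact: sqr_ge0.
rewrite -(multinomial_sum1 N sx); apply: ler_sum => k kN.
by case/andP: (sqr_multinomial_le sx kN).
Qed.

Lemma mean_density_le N x : simplex x -> 0 <= mean_density N x <= B.
Proof.
move=> sx; have dB (k : mindex N) :=
  cell_density_le f_density f_supp M0 f_face (fun i => k i) (ltn0Sn N).
apply/andP; split.
  apply: sumr_ge0 => k _; rewrite mulr_ge0 ?multinomial_ge0 //.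
  by case/andP: (dB k).
rewrite -[leRHS]mul1r -(multinomial_sum1 N sx) mulr_suml; apply: ler_sum => k _.
by rewrite ler_wpM2l ?multinomial_ge0 //; case/andP: (dB k).
Qed.

Lemma sqr_density_le N x : simplex x -> 0 <= sqr_density N x <= B.
Proof.
move=> sx; have dB (k : mindex N) :=
  cell_density_le f_density f_supp M0 f_face (fun i => k i) (ltn0Sn N).
have B0 : 0 <= B := density_bound_ge0 f_density M0.
apply/andP; split.
  by apply: sumr_ge0 => k _; rewrite mulr_ge0 ?sqr_ge0 //; case/andP: (dB k).
apply: (@le_trans _ _ (sqr_mass N x * B)); last first.
  by rewrite ler_piMl //; case/andP: (sqr_mass01 N sx).
rewrite mulr_suml; apply: ler_sum => k _.
by rewrite ler_wpM2l ?sqr_ge0 //; case/andP: (dB k).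
Qed.

Lemma sqr_density_dist N x :
  `|sqr_density N x - f 0 * sqr_mass N x| <=
  \sum_(k : mindex N | (\sum_i k i <= N)%N) multinomial_prob N (fun i => k i) x ^+ 2 *
    `|cell_density f N.+1 (fun i => k i) - f 0|.
Proof.
rewrite /sqr_density /sqr_mass mulr_sumr -sumrB; apply: le_trans (ler_norm_sum _ _ _) _.
by apply: ler_sum => k _; rewrite [f 0 * _]mulrC -mulrBr normrM normrX real_normK ?num_real.
Qed.

Definition variance_scale N : R := N.+1%:R `^ ((d + #|J|)%:R / 2).

Lemma powR_half (a : R) q : 0 <= a -> a `^ (q%:R / 2) = Num.sqrt a ^+ q.
Proof. by move=> a0; rewrite mulrC powRrM powR12_sqrt // powR_mulrn // sqrtr_ge0. Qed.

Lemma variance_scaleE N : variance_scale N = Num.sqrt N.+1%:R ^+ (d + #|J|).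
Proof. exact: powR_half. Qed.

Lemma sqrt_nat_ge1 N : 1 <= Num.sqrt (N.+1%:R : R).
Proof. by rewrite -[leLHS]sqrtr1 ler_sqrt // ler1n. Qed.

Lemma variance_scale_ge1 N : 1 <= variance_scale N.
Proof. by rewrite variance_scaleE exprn_ege1 // sqrt_nat_ge1. Qed.

Lemma card_face : (#|J| <= d)%N.
Proof. by rewrite -[X in (_ <= X)%N]card_ord max_card. Qed.

Lemma variance_scaleM N :
  N.+1%:R ^+ d = variance_scale N * Num.sqrt N.+1%:R ^+ (d - #|J|) :> R.
Proof.
rewrite variance_scaleE -exprD -addnA subnKC ?card_face // addnn -mul2n exprM.
by rewrite sqr_sqrtr.
Qed.

Definition variance_error lam y N :=
  `|sample_variance N (near_face J lam y N.+1) / variance_scale N - v_const f J lam y|.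

Lemma fixed_coords_simplex y : fixed_coords J y -> simplex y.
Proof.
move=> [yJ y01 ys]; apply/simplexP; split=> [i|].
  have [/yJ ->//|/y01/andP[/ltW]//] := boolP (i \in J).
by rewrite (bigID (mem J)) /= big1 ?add0r; [exact: ltW|move=> i; exact: yJ].
Qed.

Lemma face_value y : fixed_coords J y -> f (zero_on J y) = f 0.
Proof.
move=> /fixed_coords_simplex/(simplex_zero_on J) sy; have := f_face sy.
rewrite big1 ?expr0n ?mulr0 => [|i iJ]; last by rewrite zero_onE iJ.
by rewrite normr_le0 subr_eq0 => /eqP.
Qed.

(** The variance differs from its limit by the error on the collision probability,
    by the deviation of the density from its value on the face, and by the squared
    mean, which is of lower order. *)
Lemma variance_error_le lam y N : fixed_coords J y ->
  simplex (near_face J lam y N.+1) ->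
  variance_error lam y N <=
  f 0 * `|Num.sqrt N.+1%:R ^+ (d - #|J|) * sqr_mass N (near_face J lam y N.+1) -
          psi (~: J) y * \prod_(i in J) (expR (- (2 * lam 0 i)) * bessel_I0 (2 * lam 0 i))| +
  Num.sqrt N.+1%:R ^+ (d - #|J|) *
    (\sum_(k : mindex N | (\sum_i k i <= N)%N)
      multinomial_prob N (fun i => k i) (near_face J lam y N.+1) ^+ 2 *
      `|cell_density f N.+1 (fun i => k i) - f 0|) +
  B ^+ 2 / variance_scale N.
Proof.
move=> yJ sx; set x := near_face J lam y N.+1 in sx *.
set w := Num.sqrt _ ^+ _.
have W0 : 0 < variance_scale N by exact: lt_le_trans (variance_scale_ge1 N).
have w0 : 0 <= w by rewrite exprn_ge0 // sqrtr_ge0.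
have f0 : 0 <= f 0 by have [+ _ _] := f_density; apply.
rewrite /variance_error -/x /v_const face_value //.
set Pi := \prod_(i in J) _; set W := variance_scale N in W0 *; set ps := psi _ _.
have -> : sample_variance N x / W - f 0 * ps * Pi =
    f 0 * (w * sqr_mass N x - ps * Pi) + w * (sqr_density N x - f 0 * sqr_mass N x)
    - mean_density N x ^+ 2 / W.
  rewrite /sample_variance variance_scaleM -/w -/W.
  by field; rewrite lt0r_neq0.
apply: le_trans (ler_normB _ _) _; apply: lerD.
  apply: le_trans (ler_normD _ _) _; rewrite !normrM (ger0_norm f0) (ger0_norm w0).
  by apply: lerD => //; apply: ler_wpM2l => //; exact: sqr_density_dist.
rewrite normrM normrV ?unitfE ?lt0r_neq0 // (gtr0_norm W0) ler_wpM2r ?invr_ge0 ?(ltW W0) //.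
have /andP[a b] := mean_density_le N sx.
by rewrite ger0_norm ?sqr_ge0 // lerXn2r // nnegrE // (le_trans a).
Qed.

End variance.

Section variance_limits.
Context {R : realType} {d : nat}.
Local Notation mindex N := {ffun 'I_d -> 'I_N.+1}.
Implicit Types (x lam y : 'rV[R]_d) (N : nat).
Variables (f : 'rV[R]_d -> R) (J : {set 'I_d}) (M : R).
Hypotheses (f_density : is_density f) (f_supp : supported_on simplex f).
Hypotheses (M0 : 0 <= M)
  (f_face : forall z, simplex z -> `|f z - f 0| <= M * (\sum_(i in J) z 0 i) ^+ 2).
Local Notation B := (density_bound f M).
Local Notation La lam := (\sum_(i in J) lam 0 i).
Local Notation Pi lam :=
  (\prod_(i in J) (expR (- (2 * lam 0 i)) * bessel_I0 (2 * lam 0 i))).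

Lemma poisson_constant : exists C : 'rV[R]_d -> R, forall lam, scale_params J lam ->
  0 <= C lam /\ forall N, La lam <= N.+1%:R ->
    `|\sum_(j < N.+1) poisson_weight N.+1 N (short_scales J lam) j - Pi lam| <= C lam / N.+1%:R.
Proof.
have /choice[C CP] : forall lam, exists C : R, scale_params J lam ->
    0 <= C /\ forall N, La lam <= N.+1%:R ->
      `|\sum_(j < N.+1) poisson_weight N.+1 N (short_scales J lam) j - Pi lam| <= C / N.+1%:R.
  move=> lam; have [lamJ|] := pselect (scale_params J lam); last by exists 0.
  have [C C0 CP] := sum_poisson_weight (short_scales_ge0 lamJ).
  exists C => _; split=> // N LaN; rewrite bessel_short_scales; apply: CP.
  by rewrite sum_short_scales.
by exists C.
Qed.

Lemma La_ge0 lam : scale_params J lam -> 0 <= La lam.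
Proof. by move=> [lam0 _]; exact: sumr_ge0. Qed.

Lemma face_coord_sum lam y m : \sum_(i in J) near_face J lam y m 0 i = La lam / m%:R.
Proof. by rewrite mulr_suml; apply: eq_bigr => i iJ; rewrite mxE iJ. Qed.

Lemma La_le lam y N : fixed_coords J y -> simplex (near_face J lam y N.+1) ->
  La lam <= N.+1%:R.
Proof. by move=> yJ sx; rewrite -sum_short_scales; exact: short_scales_le yJ N sx. Qed.

Lemma face_moment lam y N : scale_params J lam -> simplex (near_face J lam y N.+1) ->
  \sum_(k : mindex N | (\sum_i k i <= N)%N)
    multinomial_prob N (fun i => k i) (near_face J lam y N.+1) *
      (\sum_(i in J) k i + d)%:R ^+ 3 <= 2 ^+ (d + 2) * expR (La lam).
Proof.
move=> lamJ sx; apply: le_trans (cubic_moment N J d sx) _.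
rewrite ler_wpM2l ?exprn_ge0 // ler_expR face_coord_sum mulrA ler_pdivrMr ?ltr0n // mulrC.
by rewrite ler_wpM2l ?La_ge0 // ler_nat.
Qed.

Lemma natr_sqr_le_cube (q : nat) : q%:R ^+ 2 <= q%:R ^+ 3 :> R.
Proof. by case: q => [|q]; rewrite ?expr0n // [leRHS]exprS ler_peMl ?sqr_ge0 // ler1n. Qed.

Lemma natr_le_cube (q : nat) : q%:R <= q%:R ^+ 3 :> R.
Proof. by case: q => [|q]; rewrite ?expr0n // -[leLHS]expr1 ler_weXn2l // ler1n. Qed.

Lemma bias_weight_le lam y N : scale_params J lam ->
  simplex (near_face J lam y N.+1) ->
  \sum_(k : mindex N | (\sum_i k i <= N)%N)
    multinomial_prob N (fun i => k i) (near_face J lam y N.+1) *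
      (M * ((\sum_(i in J) k i + d)%:R / N.+1%:R) ^+ 2) <=
  M * (2 ^+ (d + 2) * expR (La lam)) / N.+1%:R ^+ 2.
Proof.
move=> lamJ sx; apply: (@le_trans _ _ (M / N.+1%:R ^+ 2 *
  \sum_(k : mindex N | (\sum_i k i <= N)%N)
    multinomial_prob N (fun i => k i) (near_face J lam y N.+1) *
      (\sum_(i in J) k i + d)%:R ^+ 3)); last first.
  rewrite [leRHS]mulrAC; apply: ler_wpM2l; last exact: face_moment.
  by rewrite divr_ge0 // exprn_ge0.
rewrite mulr_sumr; apply: ler_sum => k _.
rewrite [leRHS]mulrCA; apply: ler_wpM2l; first exact: multinomial_ge0.
rewrite expr_div_n mulrA [leRHS]mulrAC ler_wpM2r ?invr_ge0 ?exprn_ge0 //.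
by rewrite ler_wpM2l // natr_sqr_le_cube.
Qed.

Hypothesis d_gt0 : (0 < d)%N.

(** At the vertex the squared probabilities are those of independent Poisson
    variables up to [O(1/m)], and cubic moments of the counts control both the
    deviation of the density and the cells that stick out. *)
Lemma variance_vertex : J = [set: 'I_d]%SET -> exists C : 'rV[R]_d -> R,
  forall lam y N, scale_params J lam -> fixed_coords J y ->
    simplex (near_face J lam y N.+1) -> variance_error f J lam y N <= C lam / N.+1%:R.
Proof.
move=> JT; have [CE CEP] := poisson_constant.
exists (fun lam => f 0 * CE lam + (M + B) * (2 ^+ (d + 2) * expR (La lam)) + B ^+ 2).
move=> lam y N lamJ yJ sx.
have [CE0 CEN] := CEP lam lamJ.
have N0 : 0 < N.+1%:R :> R by rewrite ltr0n.
have N1 : 1 <= N.+1%:R :> R by rewrite ler1n.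
have f0 : 0 <= f 0 by have [+ _ _] := f_density; apply.
have B0 : 0 <= B := density_bound_ge0 f_density M0.
have dJ : (d - #|J| = 0)%N by rewrite JT cardsT card_ord subnn.
apply: le_trans (variance_error_le f_density f_supp M0 f_face yJ sx) _.
rewrite dJ expr0 !mul1r 2![in leRHS]mulrDl; apply: lerD; first apply: lerD.
- rewrite -mulrA ler_wpM2l // /sqr_mass (sum_sqr_near_face yJ sx) {1}JT eqxx.
  have -> : psi (~: J) y = 1 by rewrite JT psi_setT.
  by rewrite mul1r; apply: CEN; exact: La_le yJ sx.
- apply: (@le_trans _ _ ((M + B) / N.+1%:R *
    \sum_(k : mindex N | (\sum_i k i <= N)%N)
      multinomial_prob N (fun i => k i) (near_face J lam y N.+1) *
        (\sum_(i in J) k i + d)%:R ^+ 3)); last first.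
    rewrite [leRHS]mulrAC; apply: ler_wpM2l; last exact: face_moment.
    by rewrite divr_ge0 // addr_ge0.
  rewrite mulr_sumr; apply: ler_sum => k kN; rewrite [leRHS]mulrCA.
  have /andP[P0 P1] := sqr_multinomial_le sx kN.
  apply: ler_pM => //.
  apply: le_trans (cell_density_dev f_density f_supp M0 f_face (fun i => k i) (ltn0Sn N)) _.
  have -> : (\sum_i k i = \sum_(i in J) k i)%N by apply: eq_bigl => i; rewrite JT inE.
  set q := (_ + d)%N; rewrite -[leRHS]mulrA [leRHS]mulrDl; apply: lerD.
    rewrite ler_wpM2l // expr_div_n [leRHS]mulrC; apply: ler_pM; rewrite ?invr_ge0 ?exprn_ge0 //.
      exact: natr_sqr_le_cube.
    by rewrite lef_pV2 ?posrE ?exprn_gt0 // expr2 ler_peMl // ltW.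
  rewrite ler_wpM2l //; case: ltnP => [mq|_]; last by rewrite mulr_ge0 ?invr_ge0 ?exprn_ge0.
  rewrite [leRHS]mulrC ler_pdivlMr // mul1r; apply: le_trans (natr_le_cube q).
  by rewrite ler_nat ltnW.
- rewrite ler_wpM2l ?sqr_ge0 // lef_pV2 ?posrE //; last first.
    exact: lt_le_trans (@variance_scale_ge1 R d J N).
  have := @variance_scaleM R d J N; rewrite dJ expr0 mulr1 => <-.
  by rewrite -[leLHS]expr1 ler_weXn2l.
Qed.

(** A crude bound, for scales comparable to [m]. *)
Lemma variance_face_far lam y N : scale_params J lam -> fixed_coords J y ->
  simplex (near_face J lam y N.+1) ->
  variance_error f J lam y N <= (B + B ^+ 2) * N.+1%:R ^+ d + f 0 * psi (~: J) y.
Proof.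
move=> lamJ yJ sx; set x := near_face J lam y N.+1 in sx *.
have f0 : 0 <= f 0 by have [+ _ _] := f_density; apply.
have W1 := @variance_scale_ge1 R d J N; have W0 := lt_le_trans ltr01 W1.
have N1 : 1 <= N.+1%:R ^+ d :> R by rewrite exprn_ege1 // ler1n.
have /andP[m0 m1] := mean_density_le f_density f_supp M0 f_face N sx.
have /andP[s0 s1] := sqr_density_le f_density f_supp M0 f_face N sx.
have psi0 : 0 <= psi (~: J) y by exact: powR_ge0.
apply: le_trans (ler_normB _ _) _; apply: lerD.
  rewrite normrM normfV (gtr0_norm W0) ler_pdivrMr //.
  apply: (@le_trans _ _ ((B + B ^+ 2) * N.+1%:R ^+ d)); last first.
    by rewrite ler_peMr // mulr_ge0 ?exprn_ge0 // addr_ge0 ?sqr_ge0 // (le_trans m0).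
  apply: le_trans (ler_normB _ _) _; rewrite !ger0_norm ?sqr_ge0 ?mulr_ge0 ?exprn_ge0 //.
  rewrite mulrDl mulrC; apply: lerD; first by rewrite ler_wpM2r ?exprn_ge0.
  have : mean_density f N x ^+ 2 <= B ^+ 2 by rewrite lerXn2r // nnegrE (le_trans m0).
  by move=> /le_trans; apply; rewrite ler_peMr // sqr_ge0.
have [lam0 _] := lamJ.
have Pi01 : 0 <= Pi lam <= 1.
  have b01 i : i \in J -> 0 <= expR (- (2 * lam 0 i)) * bessel_I0 (2 * lam 0 i) <= 1.
    by move=> iJ; apply: bessel_weight01; exact: lam0.
  rewrite prodr_ile1 // andbT; apply: prodr_ge0 => i iJ; by case/andP: (b01 i iJ).
case/andP: Pi01 => Pi0 Pi1.
rewrite /v_const (face_value f_face yJ) !normrM (ger0_norm f0) (ger0_norm psi0) (ger0_norm Pi0).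
by rewrite ler_piMr // mulr_ge0.
Qed.

(** Unless the total of the counts in [J] deviates by [h * N] or the cell crosses
    the oblique face, the cell lies within [3 * h] of the face, where flatness gives
    a deviation of at most [9 * M * h ^ 2]. The exceptional counts are exponentially
    unlikely, which beats the normalization by a power of [sqrt m]. *)
Lemma sqr_density_face (h : R) lam y N : 0 < h <= 1 -> scale_params J lam ->
  fixed_coords J y -> simplex (near_face J lam y N.+1) ->
  La lam <= h * N.+1%:R -> d%:R <= h * N.+1%:R ->
  \sum_(k : mindex N | (\sum_i k i <= N)%N)
      multinomial_prob N (fun i => k i) (near_face J lam y N.+1) ^+ 2 *
      `|cell_density f N.+1 (fun i => k i) - f 0| <=
  9 * M * h * sqr_mass N (near_face J lam y N.+1) +
  M * (1 + d%:R) ^+ 2 * (2 * expR (- (h ^+ 2 / 8 * N%:R))) +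
  B * (2 ^+ d * ((1 + (h + \sum_(u <- long_coords J y) u)) / 2) ^+ N).
Proof.
move=> /andP[h0 h1] lamJ yJ sx Lh dh; set x := near_face J lam y N.+1 in sx *.
have m0 : 0 < N.+1%:R :> R by rewrite ltr0n.
have B0 : 0 <= B := density_bound_ge0 f_density M0.
have ph : La lam / N.+1%:R <= h by rewrite ler_pdivrMr.
pose bad (k : mindex N) := h * N%:R <=
  `|(\sum_(i in J) k i)%:R - (\sum_(i in J) x 0 i) * N%:R|.
pose P (k : mindex N) := multinomial_prob N (fun i => k i) x.
pose cross (k : mindex N) := (N.+1 < \sum_i k i + d)%N.
have P0 k : 0 <= P k by exact: multinomial_ge0.
apply: (@le_trans _ _ (\sum_(k : mindex N | (\sum_i k i <= N)%N)
    (9 * M * h * P k ^+ 2 + (if bad k then M * (1 + d%:R) ^+ 2 * P k else 0) +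
     (if cross k then B * P k else 0)))).
  apply: ler_sum => k kN; have /andP[_ PP] := sqr_multinomial_le sx kN.
  apply: le_trans (ler_wpM2l (sqr_ge0 _)
    (cell_density_dev f_density f_supp M0 f_face (fun i => k i) (ltn0Sn N))) _.
  rewrite mulrDr; apply: lerD; last first.
    rewrite /cross; case: ltnP => _; last by rewrite !mulr0.
    by rewrite mulr1 mulrC ler_wpM2l.
  set q := (\sum_(i in J) k i + d)%N; rewrite -/(P k) in PP *.
  have [bk|] := boolP (bad k).
    apply: ler_wpDl; first by apply: mulr_ge0; [rewrite !mulr_ge0 // ltW|exact: sqr_ge0].
    have qd : (q%:R / N.+1%:R) ^+ 2 <= (1 + d%:R) ^+ 2 :> R.
      rewrite lerXn2r ?nnegrE ?divr_ge0 ?addr_ge0 //.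
      rewrite ler_pdivrMr // mulrDl mul1r /q natrD; apply: lerD.
        rewrite ler_nat; apply: leq_trans (leqnSn N); apply: leq_trans kN.
        by rewrite [leqRHS](bigID (mem J)) leq_addr.
      by rewrite ler_peMr // ler1n.
    apply: le_trans (ler_pM (sqr_ge0 _) _ PP (ler_wpM2l M0 qd)) _.
      exact: mulr_ge0 M0 (sqr_ge0 _).
    by rewrite mulrC.
  rewrite /bad -ltNge addr0 => jh.
  have qm : q%:R / N.+1%:R <= 3 * h.
    rewrite ler_pdivrMr // /q natrD.
    have NN : N%:R <= N.+1%:R :> R by rewrite ler_nat.
    have : (\sum_(i in J) k i)%:R < h * N%:R + (\sum_(i in J) x 0 i) * N%:R.
      by rewrite -ltrBlDr; exact: le_lt_trans (ler_norm _) jh.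
    rewrite face_coord_sum => jb.
    move: jb (ler_wpM2r (ler0n R N) ph) (ler_wpM2l (ltW h0) NN) dh.
    move: (La lam / N.+1%:R) => p; move: (N.+1%:R) => m.
    move: ((\sum_(i in J) k i)%:R) => K; lra.
  have hh : h ^+ 2 <= h by rewrite expr2 ger_pMl.
  rewrite mulrC; apply: ler_wpM2r; first exact: sqr_ge0.
  have -> : 9 * M * h = M * (9 * h) by ring.
  rewrite ler_wpM2l //; apply: le_trans (_ : (3 * h) ^+ 2 <= _).
    by rewrite lerXn2r // nnegrE ?divr_ge0 // mulr_ge0 // ltW.
  by rewrite exprMn; lra.
rewrite !big_split /= -mulr_sumr -!big_mkcondr /= -!mulr_sumr; apply: lerD; first apply: lerD.
- exact: lexx.
- apply: ler_wpM2l; first by rewrite mulr_ge0 // sqr_ge0.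
  by apply: subset_deviation; rewrite // h0.
- apply: ler_wpM2l => //; apply: le_trans (crossing_prob N d sx) _.
  rewrite ler_wpM2l ?exprn_ge0 // lerXn2r ?nnegrE //.
  + rewrite divr_ge0 // addr_ge0 // sumr_ge0 // => i _; by have [+ _] := (simplexP _).1 sx; apply.
  + rewrite divr_ge0 // !addr_ge0 ?(ltW h0) // big_seq; apply: sumr_ge0 => u.
    by move=> /(allP (long_coords_gt0 yJ))/ltW.
  rewrite ler_pM2r // lerD2l /x sum_near_face lerD2r sum_short_scales //.
Qed.

(** The scales enter the local limit theorem through the weights only: the product
    of its limit [ps] with the Poisson error [CE lam / m] is at most
    [ps ^ 2 / m + CE lam ^ 2 / m], which separates the two groups of coordinates. *)
Lemma variance_face_near (CE : 'rV[R]_d -> R) :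
  (forall lam, scale_params J lam -> 0 <= CE lam /\ forall N, La lam <= N.+1%:R ->
    `|\sum_(j < N.+1) poisson_weight N.+1 N (short_scales J lam) j - Pi lam| <= CE lam / N.+1%:R) ->
  J != [set: 'I_d]%SET -> forall y (e : R), fixed_coords J y -> 0 < e ->
  exists2 h : R, 0 < h & \forall N \near \oo, forall lam, scale_params J lam ->
    simplex (near_face J lam y N.+1) -> La lam <= h * N.+1%:R ->
    variance_error f J lam y N <= f 0 * CE lam ^+ 2 / N.+1%:R + e.
Proof.
move=> CEP JT y e yJ e0.
have f0 : 0 <= f 0 by have [+ _ _] := f_density; apply.
have B0 : 0 <= B := density_bound_ge0 f_density M0.
set s := long_coords J y; set S := \sum_(u <- s) u.
have S1 : S < 1 by have [_ _] := yJ; rewrite -sum_long_coords.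
pose r := (d - #|J|)%N; pose ps := psi (~: J) y.
have ps0 : 0 <= ps by exact: powR_ge0.
(* Six sixths of [e]: the local limit, [ps ^ 2 / m], three for [sqr_density_face],
   and the squared mean. *)
pose e1 := e / (6 * (f 0 + 1)).
have e10 : 0 < e1 by rewrite divr_gt0 // mulr_gt0 // ltr_wpDl.
have e1e : f 0 * e1 <= e / 6.
  have p0 : 0 < 6 * (f 0 + 1) by rewrite mulr_gt0 // ltr_wpDl.
  rewrite mulrA ler_pdivrMr // (_ : e / 6 * _ = f 0 * e + e); last by field.
  by rewrite lerDl ltW.
have [h1 h10 P1] := collision_average (long_coords_gt0 yJ) S1 e10.
pose h := Num.min 1 (Num.min h1 (Num.min ((1 - S) / 2) (e / (6 * (9 * M * (ps + e1) + 1))))).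
have c0 : 0 < 9 * M * (ps + e1) + 1 by rewrite ltr_wpDl // !mulr_ge0 // addr_ge0 // ltW.
have h0 : 0 < h by rewrite !lt_min ltr01 h10 !divr_gt0 ?subr_gt0 // mulr_gt0.
have hh1 : h <= h1 by rewrite !ge_min lexx ?orbT.
have hle1 : h <= 1 by rewrite !ge_min lexx.
have hS : h <= (1 - S) / 2 by rewrite !ge_min lexx ?orbT.
have he : 9 * M * h * (ps + e1) <= e / 6.
  have : h <= e / (6 * (9 * M * (ps + e1) + 1)) by rewrite !ge_min lexx ?orbT.
  rewrite ler_pdivlMr ?mulr_gt0 // => le.
  have E : h * (6 * (9 * M * (ps + e1) + 1)) = 6 * (9 * M * h * (ps + e1)) + 6 * h by ring.
  by move: le; rewrite E; move: (9 * M * h * _) => t; lra.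
have K1 : 0 <= M * (1 + d%:R) ^+ 2 * 2 by rewrite !mulr_ge0 // sqr_ge0.
have c1 : 0 < h ^+ 2 / 8 by rewrite divr_gt0 // exprn_gt0.
have e6 : 0 < e / 6 by rewrite divr_gt0.
have Tail1 := exp_tail_small r c1 e6 K1.
have K2 : 0 <= B * 2 ^+ d by rewrite mulr_ge0 // exprn_ge0.
have c2 : 0 < (1 - S) / 4 by rewrite divr_gt0 // subr_gt0.
have Tail2 := exp_tail_small r c2 e6 K2.
exists h => //; near=> N => lam lamJ sx Lh.
have m0 : 0 < N.+1%:R :> R by rewrite ltr0n.
have [CE0 CEN] := CEP lam lamJ; have {}CEN := CEN N (La_le yJ sx).
set x := near_face J lam y N.+1 in sx *.
pose w : R := Num.sqrt N.+1%:R ^+ r; have w0 : 0 <= w by rewrite exprn_ge0 // sqrtr_ge0.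
set Sw := \sum_(j < N.+1) _ in CEN.
have Sw01 : 0 <= Sw <= 1.
  have p01 : 0 <= (\sum_(l <- short_scales J lam) l) / N.+1%:R <= 1.
    rewrite sum_short_scales divr_ge0 ?La_ge0 //= ler_pdivrMr // mul1r.
    exact: La_le yJ sx.
  have wle (j : 'I_N.+1) := @poisson_weight_le R N (short_scales J lam) j
    (short_scales_ge0 lamJ) (short_scales_le yJ sx) (leq_ord j).
  rewrite sumr_ge0 => [|j _]; last by case/andP: (wle j).
  rewrite -(sum_binomial_pmf N ((\sum_(l <- short_scales J lam) l) / N.+1%:R)) /=.
  by apply: ler_sum => j _; case/andP: (wle j).
have TP : `|w * sqr_mass N x - ps * Sw| <= e1.
  have := (near P1 N _) (short_scales J lam) (short_scales_ge0 lamJ) _.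
  rewrite sum_short_scales => /(_ _ (le_trans Lh _)) H.
  rewrite /sqr_mass (sum_sqr_near_face yJ sx) (negbTE JT) /ps (psi_collision yJ JT).
  rewrite /w /r -(size_long_coords J y) sum_short_scales; apply: H => //.
  by rewrite ler_wpM2r // ltW.
have Tle : w * sqr_mass N x <= ps + e1.
  have : ps * Sw <= ps by rewrite ler_piMr //; case/andP: Sw01.
  by move: TP (ler_norm (w * sqr_mass N x - ps * Sw)); lra.
apply: le_trans (variance_error_le f_density f_supp M0 f_face yJ sx) _.
have part1 : f 0 * `|w * sqr_mass N x - ps * Pi lam| <=
    e / 6 + f 0 * ps ^+ 2 / N.+1%:R + f 0 * CE lam ^+ 2 / N.+1%:R.
  have -> : e / 6 + f 0 * ps ^+ 2 / N.+1%:R + f 0 * CE lam ^+ 2 / N.+1%:R =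
      e / 6 + f 0 * ((ps ^+ 2 + CE lam ^+ 2) / N.+1%:R) by ring.
  apply: (@le_trans _ _ (f 0 * (e1 + (ps ^+ 2 + CE lam ^+ 2) / N.+1%:R))); last first.
    by rewrite mulrDr lerD2r.
  rewrite ler_wpM2l // (_ : _ - _ = (w * sqr_mass N x - ps * Sw) + ps * (Sw - Pi lam)); last by ring.
  apply: le_trans (ler_normD _ _) _; apply: lerD => //.
  rewrite normrM (ger0_norm ps0); apply: le_trans (ler_wpM2l ps0 CEN) _.
  rewrite mulrA ler_wpM2r ?invr_ge0 ?(ltW m0) //.
  have := sqr_ge0 (ps - CE lam); have := mulr_ge0 ps0 CE0; rewrite sqrrB; lra.
have psN : f 0 * ps ^+ 2 / N.+1%:R <= e / 6.
  rewrite ler_pdivrMr // [leRHS]mulrC -ler_pdivrMr ?divr_gt0 //.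
  apply: (@le_trans _ _ N%:R); last by rewrite ler_nat.
  by near: N; exact: nbhs_infty_ger.
have BW : B ^+ 2 / variance_scale J N <= e / 6.
  rewrite ler_pdivrMr ?(lt_le_trans ltr01 (@variance_scale_ge1 R d J N)) // mulrC.
  rewrite -ler_pdivrMr ?divr_gt0 //; apply: (@le_trans _ _ (Num.sqrt N.+1%:R)); last first.
    rewrite variance_scaleE -[leLHS]expr1 ler_weXn2l ?sqrt_nat_ge1 // addn_gt0 d_gt0 //.
  rewrite -[leLHS]ger0_norm ?mulr_ge0 ?sqr_ge0 ?invr_ge0 ?divr_ge0 ?(ltW e0) //.
  rewrite -sqrtr_sqr ler_sqrt ?ltr0n //; apply: (@le_trans _ _ N%:R); last by rewrite ler_nat.
  by near: N; exact: nbhs_infty_ger.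
have dN : d%:R <= h * N.+1%:R.
  rewrite mulrC -ler_pdivrMr //; apply: (@le_trans _ _ N%:R); last by rewrite ler_nat.
  by near: N; exact: nbhs_infty_ger.
have h01 : 0 < h <= 1 by rewrite h0.
have part2 := sqr_density_face h01 lamJ yJ sx Lh dN.
have {}part2 := ler_wpM2l w0 part2.
rewrite -/x -/s -/S in part2.
have tail1 : w * (M * (1 + d%:R) ^+ 2 * 2 * expR (- (h ^+ 2 / 8 * N%:R))) <= e / 6.
  by rewrite /w; near: N; exact: Tail1.
have tail2 : w * (B * 2 ^+ d * expR (- ((1 - S) / 4 * N%:R))) <= e / 6.
  by rewrite /w; near: N; exact: Tail2.
have cross : ((1 + (h + S)) / 2) ^+ N <= expR (- ((1 - S) / 4 * N%:R)).
  rewrite -mulNr expRM_natr lerXn2r ?nnegrE ?expR_ge0 //.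
    rewrite divr_ge0 // !addr_ge0 ?(ltW h0) // /S big_seq; apply: sumr_ge0 => u.
    by move=> /(allP (long_coords_gt0 yJ))/ltW.
  by apply: le_trans (expR_ge1Dx _); move: hS; lra.
have {}cross : w * (B * (2 ^+ d * ((1 + (h + S)) / 2) ^+ N)) <= e / 6.
  apply: le_trans tail2; rewrite ler_wpM2l // -[B * _ * _]mulrA ler_wpM2l // ler_wpM2l //.
have first : w * (9 * M * h * sqr_mass N x) <= e / 6.
  apply: le_trans he; rewrite mulrCA ler_wpM2l // !mulr_ge0 // ltW //.
apply: le_trans (lerD (lerD part1 (le_trans part2 (_ : _ <= e / 6 + e / 6 + e / 6))) BW) _.
  rewrite [leLHS]mulrDr; apply: lerD => //; rewrite [leLHS]mulrDr; apply: lerD => //.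
  by rewrite [M * _ * (2 * _)]mulrA.
by move: psN; move: (f 0 * ps ^+ 2 / _) (f 0 * CE lam ^+ 2 / _) => u v; lra.
Unshelve. all: by end_near.
Qed.

(** A fixed fraction [h] of [m] separates two cases. Below it the local limit
    theorem is uniform; above it [m <= (h * m) ^ 2 <= La lam ^ 2] for large [m], so that
    the crude bound of order [m ^ d] is absorbed by a constant that involves neither
    [h] nor [y]. *)
Lemma variance_face : J != [set: 'I_d]%SET -> exists C : 'rV[R]_d -> R,
  forall y, fixed_coords J y -> forall e : R, 0 < e -> \forall N \near \oo,
    forall lam, scale_params J lam -> simplex (near_face J lam y N.+1) ->
    variance_error f J lam y N <= C lam / N.+1%:R + e.
Proof.
move=> JT; have [CE CEP] := poisson_constant.
have f0 : 0 <= f 0 by have [+ _ _] := f_density; apply.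
have B0 : 0 <= B := density_bound_ge0 f_density M0.
pose K := B + B ^+ 2 + f 0.
have K0 : 0 <= K by rewrite !addr_ge0 // sqr_ge0.
exists (fun lam => f 0 * CE lam ^+ 2 + K * (1 + La lam) ^+ (2 * d.+1)).
move=> y yJ e e0; have [h h0 near_case] := variance_face_near CEP JT yJ e0.
near=> N => lam lamJ sx.
have m0 : 0 < N.+1%:R :> R by rewrite ltr0n.
have L0 := La_ge0 lamJ.
rewrite mulrDl; have [le|gt] := leP (La lam) (h * N.+1%:R).
  apply: (@le_trans _ _ (f 0 * CE lam ^+ 2 / N.+1%:R + e)).
    exact: (near near_case N).
  by rewrite lerD2r lerDl divr_ge0 // mulr_ge0 // exprn_ge0 // addr_ge0.
apply: le_trans (variance_face_far lamJ yJ sx) _.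
apply: (@le_trans _ _ (K * (1 + La lam) ^+ (2 * d.+1) / N.+1%:R)); last first.
  have := divr_ge0 (mulr_ge0 f0 (sqr_ge0 (CE lam))) (ltW m0).
  by move: (f 0 * _ / _) (K * _ / _) => u v; lra.
have hm : 1 <= h ^+ 2 * N.+1%:R.
  rewrite mulrC -ler_pdivrMr ?exprn_gt0 //; apply: (@le_trans _ _ N%:R); last by rewrite ler_nat.
  by near: N; exact: nbhs_infty_ger.
have pm : psi (~: J) y <= N.+1%:R.
  apply: (@le_trans _ _ N%:R); last by rewrite ler_nat.
  by near: N; exact: nbhs_infty_ger.
have md : psi (~: J) y <= N.+1%:R ^+ d.
  by apply: le_trans pm _; rewrite -[leLHS]expr1 ler_weXn2l // ler1n.
have m1 : 1 <= N.+1%:R ^+ d :> R by rewrite exprn_ege1 // ler1n.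
apply: (@le_trans _ _ (K * N.+1%:R ^+ d)).
  by rewrite [leRHS]mulrDl lerD2l ler_wpM2l.
rewrite -[leRHS]mulrA; apply: ler_wpM2l => //; rewrite ler_pdivlMr // -exprSr.
rewrite exprM lerXn2r ?nnegrE ?sqr_ge0 ?(ltW m0) //.
apply: (@le_trans _ _ ((h * N.+1%:R) ^+ 2)).
  by rewrite exprMn [N.+1%:R ^+ 2]expr2 mulrA ler_peMl // ltW.
rewrite lerXn2r ?nnegrE ?addr_ge0 ?mulr_ge0 ?(ltW h0) //.
by apply: le_trans (ltW gt) _; rewrite lerDr.
Unshelve. all: by end_near.
Qed.

End variance_limits.

(** * The bias *)

Section quadratic_moments.
Context {R : realType} {d : nat}.
Local Notation mindex N := {ffun 'I_d -> 'I_N.+1}.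
Implicit Types (x : 'rV[R]_d) (N : nat) (k : 'I_d -> nat).

(** Mean of [cell_moment2], the second moment of a uniform point of a rescaled
    cell, split into its quadratic, linear and constant parts in [N]. *)
Definition linear_part x i j : R := if i == j then 2 * x 0 i else (x 0 i + x 0 j) / 2.
Definition constant_part (i j : 'I_d) : R := if i == j then 3^-1 else 4^-1.

Lemma ffact_pick (k : 'I_d -> nat) i e :
  \prod_l ((k l) ^_ (e * (l == i))%N)%:R = ((k i) ^_ e)%:R :> R.
Proof.
rewrite (bigD1 i) //= eqxx muln1 big1 ?mulr1 // => l /negbTE ->.
by rewrite muln0.
Qed.

Lemma power_pick x i e : \prod_l x 0 l ^+ (e * (l == i))%N = x 0 i ^+ e.
Proof. by rewrite (bigD1 i) //= eqxx muln1 big1 ?mulr1 // => l /negbTE ->; rewrite muln0. Qed.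

Lemma sum_pick (i : 'I_d) e : (\sum_l (e * (l == i)))%N = e.
Proof. by rewrite (bigD1 i) //= eqxx muln1 big1 ?addn0 // => l /negbTE ->; rewrite muln0. Qed.

Lemma mean_moment2 N x i j : simplex x ->
  \sum_(k : mindex N | (\sum_i k i <= N)%N)
    multinomial_prob N (fun i => k i) x * cell_moment2 (fun i => k i) i j =
  N%:R * (N%:R - 1) * (x 0 i * x 0 j) + N%:R * linear_part x i j + constant_part i j.
Proof.
move=> sx.
have one l : \sum_(k : mindex N | (\sum_i k i <= N)%N)
    multinomial_prob N (fun i => k i) x * (k l)%:R = N%:R * x 0 l.
  have := factorial_moment N (fun i => (1 * (i == l))%N) sx.
  rewrite sum_pick power_pick ffactn1 expr1 => <-; apply: eq_bigr => k _.
  by rewrite (ffact_pick (fun i => k i)) ffactn1.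
have two : N%:R * (N%:R - 1) = (N ^_ 2)%:R :> R.
  case: (N) => [|n]; first by rewrite mul0r.
  by rewrite ffactnS ffactn1 natrM /= -natr1 addrK.
rewrite /cell_moment2 /linear_part /constant_part.
have [ij|ij] := eqVneq i j.
  have sq : \sum_(k : mindex N | (\sum_i k i <= N)%N)
      multinomial_prob N (fun i => k i) x * ((k i) ^_ 2)%:R = N%:R * (N%:R - 1) * x 0 i ^+ 2.
    have := factorial_moment N (fun l => (2 * (l == i))%N) sx.
    rewrite sum_pick power_pick two => <-; apply: eq_bigr => k _.
    by rewrite (ffact_pick (fun i => k i)).
  rewrite -ij (eq_bigr (fun k : mindex N => multinomial_prob N (fun i => k i) x * ((k i) ^_ 2)%:R +
    2 * (multinomial_prob N (fun i => k i) x * (k i)%:R) +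
    3^-1 * multinomial_prob N (fun i => k i) x)); last first.
    move=> k _; have -> : ((k i) ^_ 2)%:R = (k i)%:R * ((k i)%:R - 1) :> R; last by ring.
    case: (nat_of_ord (k i)) => [|n]; first by rewrite mul0r.
    by rewrite ffactnS ffactn1 natrM /= -natr1 addrK.
  by rewrite !big_split /= -!mulr_sumr sq one multinomial_sum1 //; ring.
have mix : \sum_(k : mindex N | (\sum_i k i <= N)%N)
    multinomial_prob N (fun i => k i) x * ((k i)%:R * (k j)%:R) =
    N%:R * (N%:R - 1) * (x 0 i * x 0 j).
  have := factorial_moment N (fun l => (1 * (l == i) + 1 * (l == j))%N) sx.
  have -> : (\sum_l (1 * (l == i) + 1 * (l == j)) = 2)%N by rewrite big_split /= !sum_pick.
  have -> : \prod_l x 0 l ^+ (1 * (l == i) + 1 * (l == j))%N = x 0 i * x 0 j.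
    under eq_bigr do rewrite exprD.
    by rewrite big_split /= !power_pick.
  rewrite two => <-; apply: eq_bigr => k _; congr (_ * _).
  rewrite -[in LHS](ffactn1 (k i)) -[in LHS](ffactn1 (k j)).
  rewrite -(ffact_pick (fun i => k i) i 1) -(ffact_pick (fun i => k i) j 1) -big_split /=.
  apply: eq_bigr => l _; have [->|li] := eqVneq l i; last by rewrite mul1r.
  by rewrite (negbTE ij) mulr1.
rewrite (eq_bigr (fun k : mindex N => multinomial_prob N (fun i => k i) x * ((k i)%:R * (k j)%:R) +
    2^-1 * (multinomial_prob N (fun i => k i) x * (k i)%:R) +
    2^-1 * (multinomial_prob N (fun i => k i) x * (k j)%:R) +
    4^-1 * multinomial_prob N (fun i => k i) x)); last by move=> k _; field.
by rewrite !big_split /= -!mulr_sumr mix !one multinomial_sum1 //; field.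
Qed.

End quadratic_moments.

Section vertex_bias.
Context {R : realType} {d : nat}.
Local Notation mindex N := {ffun 'I_d -> 'I_N.+1}.
Implicit Types (x lam y : 'rV[R]_d) (N : nat) (k : 'I_d -> nat).
Variables (f fext : 'rV[R]_d -> R) (U : set 'rV[R]_d) (M : R).
Hypotheses (d_gt0 : (0 < d)%N).
Hypotheses (f_density : is_density f) (f_supp : supported_on simplex f).
Hypotheses (U_simplex : simplex `<=` U) (fext_f : forall x, simplex x -> fext x = f x)
  (fext_C2 : C2_on U fext).
Local Notation JT := [set: 'I_d]%SET.
Hypotheses (M0 : 0 <= M)
  (f_face : forall z, simplex z -> `|f z - f 0| <= M * (\sum_(i in JT) z 0 i) ^+ 2).
Hypothesis grad0 : forall i, partial i fext 0 = 0.
Local Notation B := (density_bound f M).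
Local Notation h := (hessian fext).

(** The average over a cell of the second order Taylor polynomial at the vertex,
    without its constant term. *)
Definition cell_quadratic m k : R :=
  2^-1 * \sum_(p : 'I_d * 'I_d) h p.1 p.2 * cell_moment2 k p.1 p.2 / m%:R ^+ 2.

Definition hessian_bound : R := 2^-1 * \sum_(p : 'I_d * 'I_d) `|h p.1 p.2|.
Local Notation H := hessian_bound.

Lemma hessian_bound_ge0 : 0 <= H.
Proof. by rewrite mulr_ge0 ?invr_ge0 // sumr_ge0. Qed.

Lemma cell_moment2_le k i j :
  (0 : R) <= @cell_moment2 R d k i j <= (\sum_i k i + d)%:R ^+ 2.
Proof.
have le l : (k l + 1 <= \sum_i k i + d)%N.
  by apply: leq_add => //; rewrite (bigD1 l) //= leq_addr.
have le' l : (k l)%:R + 1 <= (\sum_i k i + d)%:R :> R.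
  by have := le l; rewrite -(ler_nat R) natrD.
have k0 l : 0 <= (k l)%:R :> R by [].
rewrite /cell_moment2; case: eqP => _.
  have := ler_pM (addr_ge0 (k0 i) ler01) (addr_ge0 (k0 i) ler01) (le' i) (le' i).
  rewrite -!expr2 sqrrD1 => {}le; rewrite !addr_ge0 ?sqr_ge0 ?invr_ge0 //=.
  by apply: le_trans le; have := k0 i; lra.
rewrite mulr_ge0 ?addr_ge0 ?invr_ge0 //= expr2; apply: ler_pM; rewrite ?addr_ge0 ?invr_ge0 //.
  by apply: le_trans (le' i); lra.
by apply: le_trans (le' j); lra.
Qed.

Lemma cell_quadratic_le m k : (0 < m)%N ->
  `|cell_quadratic m k| <= H * ((\sum_i k i + d)%:R / m%:R) ^+ 2.
Proof.
move=> m0; rewrite /cell_quadratic /hessian_bound normrM ger0_norm ?invr_ge0 // -[leRHS]mulrA.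
rewrite ler_wpM2l ?invr_ge0 // mulr_suml; apply: le_trans (ler_norm_sum _ _ _) _.
apply: ler_sum => p _; rewrite !normrM -mulrA ler_wpM2l // expr_div_n.
have /andP[c0 c1] := cell_moment2_le k p.1 p.2.
by rewrite (ger0_norm c0) normfV ger0_norm ?exprn_ge0 // ler_wpM2r ?invr_ge0 ?exprn_ge0.
Qed.

Let F (u : unit + 'I_d * 'I_d) (z : 'rV[R]_d) : R :=
  if u is inr p then z 0 p.1 * z 0 p.2 else 1.
Let c (u : unit + 'I_d * 'I_d) : R := if u is inr p then 2^-1 * h p.1 p.2 else f 0.

Let quadraticE z : f 0 + hessian_form fext z = \sum_u c u * F u z.
Proof.
rewrite big_sumType /= (big_pred1 tt) => [|[]//]; rewrite mulr1 /hessian_form; congr (_ + _).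
rewrite pair_bigA mulr_sumr; apply: eq_bigr => p _ /=; exact: mulrA.
Qed.

Let F_integrable m k u : (0 < m)%N -> cell_integrable (F u) m k.
Proof.
move=> m0; case: u => [[]|p] /=; first exact: cst_cell_integrable.
rewrite (_ : F _ = monomial (fun l => (l == p.1) + (l == p.2))%N).
  exact: monomial_cell_integrable.
by apply/funext => z; rewrite monomial2E.
Qed.

Lemma quadratic_cell_mass m k : (0 < m)%N ->
  cell_mass (fun z => f 0 + hessian_form fext z) m k = m%:R ^- d * (f 0 + cell_quadratic m k).
Proof.
move=> m0; have -> : (fun z => f 0 + hessian_form fext z) = (fun z => \sum_u c u * F u z).
  by apply/funext => z; exact: quadraticE.
rewrite (cell_mass_sum c (fun u => F_integrable k u m0)) big_sumType /= (big_pred1 tt) => [|[]//].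
rewrite mulrDr cell_mass_cst // mul1r mulrC; congr (_ + _).
rewrite /cell_quadratic !mulr_sumr; apply: eq_bigr => p _.
by rewrite cell_mass_monomial2 //; ring.
Qed.

Lemma cell_density_taylor (e D : R) m k : (0 < m)%N ->
  (forall z, simplex z -> \sum_i z 0 i < D ->
    `|fext z - fext 0 - hessian_form fext z| <= e * (\sum_i z 0 i) ^+ 2) ->
  0 <= e -> (\sum_i k i + d <= m)%N -> (\sum_i k i + d)%:R / m%:R < D ->
  `|cell_density f m k - (f 0 + cell_quadratic m k)| <=
  e * ((\sum_i k i + d)%:R / m%:R) ^+ 2.
Proof.
move=> m0 taylor e0 km kD; have md : 0 < m%:R ^+ d :> R by rewrite exprn_gt0 // ltr0n.
have Iq : cell_integrable (fun z => f 0 + hessian_form fext z) m k.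
  rewrite (_ : (fun z => _) = (fun z => \sum_u c u * F u z)); last first.
    by apply/funext => z; exact: quadraticE.
  exact: (cell_sum_integrable c (fun u => F_integrable k u m0)).
have fq t : cell m k t ->
    `|f (row_of_tuple t) - (f 0 + hessian_form fext (row_of_tuple t))| <=
    e * ((\sum_i k i + d)%:R / m%:R) ^+ 2.
  move=> tk; have sz := cell_in_simplex m0 km tk.
  have /andP[a b] := cell_subset_sum JT m0 tk.
  have sumT (G : 'I_d -> R) : \sum_(i in JT) G i = \sum_i G i.
    by apply: eq_bigl => i; rewrite inE.
  have sumTn : (\sum_(i in JT) k i = \sum_i k i)%N by apply: eq_bigl => i; rewrite inE.
  rewrite sumT sumTn in a b; rewrite opprD addrA -(fext_f sz) -(fext_f (@simplex0 R d)).
  apply: le_trans (taylor _ sz (le_lt_trans b kD)) _; rewrite ler_wpM2l //.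
  by rewrite lerXn2r // nnegrE // (le_trans a).
have := cell_mass_dist m0 (density_cell_integrable m k f_density) Iq fq.
rewrite quadratic_cell_mass // ler_pdivlMr // -[X in _ * X]gtr0_norm // -normrM mulrBl.
by rewrite mulrAC mulVf ?lt0r_neq0 // mul1r /cell_density mulrC.
Qed.

(** A cell at distance at least [D] from the vertex has [(\sum_i k i + d) / m >= D],
    so any bounded error there is at most a multiple of the cube of that ratio; cubic
    moments of the counts are bounded at the vertex. *)
Lemma cell_density_taylor_global e : 0 < e -> exists2 K : R, 0 <= K &
  forall m k, (0 < m)%N -> `|cell_density f m k - (f 0 + cell_quadratic m k)| <=
    e * (\sum_i k i + d)%:R ^+ 3 / m%:R ^+ 2 + K * (\sum_i k i + d)%:R ^+ 3 / m%:R ^+ 3.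
Proof.
move=> e0; have [D' D'0 taylor'] := taylor_vertex U_simplex fext_C2 grad0 e0.
pose D := Num.min D' 1.
have D0 : 0 < D by rewrite lt_min D'0 ltr01.
have D1 : D <= 1 by rewrite ge_min lexx orbT.
have DD' : D <= D' by rewrite ge_min lexx.
have B0 : 0 <= B := density_bound_ge0 f_density M0.
have H0 := hessian_bound_ge0.
exists (B / D ^+ 3 + H / D) => [|m k m0].
  by rewrite addr_ge0 // divr_ge0 // ?exprn_ge0 // ltW.
have mR : 0 < m%:R :> R by rewrite ltr0n.
set q := (\sum_i k i + d)%N.
have q23 := @natr_sqr_le_cube R q.
have pos : 0 <= q%:R ^+ 3 / m%:R ^+ 3 :> R by rewrite divr_ge0 ?exprn_ge0.
have [near|far] := ltP (q%:R / m%:R) D.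
  have qm : (q <= m)%N.
    by have := lt_le_trans near D1; rewrite ltr_pdivrMr // mul1r ltr_nat => /ltnW.
  have := cell_density_taylor m0 taylor' (ltW e0) qm (lt_le_trans near DD').
  move/le_trans; apply; rewrite -/q expr_div_n; apply: ler_wpDr.
    by rewrite -mulrA mulr_ge0 // addr_ge0 // divr_ge0 // ?exprn_ge0 // ltW.
  by rewrite -mulrA ler_wpM2l ?(ltW e0) // ler_wpM2r ?invr_ge0 ?exprn_ge0.
apply: ler_wpDl; first by rewrite divr_ge0 ?mulr_ge0 ?exprn_ge0 // ltW.
rewrite opprD addrA; apply: le_trans (ler_normB _ _) _; rewrite -mulrA mulrDl; apply: lerD.
  apply: (@le_trans _ _ B).
    have /andP[a b] := cell_density_le f_density f_supp M0 f_face k m0.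
    have /andP[u v] := density_le_bound f_density f_supp M0 f_face 0.
    by rewrite ler_norml; apply/andP; split; lra.
  rewrite -mulrA ler_peMr // mulrC -expr_div_n ler_pdivlMr ?exprn_gt0 // mul1r.
  by rewrite lerXn2r // nnegrE ?(ltW D0) // divr_ge0.
apply: le_trans (cell_quadratic_le k m0) _; rewrite -/q -[leRHS]mulrA ler_wpM2l //.
rewrite -expr_div_n [leRHS]mulrC ler_pdivlMr // [leRHS]exprS mulrC.
by rewrite ler_wpM2r // exprn_ge0 // divr_ge0.
Qed.

Lemma hessian_sym i j : h i j = h j i.
Proof. exact: (second_partials_sym U_simplex fext_C2). Qed.

Lemma mean_cell_quadratic N x : simplex x ->
  \sum_(k : mindex N | (\sum_i k i <= N)%N)
    multinomial_prob N (fun i => k i) x * (f 0 + cell_quadratic N.+1 (fun i => k i)) =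
  f 0 + \sum_(p : 'I_d * 'I_d) 2^-1 * h p.1 p.2 *
    (N%:R * (N%:R - 1) * (x 0 p.1 * x 0 p.2) + N%:R * linear_part x p.1 p.2 +
     constant_part p.1 p.2) / N.+1%:R ^+ 2.
Proof.
move=> sx; under eq_bigr do rewrite mulrDr.
rewrite big_split /= -mulr_suml multinomial_sum1 // mul1r; congr (_ + _).
under eq_bigr do rewrite /cell_quadratic !mulr_sumr.
rewrite exchange_big /=; apply: eq_bigr => p _.
rewrite -(mean_moment2 N p.1 p.2 sx) mulr_sumr mulr_suml; apply: eq_bigr => k _.
by ring.
Qed.

(** The mixed partials being equal, [lam i] and [lam j] may be exchanged in the
    mixed terms. *)
Lemma L_constE lam y : L_const fext JT lam y =
  \sum_(p : 'I_d * 'I_d) 2^-1 * h p.1 p.2 * (linear_part lam p.1 p.2 + constant_part p.1 p.2).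
Proof.
rewrite /L_const zero_onT (eq_bigl xpredT) => [|p]; last by rewrite !inE.
apply/eqP; rewrite -subr_eq0 -sumrB; apply/eqP.
pose t (i j : 'I_d) : R := if i == j then 0 else h i j * (lam 0 j - lam 0 i) / 4.
rewrite (eq_bigr (fun p => t p.1 p.2)); last first.
  move=> p _; rewrite /t /linear_part /constant_part -/(h p.1 p.2); case: eqP => _; last by field.
  by field.
have anti : \sum_p t p.1 p.2 = - \sum_p t p.1 p.2.
  rewrite -(pair_bigA _ t) /= [LHS]exchange_big /= -sumrN; apply: eq_bigr => i _.
  rewrite -sumrN; apply: eq_bigr => j _; rewrite /t eq_sym; case: eqP => _; first by rewrite oppr0.
  by rewrite hessian_sym; ring.
by move: anti; set u := \sum_p _; lra.
Qed.

(** The quadratic terms of the mean of [cell_quadratic] cancel those of [f] at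
    the point [lam / m] up to lower order; the limit is made of its
    linear and constant parts. *)
Lemma vertex_bias lam y : scale_params JT lam ->
  (fun N => N.+1%:R ^+ 2 * (mean_density f N (near_face JT lam y N.+1) -
    f (near_face JT lam y N.+1))) @ \oo --> L_const fext JT lam y.
Proof.
move=> lamJ; have [lam0 _] := lamJ.
have sumT (G : 'I_d -> R) : \sum_(i in JT) G i = \sum_i G i.
  by apply: eq_bigl => i; rewrite inE.
pose La := \sum_(i in JT) lam 0 i; have La0 : 0 <= La := La_ge0 lamJ.
pose C3 : R := 2 ^+ (d + 2) * expR La.
have C30 : 0 <= C3 by rewrite mulr_ge0 ?exprn_ge0 ?expR_ge0.
(* [al] and [be] collect the terms of order [1/m] and [1/m^2] of the expansion in
   [algebra] below. *)
pose al := \sum_(p : 'I_d * 'I_d) 2^-1 * h p.1 p.2 *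
  (- (3 * (lam 0 p.1 * lam 0 p.2)) - linear_part lam p.1 p.2).
pose be := \sum_(p : 'I_d * 'I_d) h p.1 p.2 * (lam 0 p.1 * lam 0 p.2).
apply/cvgrPdist_le => e e0.
pose e' := e / (2 * (C3 + La ^+ 2 + 1)).
have pos : 0 < C3 + La ^+ 2 + 1 by rewrite ltr_wpDl // addr_ge0 // sqr_ge0.
have e'0 : 0 < e' by rewrite divr_gt0 // mulr_gt0.
have [K K0 taylorC] := cell_density_taylor_global e'0.
have [D D0 taylor] := taylor_vertex U_simplex fext_C2 grad0 e'0.
near=> N.
have m0 : 0 < N.+1%:R :> R by rewrite ltr0n.
have NN : N%:R <= N.+1%:R :> R by rewrite ler_nat.
have Lm : La <= N.+1%:R by apply: le_trans NN; near: N; exact: nbhs_infty_ger.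
have LD : La / D < N.+1%:R by apply: lt_le_trans NN; near: N; exact: nbhs_infty_gtr.
have big : 2 * (K * C3 + `|al| + `|be|) / e <= N.+1%:R.
  by apply: le_trans NN; near: N; exact: nbhs_infty_ger.
set x := near_face JT lam y N.+1.
have xE i : x 0 i = lam 0 i / N.+1%:R by rewrite mxE inE.
have sumx : \sum_i x 0 i = La / N.+1%:R.
  by rewrite /La sumT mulr_suml; apply: eq_bigr => i _.
have sx : simplex x.
  apply/simplexP; split=> [i|]; first by rewrite xE divr_ge0 // lam0 // inE.
  by rewrite sumx ler_pdivrMr // mul1r.
pose Qm := \sum_(k : mindex N | (\sum_i k i <= N)%N)
    multinomial_prob N (fun i => k i) x * (f 0 + cell_quadratic N.+1 (fun i => k i)).
have part1 : N.+1%:R ^+ 2 * `|mean_density f N x - Qm| <= e' * C3 + K * C3 / N.+1%:R.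
  have : `|mean_density f N x - Qm| <= (e' / N.+1%:R ^+ 2 + K / N.+1%:R ^+ 3) * C3.
    apply: (@le_trans _ _ ((e' / N.+1%:R ^+ 2 + K / N.+1%:R ^+ 3) *
      (\sum_(k : mindex N | (\sum_i k i <= N)%N) multinomial_prob N (fun i => k i) x *
        (\sum_(i in JT) k i + d)%:R ^+ 3))); last first.
      rewrite ler_wpM2l ?face_moment // addr_ge0 // divr_ge0 ?exprn_ge0 // ltW //.
    rewrite /mean_density /Qm -sumrB mulr_sumr; apply: le_trans (ler_norm_sum _ _ _) _.
    apply: ler_sum => k _; rewrite -mulrBr normrM ger0_norm ?multinomial_ge0 // [leRHS]mulrCA.
    apply: ler_wpM2l; first exact: multinomial_ge0.
    have -> : (\sum_(i in JT) k i = \sum_i k i)%N by apply: eq_bigl => i; rewrite inE.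
    by apply: le_trans (taylorC N.+1 (fun i => k i) isT) _; rewrite le_eqVlt; apply/orP; left; apply/eqP; ring.
  move/(ler_wpM2l (exprn_ge0 2 (ltW m0)))/le_trans; apply; rewrite le_eqVlt; apply/orP; left.
  by apply/eqP; field; rewrite lt0r_neq0.
have part3 : N.+1%:R ^+ 2 * `|f x - f 0 - hessian_form fext x| <= e' * La ^+ 2.
  rewrite -(fext_f sx) -(fext_f (@simplex0 R d)).
  have xD : \sum_i x 0 i < D by rewrite sumx ltr_pdivrMr // mulrC -ltr_pdivrMr.
  apply: le_trans (ler_wpM2l (exprn_ge0 2 (ltW m0)) (taylor x sx xD)) _.
  by rewrite sumx expr_div_n mulrCA [N.+1%:R ^+ 2 * _]mulrC divfK ?expf_neq0 ?lt0r_neq0.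
have algebra : N.+1%:R ^+ 2 * (Qm - f 0 - hessian_form fext x) =
    L_const fext JT lam y + al / N.+1%:R + be / N.+1%:R ^+ 2.
  rewrite /Qm mean_cell_quadratic // [f 0 + _]addrC addrK L_constE /hessian_form pair_bigA /=.
  rewrite [2^-1 * _]mulr_sumr -sumrB mulr_sumr /al /be !mulr_suml -!big_split /=; apply: eq_bigr => p _.
  rewrite /linear_part !xE -/(h p.1 p.2); have -> : N%:R = N.+1%:R - 1 :> R by rewrite -natr1 addrK.
  by case: ifP => _; field; rewrite lt0r_neq0.
have split : N.+1%:R ^+ 2 * (mean_density f N x - f x) - L_const fext JT lam y =
    N.+1%:R ^+ 2 * (mean_density f N x - Qm)
    - N.+1%:R ^+ 2 * (f x - f 0 - hessian_form fext x) + (al / N.+1%:R + be / N.+1%:R ^+ 2).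
  move: algebra; set Lc := L_const _ _ _ _ => algebra.
  have -> : Lc = N.+1%:R ^+ 2 * (Qm - f 0 - hessian_form fext x) - al / N.+1%:R - be / N.+1%:R ^+ 2.
    by rewrite algebra; ring.
  by ring.
rewrite distrC split; apply: le_trans (ler_normD _ _) _.
have le1 := ler_normB (N.+1%:R ^+ 2 * (mean_density f N x - Qm))
    (N.+1%:R ^+ 2 * (f x - f 0 - hessian_form fext x)).
have nm z : `|N.+1%:R ^+ 2 * z| = N.+1%:R ^+ 2 * `|z|.
  by rewrite normrM ger0_norm ?exprn_ge0 ?(ltW m0).
rewrite !nm in le1.
have le2 : `|al / N.+1%:R + be / N.+1%:R ^+ 2| <= (`|al| + `|be|) / N.+1%:R.
  apply: le_trans (ler_normD _ _) _; rewrite !normrM !normfV (ger0_norm (ltW m0)).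
  rewrite [`|_ ^+ 2|]ger0_norm ?exprn_ge0 ?(ltW m0) // mulrDl lerD2l ler_wpM2l //.
  by rewrite lef_pV2 ?posrE ?exprn_gt0 // expr2 ler_peMr ?(ltW m0) // ler1n.
have e'E : e' * (C3 + La ^+ 2 + 1) = e / 2 by rewrite /e'; field; rewrite lt0r_neq0.
have le3 : K * C3 / N.+1%:R + (`|al| + `|be|) / N.+1%:R <= e / 2.
  rewrite -mulrDl addrA ler_pdivrMr //; move: big; rewrite ler_pdivrMr //.
  by rewrite [e / 2 * _]mulrAC ler_pdivlMr // mulrC [N.+1%:R * e]mulrC.
apply: le_trans (lerD (le_trans le1 (lerD part1 part3)) le2) _.
move: le3 e'E e'0; rewrite !mulrDr mulr1.
move: (K * C3 / _) ((_ + _) / _) (e' * C3) (e' * La ^+ 2) => u v w z; lra.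
Unshelve. all: by end_near.
Qed.

End vertex_bias.

Section face_bias.
Context {R : realType} {d : nat}.
Local Notation mindex N := {ffun 'I_d -> 'I_N.+1}.
Implicit Types (x lam y : 'rV[R]_d) (N : nat).
Variables (f : 'rV[R]_d -> R) (J : {set 'I_d}) (M : R).
Hypotheses (f_density : is_density f) (f_supp : supported_on simplex f).
Hypotheses (M0 : 0 <= M)
  (f_face : forall z, simplex z -> `|f z - f 0| <= M * (\sum_(i in J) z 0 i) ^+ 2).
Local Notation B := (density_bound f M).

(** Both the cell averages and the value at the point are quadratically close to
    [f 0], except for the cells crossing the oblique face. *)
Lemma face_bias_le lam y N : scale_params J lam ->
  simplex (near_face J lam y N.+1) ->
  `|mean_density f N (near_face J lam y N.+1) - f (near_face J lam y N.+1)| <=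
  M * (2 ^+ (d + 2) * expR (\sum_(i in J) lam 0 i) + (\sum_(i in J) lam 0 i) ^+ 2)
    / N.+1%:R ^+ 2 +
  B * (2 ^+ d * ((1 + \sum_i near_face J lam y N.+1 0 i) / 2) ^+ N).
Proof.
move=> lamJ sx; set x := near_face J lam y N.+1 in sx *.
have B0 : 0 <= B := density_bound_ge0 f_density M0.
have -> : mean_density f N x - f x = (mean_density f N x - f 0) - (f x - f 0) by ring.
apply: le_trans (ler_normB _ _) _; rewrite mulrDr mulrDl addrAC; apply: lerD; last first.
  apply: le_trans (f_face sx) _; rewrite /x face_coord_sum expr_div_n.
  by rewrite mulrA.
have -> : mean_density f N x - f 0 = \sum_(k : mindex N | (\sum_i k i <= N)%N)
    multinomial_prob N (fun i => k i) x * (cell_density f N.+1 (fun i => k i) - f 0).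
  under [RHS]eq_bigr do rewrite mulrBr.
  by rewrite big_split /= sumrN -mulr_suml multinomial_sum1 // mul1r.
apply: le_trans (ler_norm_sum _ _ _) _.
apply: (@le_trans _ _ (\sum_(k : mindex N | (\sum_i k i <= N)%N)
    (multinomial_prob N (fun i => k i) x * (M * ((\sum_(i in J) k i + d)%:R / N.+1%:R) ^+ 2) +
     (if (N.+1 < \sum_i k i + d)%N then B * multinomial_prob N (fun i => k i) x else 0)))).
  apply: ler_sum => k _.
  have Pk : 0 <= multinomial_prob N (fun i => k i) x by exact: multinomial_ge0.
  rewrite normrM ger0_norm //.
  apply: le_trans (ler_wpM2l Pk
    (cell_density_dev f_density f_supp M0 f_face (fun i => k i) (ltn0Sn N))) _.
  rewrite mulrDr lerD2l; case: ltnP => _; last by rewrite !mulr0.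
  by rewrite mulr1 mulrC.
rewrite big_split /= -big_mkcondr /= -mulr_sumr; apply: lerD; first exact: bias_weight_le.
by apply: ler_wpM2l => //; exact: crossing_prob.
Qed.

End face_bias.

(** * Uniform moduli and the optimal bandwidth *)

(** Turns an eventual bound that is uniform in a parameter into a single null
    sequence. *)
Lemma uniform_modulus (R : realType) (I : Type) (P : I -> nat -> Prop) (e : I -> nat -> R) :
  (forall N, exists B, forall i, P i N -> e i N <= B) ->
  (forall eps : R, 0 < eps -> \forall N \near \oo, forall i, P i N -> e i N <= eps) ->
  exists2 rho : nat -> R, rho @ \oo --> (0 : R) &
    (forall N, 0 <= rho N) /\ forall i N, P i N -> e i N <= rho N.
Proof.
move=> bounded small.
pose E N := [set u : R | u = 0 \/ exists2 i, P i N & u = e i N].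
have supE N : has_sup (E N).
  split; first by exists 0; left.
  have [B BP] := bounded N; exists (Num.max 0 B) => u [->|[i Pi ->]]; rewrite le_max ?lexx //.
  by rewrite BP ?orbT.
exists (fun N => sup (E N)); last first.
  split=> [N|i N Pi]; first by apply: ub_le_sup; [case: (supE N)|left].
  by apply: ub_le_sup; [case: (supE N)|right; exists i].
apply/cvgrPdist_le => eps eps0; near=> N.
have ge0 : 0 <= sup (E N) by apply: ub_le_sup; [case: (supE N)|left].
rewrite sub0r normrN ger0_norm //; apply: ge_sup; first by case: (supE N).
move=> u [->|[i Pi ->]]; first exact: ltW.
by move: i Pi; near: N; exact: small.
Unshelve. all: by end_near.
Qed.

Lemma split_error (R : realType) (E a b : R) : 0 <= a -> 0 <= b -> `|E| <= a + b ->
  exists e1 e2 : R, [/\ E = e1 + e2, `|e1| <= a & `|e2| <= b].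
Proof.
move=> a0 b0 Eab; have [Ea|aE] := leP `|E| a.
  by exists E, 0; rewrite addr0 normr0.
have [E0|E0] := leP 0 E.
  exists a, (E - a); rewrite subrKC ger0_norm // lexx; split=> //.
  rewrite (ger0_norm E0) in Eab aE; rewrite ger0_norm; lra.
exists (- a), (E + a); rewrite normrN ger0_norm // lexx; split=> //; first by ring.
rewrite (ltr0_norm E0) in Eab aE; rewrite ler0_norm; lra.
Qed.

Section optimum.
Context {R : realType}.
Variables (d : nat) (v L : R).
Hypotheses (d_gt0 : (0 < d)%N) (v_gt0 : 0 < v) (L_neq0 : L != 0).

Let q : R := (d + 4)%:R^-1.
Let a n : R := ln n%:R.
Let b : R := ln (L ^+ 2).
Let c : R := ln (d%:R / 4).
Let w : R := ln v.

Let powRexp (x y : R) : 0 < x -> x `^ y = expR (y * ln x).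
Proof. by move=> x0; rewrite /powR gt_eqF. Qed.

Let L2_gt0 : 0 < L ^+ 2. Proof. by rewrite exprn_even_gt0. Qed.
Let d4_gt0 : 0 < d%:R / 4 :> R. Proof. by rewrite divr_gt0 // ltr0n. Qed.
Let q_gt0 : 0 < q. Proof. by rewrite invr_gt0 ltr0n addn4. Qed.
Let dq : d%:R * q = 1 - 4 * q.
Proof.
have dR : (d + 4)%:R != 0 :> R by rewrite pnatr_eq0 addn4.
by rewrite /q; move: dR; rewrite natrD => dR; field.
Qed.

Lemma m_optE n : (0 < n)%N -> m_opt d v L n = expR (q * (a n + b - c - w)).
Proof.
move=> n0; have nR : 0 < n%:R :> R by rewrite ltr0n.
have dv0 : 0 < d%:R / 4 * v by rewrite mulr_gt0.
have lndv : ln (d%:R / 4 * v) = c + w by rewrite lnM.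
rewrite /m_opt (powRexp _ nR) (powRexp _ L2_gt0) (powRexp _ dv0) lndv -expRN -!expRD.
by congr expR; rewrite /a /b /q; ring.
Qed.

(** The bandwidth in units of [n^(1/(d+4))]. *)
Let kap := expR (q * (b - c - w)).

Lemma m_opt_scale n : (0 < n)%N -> m_opt d v L n = kap * expR (q * a n).
Proof. by move=> n0; rewrite m_optE // /kap -expRD; congr expR; ring. Qed.

Lemma m_opt_gt0 n : (0 < n)%N -> 0 < m_opt d v L n.
Proof. by move=> n0; rewrite m_optE // expR_gt0. Qed.

Let main n : R := expR (w - a n + d%:R * (q * (a n + b - c - w))).

Lemma leading_scaled n (r : R) : (0 < n)%N -> 0 < r ->
  leading_terms d v L n (m_opt d v L n * r) = main n * (r ^+ d + d%:R / 4 * r ^- 4).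
Proof.
move=> n0 r0; have nR : 0 < n%:R :> R by rewrite ltr0n.
rewrite /leading_terms m_optE //; set s := q * _.
have e4 : expR s ^- 4 = expR (- (4 * s)) by rewrite expRN expRM_natl.
have ed : expR s ^+ d = expR (d%:R * s) by rewrite expRM_natl.
have en : n%:R^-1 = expR (- a n) by rewrite expRN /a lnK.
have ev : v = expR w by rewrite /w lnK.
have eL : L ^+ 2 = expR b by rewrite /b lnK.
have e4d : d%:R / 4 = expR c by rewrite /c lnK.
rewrite !exprMn invfM e4 ed en {1}ev eL e4d mulrDr; congr (_ + _).
  by rewrite /main -/s !expRD; ring.
rewrite [RHS]mulrA (_ : main n * expR c = expR (- (4 * s)) * expR b); first by ring.
rewrite /main -/s -!expRD; congr expR.
have -> : s = q * (a n + b - c - w) by [].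
have -> : d%:R * (q * (a n + b - c - w)) = (d%:R * q) * (a n + b - c - w) by ring.
by rewrite dq; ring.
Qed.

(** Strict convexity of the exponential: both terms lie above their tangents at
    [r = 1], whose slopes cancel. *)
Lemma optimum_strict (r : R) : 0 < r -> r != 1 ->
  1 + d%:R / 4 < r ^+ d + d%:R / 4 * r ^- 4.
Proof.
move=> r0 r1; have l0 : ln r != 0 by rewrite ln_eq0.
have dR : 0 < d%:R :> R by rewrite ltr0n.
have E (k : nat) : r ^+ k = expR (k%:R * ln r) by rewrite expRM_natl lnK.
have p1 : 1 + d%:R * ln r < r ^+ d.
  by rewrite E expR_gt1Dx // mulf_neq0 // lt0r_neq0.
have p2 : 1 - 4 * ln r < r ^- 4.
  by rewrite E -expRN expR_gt1Dx // oppr_eq0 mulf_neq0.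
have := ltrD p1 (_ : d%:R / 4 * (1 - 4 * ln r) < d%:R / 4 * r ^- 4).
rewrite ltr_pM2l // => /(_ p2); apply: le_lt_trans.
by rewrite le_eqVlt; apply/orP; left; apply/eqP; field.
Qed.

Lemma main_gt0 n : 0 < main n. Proof. exact: expR_gt0. Qed.

Lemma leading_m_opt n : (0 < n)%N ->
  leading_terms d v L n (m_opt d v L n) = main n * (1 + d%:R / 4).
Proof.
by move=> n0; rewrite -[m_opt d v L n]mulr1 leading_scaled // !expr1n invr1 mulr1.
Qed.

Lemma m_opt_strict n (s : R) : (0 < n)%N -> 0 < s -> s != m_opt d v L n ->
  leading_terms d v L n (m_opt d v L n) < leading_terms d v L n s.
Proof.
move=> n0 s0 sm; have m0 := m_opt_gt0 n0.
rewrite leading_m_opt // (_ : s = m_opt d v L n * (s / m_opt d v L n)); last first.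
  by rewrite mulrC divfK ?lt0r_neq0.
rewrite leading_scaled //; last exact: divr_gt0.
rewrite (ltr_pM2l (main_gt0 n)).
apply: optimum_strict; first exact: divr_gt0.
by apply: contra sm => /eqP E; rewrite -[s](divfK (lt0r_neq0 m0)) E mul1r.
Qed.

Lemma leading_optimal n : (0 < n)%N ->
  leading_terms d v L n (m_opt d v L n) = optimal_MSE d v L n.
Proof.
move=> n0; have nR : 0 < n%:R :> R by rewrite ltr0n.
have dR : d%:R != 0 :> R by rewrite pnatr_eq0 -lt0n.
rewrite leading_m_opt // /optimal_MSE.
have d40 : 0 < 4 / d%:R :> R by rewrite divr_gt0 // ltr0n.
have lnd : ln (4 / d%:R) = - c by rewrite -invf_div lnV // posrE.
rewrite (powRexp _ nR) (powRexp _ L2_gt0) (powRexp _ d40) (powRexp _ v_gt0) lnd -/b -/w -/(a n) -/q.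
have -> : 1 + d%:R / 4 = (4 / d%:R + 1) * expR c by rewrite /c lnK //; field.
have tpos : 4 / d%:R + 1 != 0 :> R by rewrite lt0r_neq0 // addr_gt0.
rewrite !invfM invrK -!expRN mulrCA [RHS]mulrC.
have -> : main n * expR c = expR (- (4 * q) * a n) * expR (d%:R * q * b) *
    expR (- (4 * q * - c)) * expR (- (- (4 * q) * w)).
  rewrite /main -!expRD; congr expR; rewrite mulrA !dq; ring.
ring.
Qed.

Lemma m_opt_cvg : m_opt d v L n @[n --> \oo] --> +oo.
Proof.
apply/cvgryPge => A.
pose A' := Num.max A 1 / kap.
have kap0 : 0 < kap by exact: expR_gt0.
near=> n.
have n1 : (1 : R) <= n%:R by near: n; exact: nbhs_infty_ger.
have n0 : (0 < n)%N by rewrite -(ltr0n R) (lt_le_trans ltr01).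
have An : expR (ln A' / q) <= n%:R by near: n; exact: nbhs_infty_ger.
have A'0 : 0 < A' by rewrite divr_gt0 // lt_max ltr01 orbT.
rewrite m_opt_scale //; apply: (@le_trans _ _ (kap * A')).
  by rewrite mulrC divfK ?lt0r_neq0 // le_max lexx.
rewrite ler_pM2l // -[leLHS]lnK // ler_expR mulrC -ler_pdivrMr //.
by rewrite -ler_expR /a lnK // posrE ltr0n.
Unshelve. all: by end_near.
Qed.

(** In units of the optimal rate the mean square error is a fixed function of
    the bandwidth divided by [m_opt]. *)
Lemma rate_scaled n (V b2 : R) (m : R) : (0 < n)%N -> 0 < m ->
  n%:R `^ (4 / (d + 4)%:R) * (n%:R^-1 * (m ^+ d * V) + m ^- 4 * b2) =
  kap ^+ d * (m / m_opt d v L n) ^+ d * V + kap ^- 4 * (m_opt d v L n / m) ^+ 4 * b2.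
Proof.
move=> n0 m0; have nR : 0 < n%:R :> R by rewrite ltr0n.
have k0 : kap != 0 by rewrite lt0r_neq0 // expR_gt0.
rewrite (powRexp _ nR) -/q -/(a n) m_opt_scale //; set u := expR (q * a n).
have u0 : u != 0 by rewrite lt0r_neq0 // expR_gt0.
have -> : expR (4 / (d + 4)%:R * a n) = u ^+ 4 by rewrite /u -expRM_natl mulrA.
have -> : n%:R^-1 = u ^- (d + 4).
  rewrite /u -expRM_natl -expRN -[LHS](lnK _) ?posrE ?invr_gt0 //; congr expR.
  rewrite lnV ?posrE // -/(a n) mulrA divff ?mul1r //.
rewrite exprD !expr_div_n !exprMn; field.
by rewrite (lt0r_neq0 m0) k0 u0 !expf_neq0.
Qed.

End optimum.

(** * The mean square error *)

Section remainders.
Context {R : realType} {d : nat}.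
Implicit Types (lam y : 'rV[R]_d) (N m : nat).
Variables (f fext : 'rV[R]_d -> R) (U : set 'rV[R]_d) (J : {set 'I_d}) (M : R).
Hypotheses (d_gt0 : (0 < d)%N).
Hypotheses (f_density : is_density f) (f_supp : supported_on simplex f).
Hypotheses (U_simplex : simplex `<=` U) (fext_f : forall x, simplex x -> fext x = f x)
  (fext_C2 : C2_on U fext).
Hypotheses (M0 : 0 <= M)
  (f_face : forall z, simplex z -> `|f z - f 0| <= M * (\sum_(i in J) z 0 i) ^+ 2).
Hypothesis grad0 : forall i, partial i fext 0 = 0.
Local Notation JT := [set: 'I_d]%SET.
Local Notation B := (density_bound f M).

Definition bias lam y N :=
  mean_density f N (near_face J lam y N.+1) - f (near_face J lam y N.+1).

(** The squared bias beyond its leading term, in units of its admissible error. *)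
Definition bias_remainder lam y m : R :=
  `|bias lam y m.-1 ^+ 2 - m%:R ^- 4 * L_const fext J lam y ^+ 2| /
  (m%:R ^- 4 + (J != JT)%:R * m%:R ^- 3).

Lemma bias_remainderE lam y N : `|bias lam y N ^+ 2 - N.+1%:R ^- 4 * L_const fext J lam y ^+ 2| =
  bias_remainder lam y N.+1 * (N.+1%:R ^- 4 + (J != JT)%:R * N.+1%:R ^- 3).
Proof.
by rewrite /bias_remainder divfK // lt0r_neq0.
Qed.

Lemma scaled_bias_cvg lam y : J = JT -> scale_params J lam ->
  (fun N => N.+1%:R ^+ 2 * bias lam y N) @ \oo --> L_const fext J lam y.
Proof.
move=> JE lamJ; have lamT : scale_params JT lam by rewrite -JE.
have ffT z : simplex z -> `|f z - f 0| <= M * (\sum_(i in JT) z 0 i) ^+ 2.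
  by rewrite -JE; exact: f_face.
have key := vertex_bias (y := y) d_gt0 f_density f_supp U_simplex fext_f fext_C2 M0 ffT grad0 lamT.
by rewrite /bias JE; exact: key.
Qed.

Lemma vertex_remainder_cvg lam y : J = JT -> scale_params J lam ->
  bias_remainder lam y @ \oo --> (0 : R).
Proof.
move=> JE lamJ; rewrite -cvg_shiftS; have Lc := @scaled_bias_cvg lam y JE lamJ.
set L := L_const _ _ _ _ in Lc.
have lim : (fun N => `|(N.+1%:R ^+ 2 * bias lam y N) ^+ 2 - L ^+ 2|) @ \oo --> `|L ^+ 2 - L ^+ 2|.
  apply: cvg_norm; apply: cvgB; last exact: cvg_cst.
  by rewrite expr2; under eq_fun do rewrite expr2; exact: cvgM.
rewrite subrr normr0 in lim; apply: cvg_trans lim.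
apply: near_eq_cvg; near=> N; rewrite /bias_remainder /= -/L JE eqxx mul0r addr0.
have m0 : 0 < N.+1%:R ^+ 4 :> R by rewrite exprn_gt0 // ltr0n.
rewrite invrK -[X in _ = _ * X]gtr0_norm // -normrM; congr `|_|.
by field; rewrite lt0r_neq0.
Unshelve. all: by end_near.
Qed.

(** Bias and leading term are both [O(m^-2)], so that their squares are
    [O(m^-4) = o(m^-3)]. *)
Lemma face_remainder_cvg lam y : J != JT -> scale_params J lam -> fixed_coords J y ->
  bias_remainder lam y @ \oo --> (0 : R).
Proof.
move=> JN lamJ yJ; rewrite -cvg_shiftS.
set S := \sum_(u <- long_coords J y) u.
have S1 : S < 1 by have [_ _] := yJ; rewrite -sum_long_coords.
pose La := \sum_(i in J) lam 0 i; have La0 : 0 <= La := La_ge0 lamJ.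
pose A := M * (2 ^+ (d + 2) * expR La + La ^+ 2).
pose K := B * 2 ^+ d; pose L := L_const fext J lam y.
have B0 : 0 <= B := density_bound_ge0 f_density M0.
have A0 : 0 <= A by rewrite mulr_ge0 // addr_ge0 ?sqr_ge0 // mulr_ge0 ?exprn_ge0 ?expR_ge0.
have K0 : 0 <= K by rewrite mulr_ge0 // exprn_ge0.
have c0 : 0 < (1 - S) / 4 by rewrite divr_gt0 // subr_gt0.
have c20 : 0 < 2 * ((1 - S) / 4) by rewrite mulr_gt0.
have K20 : 0 <= 2 * K ^+ 2 by rewrite mulr_ge0 // sqr_ge0.
apply/cvgrPdist_le => e e0; have e20 : 0 < e / 2 by rewrite divr_gt0.
have tail := exp_tail_small 6 c20 e20 K20.
near=> N.
have m0 : 0 < N.+1%:R :> R by rewrite ltr0n.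
have NN : N%:R <= N.+1%:R :> R by rewrite ler_nat.
have big : (2 * A ^+ 2 + L ^+ 2) / (e / 2) <= N.+1%:R.
  by apply: le_trans NN; near: N; exact: nbhs_infty_ger.
have Lam : La / ((1 - S) / 2) <= N.+1%:R.
  by apply: le_trans NN; near: N; exact: nbhs_infty_ger.
have tailN : Num.sqrt N.+1%:R ^+ 6 * (2 * K ^+ 2 * expR (- (2 * ((1 - S) / 4) * N%:R))) <= e / 2.
  by near: N; exact: tail.
have Lm : La / N.+1%:R <= (1 - S) / 2.
  by rewrite ler_pdivrMr // mulrC -ler_pdivrMr // divr_gt0 // subr_gt0.
have sumx : \sum_i near_face J lam y N.+1 0 i = La / N.+1%:R + S.
  by rewrite sum_near_face sum_short_scales.
have half : \sum_i near_face J lam y N.+1 0 i <= (1 + S) / 2.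
  by rewrite sumx; move: Lm; move: (La / _) => p; lra.
have sx : simplex (near_face J lam y N.+1).
  apply/simplexP; split=> [i|]; last by apply: le_trans half _; lra.
  rewrite mxE; have [iJ|iJ] := boolP (i \in J).
    by have [lam0 _] := lamJ; rewrite divr_ge0 // lam0.
  by have [_ /(_ i iJ)/andP[/ltW]] := yJ.
have bb : `|bias lam y N| <= A / N.+1%:R ^+ 2 + K * expR (- ((1 - S) / 4 * N%:R)).
  apply: le_trans (face_bias_le f_density f_supp M0 f_face lamJ sx) _.
  rewrite -/La -/A lerD2l /K -[leRHS]mulrA ler_wpM2l // ler_wpM2l ?exprn_ge0 //.
  rewrite -mulNr expRM_natr lerXn2r ?nnegrE ?expR_ge0 //.
    have [x0 _] := (simplexP _).1 sx.
    by rewrite divr_ge0 // addr_ge0 // sumr_ge0.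
  by apply: le_trans (expR_ge1Dx _); move: half; move: (\sum_i _) => p; lra.
set E := expR _ in bb.
have E0 : 0 <= E by exact: expR_ge0.
have sq : bias lam y N ^+ 2 <= 2 * (A / N.+1%:R ^+ 2) ^+ 2 + 2 * (K * E) ^+ 2.
  rewrite -real_normK ?num_real //; apply: le_trans (_ : (A / N.+1%:R ^+ 2 + K * E) ^+ 2 <= _).
    have T0 := addr_ge0 (divr_ge0 A0 (exprn_ge0 2 (ltW m0))) (mulr_ge0 K0 E0).
    by rewrite lerXn2r ?nnegrE.
  have := sqr_ge0 (A / N.+1%:R ^+ 2 - K * E); rewrite sqrrB sqrrD.
  move: (A / _) (K * E) => s t; lra.
have ge0 : 0 <= bias_remainder lam y N.+1.
  by rewrite mulr_ge0 // invr_ge0 addr_ge0 ?mulr_ge0 // invr_ge0 exprn_ge0.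
rewrite /= sub0r normrN ger0_norm // /bias_remainder JN mul1r ler_pdivrMr; last first.
  by rewrite addr_gt0 // invr_gt0 exprn_gt0.
apply: le_trans (ler_normB _ _) _; rewrite normrX real_normK ?num_real // normrM normrX.
rewrite real_normK ?num_real // normfV [`|_ ^+ 4|]ger0_norm ?exprn_ge0 ?(ltW m0) // -/L.
have part1 : 2 * (A / N.+1%:R ^+ 2) ^+ 2 + N.+1%:R ^- 4 * L ^+ 2 <= e / 2 * N.+1%:R ^- 3.
  have -> : 2 * (A / N.+1%:R ^+ 2) ^+ 2 + N.+1%:R ^- 4 * L ^+ 2 =
      (2 * A ^+ 2 + L ^+ 2) / N.+1%:R * N.+1%:R ^- 3 by field; rewrite lt0r_neq0.
  rewrite ler_wpM2r ?invr_ge0 ?exprn_ge0 ?(ltW m0) //.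
  by rewrite ler_pdivrMr // [leRHS]mulrC -ler_pdivrMr.
have part2 : 2 * (K * E) ^+ 2 <= e / 2 * N.+1%:R ^- 3.
  rewrite ler_pdivlMr ?exprn_gt0 //; apply: le_trans tailN; rewrite le_eqVlt; apply/orP; left.
  apply/eqP; rewrite (_ : 6 = 2 * 3)%N // exprM sqr_sqrtr ?(ltW m0) //.
  have -> : expR (- (2 * ((1 - S) / 4) * N%:R)) = E ^+ 2.
    by rewrite /E -expRM_natl; congr expR; ring.
  by ring.
have m4 : 0 <= e * N.+1%:R ^- 4 by rewrite mulr_ge0 ?(ltW e0) // invr_ge0 exprn_ge0.
rewrite mulrDr; move: sq part1 part2 m4.
move: (N.+1%:R ^- 4 * _) (2 * (A / _) ^+ 2) (2 * (K * E) ^+ 2) (e * _ ^- 4) (N.+1%:R ^- 3).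
by move=> s1 s2 s3 s4 s5; lra.
Unshelve. all: by end_near.
Qed.

Lemma bias_remainder_cvg lam y : scale_params J lam -> fixed_coords J y ->
  bias_remainder lam y @ \oo --> (0 : R).
Proof.
move=> lamJ yJ; have [JE|JN] := eqVneq J JT; first exact: vertex_remainder_cvg.
exact: face_remainder_cvg.
Qed.

(** Both boundary regimes at once: a constant depending on the scales only, and a
    null sequence depending on the other coordinates only. *)
Lemma variance_remainder : exists (C : 'rV[R]_d -> R) (rho : 'rV[R]_d -> nat -> R),
  [/\ forall lam, 0 <= C lam,
      forall y, fixed_coords J y -> rho y @ \oo --> (0 : R) &
      forall lam y N, scale_params J lam -> fixed_coords J y ->
        simplex (near_face J lam y N.+1) ->
        exists e1 e2 : R,
        [/\ sample_variance f N (near_face J lam y N.+1) / variance_scale J N =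
              v_const f J lam y + (e1 + e2 * (J != JT)%:R),
            `|e1| <= C lam / N.+1%:R & `|e2| <= rho y N.+1]].
Proof.
have [JE|JN] := eqVneq J JT.
  have [C CP] := variance_vertex f_density f_supp M0 f_face d_gt0 JE.
  exists (fun lam => `|C lam|), (fun _ _ => 0); split=> [lam|y _|lam y N lamJ yJ sx].
  - exact: normr_ge0.
  - exact: cvg_cst.
  exists (sample_variance f N (near_face J lam y N.+1) / variance_scale J N - v_const f J lam y), 0.
  rewrite normr0 mul0r addr0 addrC subrK; split=> //.
  apply: le_trans (CP lam y N lamJ yJ sx) _; rewrite ler_wpM2r ?invr_ge0 //.
  exact: ler_norm.
have [C CP] := variance_face f_density f_supp M0 f_face d_gt0 JN.
have B0 : 0 <= B := density_bound_ge0 f_density M0.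
have f0 : 0 <= f 0 by have [+ _ _] := f_density; apply.
have /choice[rho rhoP] : forall y, exists rho : nat -> R, fixed_coords J y ->
    [/\ rho @ \oo --> (0 : R), forall N, 0 <= rho N & forall lam N, scale_params J lam ->
      simplex (near_face J lam y N.+1) ->
      variance_error f J lam y N <= `|C lam| / N.+1%:R + rho N].
  move=> y; have [yJ|] := pselect (fixed_coords J y); last by exists (fun=> 0).
  have [||rho rho0 [rho_ge0 rhoP]] := @uniform_modulus R 'rV[R]_d
    (fun lam N => scale_params J lam /\ simplex (near_face J lam y N.+1))
    (fun lam N => variance_error f J lam y N - `|C lam| / N.+1%:R).
  - move=> N; exists ((B + B ^+ 2) * N.+1%:R ^+ d + f 0 * psi (~: J) y) => lam [lamJ sx].
    apply: le_trans (variance_face_far f_density f_supp M0 f_face lamJ yJ sx).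
    by rewrite gerBl divr_ge0.
  - move=> e e0; have near_e := CP y yJ e e0; near=> N => lam [lamJ sx].
    rewrite lerBlDl; apply: le_trans (near near_e N _ lam lamJ sx) _ => //.
    by rewrite lerD2r ler_wpM2r ?invr_ge0 // ler_norm.
  exists rho => _; split=> // lam N lamJ sx.
  by have := rhoP lam N (conj lamJ sx); rewrite lerBlDl.
exists (fun lam => `|C lam|), (fun y m => rho y m.-1).
split=> [lam|y yJ|lam y N lamJ yJ sx]; first exact: normr_ge0.
  by rewrite -cvg_shiftS; have [] := rhoP y yJ.
have [_ rho0 rhoN] := rhoP y yJ.
have Cm : 0 <= `|C lam| / N.+1%:R by rewrite divr_ge0.
have [e1 [e2 [E e1C e2r]]] := split_error Cm (rho0 N) (rhoN lam N lamJ sx).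
exists e1, e2; split=> //.
by rewrite /= mulr1 -E addrC subrK.
Unshelve. all: by end_near.
Qed.

End remainders.

(** * The rate at the optimal bandwidth *)

Section optimal_rate.
Context {R : realType} {d : nat}.
Implicit Types (lam : 'rV[R]_d) (N n m : nat).
Variables (f fext : 'rV[R]_d -> R) (U : set 'rV[R]_d) (M : R).
Hypotheses (d_gt0 : (0 < d)%N).
Hypotheses (f_density : is_density f) (f_supp : supported_on simplex f).
Hypotheses (U_simplex : simplex `<=` U) (fext_f : forall x, simplex x -> fext x = f x)
  (fext_C2 : C2_on U fext).
Local Notation JT := [set: 'I_d]%SET.
Hypotheses (M0 : 0 <= M)
  (f_face : forall z, simplex z -> `|f z - f 0| <= M * (\sum_(i in JT) z 0 i) ^+ 2).
Hypothesis grad0 : forall i, partial i fext 0 = 0.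

Definition vertex_MSE lam n m : R :=
  n%:R^-1 * sample_variance f m.-1 (near_face JT lam 0 m) + bias f JT lam 0 m.-1 ^+ 2.

Lemma fixed_coords0 : fixed_coords JT (0 : 'rV[R]_d).
Proof.
split=> [i _|i|]; rewrite ?mxE ?inE //.
by rewrite big1 // => i _; rewrite mxE.
Qed.

Lemma vertex_simplex_near lam : scale_params JT lam ->
  \forall N \near \oo, simplex (near_face JT lam (0 : 'rV[R]_d) N.+1).
Proof.
move=> [lam0 _]; near=> N; apply/simplexP; split=> [i|].
  by rewrite mxE inE divr_ge0 // lam0 // inE.
have -> : \sum_i near_face JT lam (0 : 'rV[R]_d) N.+1 0 i = (\sum_i lam 0 i) / N.+1%:R.
  by rewrite mulr_suml; apply: eq_bigr => i _; rewrite mxE inE.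
rewrite ler_pdivrMr ?ltr0n // mul1r; apply: (@le_trans _ _ N%:R); last by rewrite ler_nat.
by near: N; exact: nbhs_infty_ger.
Unshelve. all: by end_near.
Qed.

Lemma vertex_variance_cvg lam : scale_params JT lam ->
  (fun N => sample_variance f N (near_face JT lam 0 N.+1) / N.+1%:R ^+ d) @ \oo -->
  v_const f JT lam 0.
Proof.
move=> lamT; have [C CP] := variance_vertex f_density f_supp M0 f_face d_gt0 erefl.
apply/cvgrPdist_le => e e0; near=> N.
have sx : simplex (near_face JT lam (0 : 'rV[R]_d) N.+1).
  by near: N; exact: vertex_simplex_near.
have m0 : 0 < N.+1%:R :> R by rewrite ltr0n.
have := CP lam 0 N lamT fixed_coords0 sx.
have := @variance_scaleM R d JT N; rewrite cardsT card_ord subnn expr0 mulr1 => WE.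
rewrite /variance_error -WE distrC => /le_trans; apply.
rewrite ler_pdivrMr // [leRHS]mulrC -ler_pdivrMr //.
apply: (@le_trans _ _ N%:R); last by rewrite ler_nat.
by near: N; exact: nbhs_infty_ger.
Unshelve. all: by end_near.
Qed.

Lemma vertex_bias_cvg lam : scale_params JT lam ->
  (fun N => N.+1%:R ^+ 2 * bias f JT lam 0 N) @ \oo --> L_const fext JT lam 0.
Proof.
move=> lamT.
exact: (scaled_bias_cvg (y := 0) d_gt0 f_density f_supp U_simplex fext_f fext_C2 M0 f_face grad0 erefl lamT).
Qed.

Lemma v_const_ge0 lam : scale_params JT lam -> 0 <= v_const f JT lam 0.
Proof.
move=> [lam0 _]; have [f0 _ _] := f_density.
rewrite /v_const psi_setT mulr1 mulr_ge0 // prodr_ge0 // => i iJ.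
by apply: ltW; apply: bessel_weight_gt0; exact: lam0.
Qed.

(** The MSE at an integer within distance one of the optimal bandwidth, in units
    of the optimal rate: it only depends on the ratio to the optimum, which tends
    to one. *)
Lemma vertex_MSE_near_opt lam (j : nat -> nat) : scale_params JT lam ->
  let v := v_const f JT lam 0 in let L := L_const fext JT lam 0 in
  v != 0 -> L != 0 ->
  (forall n, `|(j n).+1%:R - m_opt d v L n| <= 1) ->
  (fun n => `|vertex_MSE lam n (j n).+1 - optimal_MSE d v L n| *
    n%:R `^ (4 / (d + 4)%:R)) @ \oo --> (0 : R).
Proof.
move=> lamT v L v_neq0 L_neq0 jopt.
have v_gt0 : 0 < v by rewrite lt_neqAle eq_sym v_neq0 v_const_ge0.
pose s n := m_opt d v L n.
have s_cvg : s @ \oo --> +oo by exact: m_opt_cvg.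
have j_cvg : j @ \oo --> \oo.
  apply/cvgnyPge => A; move/cvgryPge : s_cvg => /(_ (A.+2%:R)) sA.
  near=> n; have sAn : A.+2%:R <= s n by near: n.
  have := jopt n; rewrite ler_norml => /andP[le _].
  rewrite -ltnS -(ltr_nat R); move: sAn le; rewrite /s -addn2 natrD; lra.
have V_cvg := cvg_comp _ _ j_cvg (vertex_variance_cvg lamT).
have b_cvg := cvg_comp _ _ j_cvg (vertex_bias_cvg lamT).
have s_gt0 n : (0 < n)%N -> 0 < s n by move=> n0; exact: m_opt_gt0.
have inv_cvg : (fun n => (s n)^-1) @ \oo --> (0 : R).
  apply/gtr0_cvgV0; last exact: s_cvg.
  by near=> n; apply: s_gt0; near: n; exact: nbhs_infty_gt.
pose t n := (j n).+1%:R / s n.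
have t_cvg : t @ \oo --> (1 : R).
  apply/cvgrPdist_le => e e0; move/cvgrPdist_le : inv_cvg => /(_ e e0) inv_e.
  near=> n; have sn : 0 < s n by apply: s_gt0; near: n; exact: nbhs_infty_gt.
  have : `|0 - (s n)^-1| <= e by near: n.
  rewrite sub0r normrN gtr0_norm ?invr_gt0 // distrC /t; apply: le_trans.
  rewrite -[X in _ - X](divff (lt0r_neq0 sn)) -mulrBl normrM normfV (gtr0_norm sn).
  by rewrite ler_piMl ?invr_ge0 ?(ltW sn).
have power_cvg (u : nat -> R) k : u @ \oo --> (1 : R) -> (fun n => u n ^+ k) @ \oo --> (1 : R).
  move=> uc; elim: k => [|k IH]; first by under eq_fun do rewrite expr0; exact: cvg_cst.
  by have := cvgM uc IH; rewrite mulr1 => h; under eq_fun do rewrite exprS; exact: h.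
have tV_cvg : (fun n => (t n)^-1) @ \oo --> (1 : R).
  by rewrite -[X in _ --> X]invr1; apply: cvgV => //; exact: oner_neq0.
pose kap := expR ((d + 4)%:R^-1 * (ln (L ^+ 2) - ln (d%:R / 4) - ln v)).
(* [g] is the mean square error in units of the optimal rate: [rate_scaled] with the
   variance and bias replaced by their convergent normalizations. *)
pose g n := kap ^+ d * t n ^+ d *
    (sample_variance f (j n) (near_face JT lam 0 (j n).+1) / (j n).+1%:R ^+ d) +
  kap ^- 4 * (t n)^-1 ^+ 4 * ((j n).+1%:R ^+ 2 * bias f JT lam 0 (j n)) ^+ 2.
have g_cvg : g @ \oo --> kap ^+ d * 1 * v + kap ^- 4 * 1 * (L * L).
  apply: cvgD; apply: cvgM.
  - by apply: cvgMr; exact: power_cvg.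
  - exact: V_cvg.
  - by apply: cvgMr; exact: power_cvg.
  - by under eq_fun do rewrite expr2; apply: cvgM; exact: b_cvg.
have lim : (fun n => `|g n - (kap ^+ d * 1 * v + kap ^- 4 * 1 * (L * L))|) @ \oo -->
    `|(kap ^+ d * 1 * v + kap ^- 4 * 1 * (L * L)) - (kap ^+ d * 1 * v + kap ^- 4 * 1 * (L * L))|.
  by apply: cvg_norm; apply: cvgB => //; exact: cvg_cst.
rewrite subrr normr0 in lim.
apply: cvg_trans lim; apply: near_eq_cvg; near=> n.
have n0 : (0 < n)%N by near: n; exact: nbhs_infty_gt.
have m0 : 0 < (j n).+1%:R :> R by rewrite ltr0n.
have rate0 : 0 <= n%:R `^ (4 / (d + 4)%:R) :> R by exact: powR_ge0.
rewrite -[X in _ = _ * X]ger0_norm // -normrM; congr `|_|; rewrite mulrBl; congr (_ - _).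
  rewrite [RHS]mulrC.
  have -> : vertex_MSE lam n (j n).+1 = n%:R^-1 * ((j n).+1%:R ^+ d *
      (sample_variance f (j n) (near_face JT lam 0 (j n).+1) / (j n).+1%:R ^+ d)) +
      (j n).+1%:R ^- 4 * ((j n).+1%:R ^+ 2 * bias f JT lam 0 (j n)) ^+ 2.
    rewrite /vertex_MSE /=; congr (_ * _ + _).
      by rewrite [RHS]mulrC divfK // expf_neq0 // lt0r_neq0.
    by rewrite exprMn -exprM mulrA mulVf ?mul1r // expf_neq0 // lt0r_neq0.
  rewrite (rate_scaled d_gt0 v_gt0 L_neq0 _ _ n0 m0) -/kap -/(s n) /g /t.
  by rewrite -[in RHS](invf_div (j n).+1%:R (s n)).
rewrite [RHS]mulrC -leading_optimal // /leading_terms.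
rewrite -[n%:R^-1 * _ * v]mulrA (rate_scaled d_gt0 v_gt0 L_neq0 _ _ n0 (s_gt0 n n0)) -/kap.
by rewrite divff ?lt0r_neq0 ?s_gt0 // !expr1n expr2.
Unshelve. all: by end_near.
Qed.

End optimal_rate.

(** The two integers next to a nonnegative real; the shift by one matters below one,
    where the integer part is not an admissible bandwidth. *)
Lemma near_integers (R : realType) (s : R) (m : nat) : 0 <= s -> (0 < m)%N ->
  `|m%:R - s| < 1 -> m = (Num.truncn s).-1.+1 \/ m = (Num.truncn s).+1.
Proof.
move=> s0 m0 ms; have /andP[lo hi] := truncn_itv s0.
move: ms; rewrite ltr_norml => /andP[a b].
set t := Num.truncn s in lo hi *.
have h1 : (m < t.+2)%N by rewrite -(ltr_nat R) -[t.+2]addn1 natrD; lra.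
have h2 : (t < m.+1)%N by rewrite -(ltr_nat R) -[m.+1]addn1 natrD; lra.
lia.
Qed.

Lemma truncn_dist (R : realType) (s : R) : 0 <= s ->
  `|(Num.truncn s).-1.+1%:R - s| <= 1 /\ `|(Num.truncn s).+1%:R - s| <= 1.
Proof.
move=> s0; have /andP[] := truncn_itv s0; set t := Num.truncn s => lo hi.
have t1 : t.+1%:R = t%:R + 1 :> R by rewrite -natr1.
split; rewrite ler_norml; apply/andP; split; try lra.
- by case: t lo hi t1 => [|t] /= lo hi t1; lra.
- by case: t lo hi t1 => [|t] /= lo hi t1; lra.
Qed.

Theorem corollary2 (R : realType) (d : nat) (d_gt0 : (0 < d)%N)
    (f fext : 'rV[R]_d -> R) (U : set 'rV[R]_d) (J : {set 'I_d})
    (f_density : is_density f)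
    (f_supp : supported_on simplex f)
    (f_C2 : C2_on simplex_interior f)
    (U_open : open U)
    (U_simplex : simplex `<=` U)
    (fext_f : forall x, simplex x -> fext x = f x)
    (fext_C2 : C2_on U fext)
    (grad0 : forall x, simplex x -> forall i : 'I_d,
       partial i fext (zero_on J x) = 0)
    (hess0 : forall x, simplex x -> forall i j : 'I_d,
       i \notin J -> j \notin J ->
       partial i (partial j fext) (zero_on J x) = 0) :
  exists (C : 'rV[R]_d -> R) (rho : 'rV[R]_d -> nat -> R)
         (sigma : 'rV[R]_d -> 'rV[R]_d -> nat -> R) (tau : 'rV[R]_d -> nat -> R),
  [/\ forall y, fixed_coords J y -> rho y @ \oo --> (0 : R),
      forall lam y, scale_params J lam -> fixed_coords J y ->
        sigma lam y @ \oo --> (0 : R),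
      forall lam, scale_params J lam -> tau lam @ \oo --> (0 : R) &
      forall (disp : measure_display) (T : measurableType disp)
             (P : probability T R) (X : nat -> {RV P >-> d.-tuple (measurableTypeR R)}),
      iid_sample X f ->
      forall lam y, scale_params J lam -> fixed_coords J y ->
      (forall m : nat -> nat, m @ \oo --> \oo ->
       forall n : nat, (0 < n)%N -> (0 < m n)%N ->
       simplex (near_face J lam y (m n)) ->
       exists e1 e2 e3 : R,
       [/\ MSE X f n (m n) (near_face J lam y (m n)) =
           (n%:R^-1 * (m n)%:R `^ ((d + #|J|)%:R / 2) * v_const f J lam y +
            (m n)%:R ^- 4 * L_const fext J lam y ^+ 2 +
            n%:R^-1 * (m n)%:R `^ ((d + #|J|)%:R / 2) *
              (e1 + e2 * (J != [set: 'I_d]%SET)%:R) + e3)%:E,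
           `|e1| <= C lam * (m n)%:R^-1,
           `|e2| <= rho y (m n) &
           `|e3| <= sigma lam y (m n) *
             ((m n)%:R ^- 4 + (J != [set: 'I_d]%SET)%:R * (m n)%:R ^- 3)]) /\
      (J = [set: 'I_d]%SET ->
       let v := v_const f J lam 0 in let L := L_const fext J lam 0 in
       v != 0 -> L != 0 ->
       (forall n : nat, (0 < n)%N ->
          0 < m_opt d v L n /\
          forall s : R, 0 < s -> s != m_opt d v L n ->
            leading_terms d v L n (m_opt d v L n) <
            leading_terms d v L n s) /\
       (forall m : nat -> nat,
          (forall n, `|(m n)%:R - m_opt d v L n| < 1) ->
        forall n : nat, (0 < n)%N -> (0 < m n)%N ->
        simplex (near_face J lam y (m n)) ->
        exists e : R,
          MSE X f n (m n) (near_face J lam y (m n)) =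
            (optimal_MSE d v L n + e)%:E /\
          `|e| <= tau lam n * n%:R `^ (- (4 / (d + 4)%:R))))].
Proof.
have [M M0 face_ext] := quadratic_near_face U_simplex fext_C2 grad0.
have f_face z : simplex z -> `|f z - f 0| <= M * (\sum_(i in J) z 0 i) ^+ 2.
  by move=> sz; rewrite -(fext_f _ sz) -(fext_f _ (@simplex0 R d)); exact: face_ext.
have grad00 i : partial i fext 0 = 0.
  have := grad0 0 (@simplex0 R d) i; rewrite (_ : zero_on J 0 = 0) //.
  by apply/rowP => l; rewrite zero_onE mxE; case: ifP.
have [C [rho [C0 rho_cvg variance]]] := variance_remainder d_gt0 f_density f_supp M0 f_face.
pose s (lam : 'rV[R]_d) n := m_opt d (v_const f J lam 0) (L_const fext J lam 0) n.
have s_ge0 lam n : 0 <= s lam n.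
  by rewrite divr_ge0 ?powR_ge0 // mulr_ge0 // powR_ge0.
pose opt (lam : 'rV[R]_d) n := optimal_MSE d (v_const f J lam 0) (L_const fext J lam 0) n.
(* The error of the rounded optimal bandwidth is the sum over both ways of rounding. *)
pose tau (lam : 'rV[R]_d) n : R :=
  if (J == [set: 'I_d]%SET) && ((v_const f J lam 0 != 0) && (L_const fext J lam 0 != 0)) then
    `|vertex_MSE f lam n (Num.truncn (s lam n)).-1.+1 - opt lam n| * n%:R `^ (4 / (d + 4)%:R) +
    `|vertex_MSE f lam n (Num.truncn (s lam n)).+1 - opt lam n| * n%:R `^ (4 / (d + 4)%:R)
  else 0.
exists C, rho, (bias_remainder f fext J), tau; split=> //.
- move=> lam y lamJ yJ.
  exact: (bias_remainder_cvg d_gt0 f_density f_supp U_simplex fext_f fext_C2 M0 f_face grad00).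
- move=> lam lamJ; rewrite /tau.
  have [JE|] := eqVneq J [set: 'I_d]%SET; last by move=> _; exact: cvg_cst.
  have [/andP[v0 L0]|_] := boolP ((v_const f J lam 0 != 0) && (L_const fext J lam 0 != 0));
    last exact: cvg_cst.
  rewrite /opt; subst J.
  have key j jP := vertex_MSE_near_opt d_gt0 f_density f_supp U_simplex fext_f fext_C2 M0
    f_face grad00 (j := j) lamJ v0 L0 jP.
  rewrite -[X in _ --> X]addr0; apply: cvgD.
    by apply: (key (fun n => (Num.truncn (s lam n)).-1)) => n; case: (truncn_dist (s_ge0 lam n)).
  by apply: (key (fun n => Num.truncn (s lam n))) => n; case: (truncn_dist (s_ge0 lam n)).
- move=> disp T P X Xf lam y lamJ yJ; split.
    move=> m m_cvg n n0 m0; case: (m n) m0 => // N _ sx.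
    have [e1 [e2 [varE e1C e2r]]] := variance lam y N lamJ yJ sx.
    pose b := bias f J lam y N.
    exists e1, e2, (b ^+ 2 - N.+1%:R ^- 4 * L_const fext J lam y ^+ 2); split=> //.
      rewrite (MSE_moments _ _ Xf n0) -/(bias f J lam y N) -/b -/(variance_scale J N).
      have W0 : @variance_scale R d J N != 0.
        by rewrite lt0r_neq0 // (lt_le_trans ltr01 (@variance_scale_ge1 R d J N)).
      congr EFin; rewrite -[sample_variance _ _ _](divfK W0) varE.
      by move: (_ ^- 4 * _) => u; ring.
    by rewrite (bias_remainderE f fext J lam y N).
  move=> JE v L v0 L0; subst J.
  have v_gt0 : 0 < v by rewrite lt_neqAle eq_sym v0 (v_const_ge0 f_density lamJ).
  split=> [n n0|m ms n n0 m0 sx].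
    split; first exact: m_opt_gt0.
    by move=> t t0 tm; exact: m_opt_strict.
  have y0 : y = 0 by apply/rowP => i; have [yJ0 _ _] := yJ; rewrite yJ0 ?inE // mxE.
  rewrite y0 in sx *.
  exists (vertex_MSE f lam n (m n) - opt lam n); split.
    case: (m n) m0 sx => // N _ sx; rewrite (MSE_moments _ _ Xf n0); congr EFin.
    by transitivity (vertex_MSE f lam n N.+1); rewrite // [RHS]addrC subrK.
  have nR : 0 < n%:R :> R by rewrite ltr0n.
  rewrite powRN ler_pdivlMr ?powR_gt0 // /tau eqxx v0 L0 /=.
  have [-> | ->] := near_integers (s_ge0 lam n) m0 (ms n); rewrite ?lerDl ?lerDr.
    by rewrite mulr_ge0 ?powR_ge0.
  by rewrite mulr_ge0 ?powR_ge0.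
Qed.
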